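(* Let $C_0$ be a copula satisfying the nondegeneracy condition ($C_0^{\mathbb{S},2}(\sigma,\sigma)-C_0^{\mathbb{S}}(\sigma)^2\neq0$ for some $\sigma\in\mathbb{S}$), fix $\alpha\in(0,1)$, and for a random permutation $\Pi_n$ generated by an i.i.d. sample of size $n$ from a copula $C$ let $\mathrm{KS}^{GF}_n=\sqrt{n}\max_{\sigma\in\mathbb{S}^{\le}_n}p_\sigma^{1/2}|\sigma|^{-1}\bigl|t(\Pi_n,\sigma)-C_0^{\mathbb{S}}(\sigma)\bigr|$, with $q_{n,\alpha}=\inf\{t:P_{C_0}(\mathrm{KS}^{GF}_n>t)\le\alpha\}$ its upper $\alpha$-quantile when $C=C_0$. Then $\lim_{n\to\infty}P_{C_0}(\mathrm{KS}^{GF}_n\ge q_{n,\alpha})=\alpha$ and $\lim_{n\to\infty}P_C(\mathrm{KS}^{GF}_n\ge q_{n,\alpha})=1$ for every copula $C\neq C_0$.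
   Context: $\mathbb{S}_k$: permutations of $[k]$; $\mathbb{S}=\bigsqcup_k\mathbb{S}_k$; $|\sigma|=k$ for $\sigma\in\mathbb{S}_k$; $\mathbb{S}^{\le}_n=\bigsqcup_{j=1}^n\mathbb{S}_j$. For $\pi\in\mathbb{S}_n$, $\sigma\in\mathbb{S}_j$ ($j\le n$), $t(\pi,\sigma)$ is the proportion of $j$-element subsets $\{i_1<\dots<i_j\}\subset[n]$ with $(\pi(i_1),\dots,\pi(i_j))$ order-isomorphic to $(\sigma(1),\dots,\sigma(j))$. A copula is the distribution function of a probability measure on $[0,1]^2$ with uniform marginals. For points $(u_i,v_i)$, $i\le n$, without ties in either coordinate, $\Pi_n$ is the unique $\pi\in\mathbb{S}_n$ with $u_i<u_j\iff v_{\pi(i)}<v_{\pi(j)}$. For a copula $C$ and independent $Z_1,Z_2,Z_2',\dots$ with distribution function $C$: $C^{\mathbb{S}}(\sigma)=\mathbb{P}(\Pi_k(Z_1,\dots,Z_k)=\sigma)$ and $C^{\mathbb{S},2}(\sigma,\tau)=\mathbb{P}(\Pi_k(Z_1,Z_2,\dots,Z_k)=\sigma,\Pi_j(Z_1,Z_2',\dots,Z_j')=\tau)$. Weights $p_\sigma=\gamma\,|\sigma|!^{-2}2^{-|\sigma|}$, $\gamma=e^{-1/2}(1-e^{-1/2})^{-1}$.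
   Formalization: Π_n is taken as the standard pattern (the point of u-rank r has v-rank π(r)); with the formula u_i<u_j ⟺ v_{π(i)}<v_{π(j)} for unsorted points, the law of Π_n is the same for C_0 and its transpose, so the second limit would fail. *)

(* Defs.v *)
From HB Require Import structures.
From mathcomp Require Import all_boot all_order all_algebra all_fingroup.
From mathcomp Require Import all_classical all_reals all_analysis.
Set Implicit Arguments. Unset Strict Implicit. Unset Printing Implicit Defensive.
Import Order.TTheory GRing.Theory Num.Theory.
Local Open Scope ring_scope.
Local Open Scope classical_set_scope.

Section Copulas.
Variable R : realType.
Local Notation pt := (R * R)%type.

(* A copula is (the distribution function of) a probability measure on
   [0,1]^2 with uniform marginals; we carry the measure. *)
Definition clamp01 (u : R) : R := Num.min 1 (Num.max 0 u).

Definition is_copula (mu : probability pt R) : Prop :=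
  (forall u : R, mu [set z : pt | z.1 <= u] = (clamp01 u)%:E) /\
  (forall u : R, mu [set z : pt | z.2 <= u] = (clamp01 u)%:E).

Definition copula_fun (mu : probability pt R) (u v : R) : R :=
  fine (mu [set z : pt | z.1 <= u /\ z.2 <= v]).

(* iterated integral over an i.i.d. sample of size n from mu:
   iprod mu n f = E[f(Z_1,...,Z_n)] (Tonelli) *)
Fixpoint iprod (mu : probability pt R) (n : nat)
    (f : seq pt -> \bar R) : \bar R :=
  match n with
  | 0 => f [::]
  | n'.+1 => (\int[mu]_z iprod mu n' (fun s => f (z :: s)))%E
  end.

Definition sampleP (mu : probability pt R) (n : nat) (E : seq pt -> bool)
  : \bar R := iprod mu n (fun s => (E s)%:R%:E).

Definition z0 : pt := (0, 0).

Definition noties (s : seq pt) : bool :=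
  [forall i : 'I_(size s), forall j : 'I_(size s),
     (i != j) ==> ((nth z0 s i).1 != (nth z0 s j).1)
                  && ((nth z0 s i).2 != (nth z0 s j).2)].

Definition rank1 (s : seq pt) (i : nat) : nat :=
  count (fun z => z.1 < (nth z0 s i).1) s.
Definition rank2 (s : seq pt) (i : nat) : nat :=
  count (fun z => z.2 < (nth z0 s i).2) s.

(* Pi_k(s) = sigma : the point whose first coordinate has rank r
   has second coordinate of rank sigma(r) (ranks counted from 0). *)
(* sigma viewed as a map on nat (identity outside [0,k)) *)
Definition permn (k : nat) (sigma : 'S_k) (r : nat) : nat :=
  oapp (fun i : 'I_k => val (sigma i)) r (insub r).

Definition has_pattern (k : nat) (sigma : 'S_k) (s : seq pt) : bool :=
  (size s == k) && noties s &&
  [forall i : 'I_k, permn sigma (rank1 s i) == rank2 s i].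

Definition CS (mu : probability pt R) (k : nat) (sigma : 'S_k) : R :=
  fine (sampleP mu k (has_pattern sigma)).

(* C^{S,2}(sigma,tau) for sigma in S_k, tau in S_j (k, j >= 1): sample
   Z_1, Z_2..Z_k, Z_2'..Z_j' *)
Definition CS2 (mu : probability pt R) (k j : nat) (sigma : 'S_k) (tau : 'S_j)
  : R :=
  fine (sampleP mu (k + j - 1)
    (fun s => has_pattern sigma (take k s) &&
              has_pattern tau (take 1 s ++ drop k s))).

Definition pos_in (n : nat) (I : {set 'I_n}) (x : 'I_n) : nat :=
  #|[set y in I | (y < x)%N]|.

Definition occurs_at (n j : nat) (pi : 'S_n) (sigma : 'S_j) (I : {set 'I_n})
  : bool :=
  [forall x in I, forall y in I,
     (pi x < pi y)%N ==
     (permn sigma (pos_in I x) < permn sigma (pos_in I y))%N].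

Definition tdens (n j : nat) (pi : 'S_n) (sigma : 'S_j) : R :=
  #|[set I : {set 'I_n} | (#|I| == j) && occurs_at pi sigma I]|%:R
  / 'C(n, j)%:R.

Definition gamma_w : R := expR (- 2^-1) / (1 - expR (- 2^-1)).
Definition pw (j : nat) : R := gamma_w / ((j`!)%:R ^+ 2 * 2 ^+ j).

Definition KSGF (mu0 : probability pt R) (n : nat) (pi : 'S_n) : R :=
  Num.sqrt n%:R *
  \big[Num.max/0]_(j < n.+1 | (0 < j)%N)
    \big[Num.max/0]_(sigma : 'S_j)
       (Num.sqrt (pw j) / j%:R * `|tdens pi sigma - CS mu0 sigma|).

Definition KS_event (mu0 : probability pt R) (n : nat) (P : R -> bool)
  (s : seq pt) : bool :=
  [exists pi : 'S_n, has_pattern pi s && P (KSGF mu0 pi)].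

Definition qalpha (mu0 : probability pt R) (alpha : R) (n : nat) : R :=
  inf [set t : R | (sampleP mu0 n (KS_event mu0 n (fun x => (t < x)%R))
                     <= alpha%:E)%E].

Definition nondegenerate_copula (mu0 : probability pt R) : Prop :=
  exists k (sigma : 'S_k), (0 < k)%N /\
    CS2 mu0 sigma sigma - CS mu0 sigma ^+ 2 != 0.

End Copulas.

(* Main.v *)
(* Let U_sigma be the density of the pattern sigma in the sample, a U-statistic
   with mean C^S(sigma). By definition of the quantile, P(KS > q) <= alpha <=
   P(KS >= q), so the first limit only requires that KS has asymptotically no
   atoms: no functional limit theorem is needed. If KS = x > 0, some sigma
   attains the maximum. Chebyshev and n Var(U_sigma) <= |sigma|^2 make the long
   patterns negligible uniformly in n, and for the finitely many remaining
   sigma one shows P(sqrt n w |U_sigma - C^S(sigma)| = x) -> 0 for x >= delta: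
   in the degenerate case sqrt n (U_sigma - C^S(sigma)) -> 0 in L^2, otherwise
   U_sigma has vanishing small ball probabilities at scale 1/sqrt n. The latter
   also deals with x < delta, through a nondegenerate pattern. The small ball
   bound follows from Hoeffding's projection, U_sigma = C^S(sigma) +
   (k/n) sum_i (h(Z_i) - C^S(sigma)) + O_{L^2}(1/n), by symmetrising
   sum_i h(Z_i) (replace Z_i by an independent copy with probability 1/2) and
   applying the Littlewood-Offord-Erdos inequality.

   For the second limit, the same Chebyshev bound gives q <= sqrt(gamma/alpha),
   while U_sigma tends to C^S(sigma) <> C_0^S(sigma) for some sigma: the pattern
   probabilities determine the copula, since the expected empirical copula of
   Pi_k is a function of them and converges to C at rate 1/sqrt k. *)
Require Import Defs.
From HB Require Import structures.
From mathcomp Require Import all_boot all_order all_algebra all_fingroup.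
From mathcomp Require Import all_classical all_reals all_analysis.
From mathcomp Require Import measurable_realfun.
From mathcomp Require Import zify ring lra.
Import Order.TTheory GRing.Theory Num.Theory.
Local Open Scope ring_scope.
Local Open Scope classical_set_scope.

(** * Integration over an i.i.d. sample *)

(** The quantile moves with n, so the atoms have to be bounded uniformly in the level x. The
    obstacle is degenerate patterns: their rescaled deviations may have large atoms near 0, and the
    pattern of length 1 even has all its mass there. Levels x >= delta avoid these atoms, and a
    single nondegenerate pattern keeps the maximum away from smaller levels. The weights fit this
    argument: the factor 1/|sigma| cancels the variance bound |sigma|^2, and the |sigma|! patterns
    of length j have total weight gamma / (j! 2^j), which is summable in j. Independence is used in
    operator form. Integrating out one coordinate is an idempotent operator on functions of an
    infinite sequence, and by Fubini these operators commute. Conditional expectations are their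
    compositions, and independence of a group of coordinates means that a function ignores them. *)

Section Sampling.
Set Implicit Arguments.
Unset Strict Implicit.
Context d (S : measurableType d) (R : realType) (mu : probability S R).
Implicit Types (w : nat -> S) (l : seq nat) (f g : (nat -> S) -> R).

(* Measurability of a function of the whole sample is tested along arbitrary
   families of measurable coordinates; this avoids a sigma-algebra on [nat -> S]
   and, with [T := T * S], is stable under integrating out a coordinate. *)
Definition sample_measurable d' (U : measurableType d') (f : (nat -> S) -> U)
    : Prop :=
  forall d1 (T : measurableType d1) (X : nat -> T -> S),
    (forall i, measurable_fun setT (X i)) ->
    measurable_fun setT (fun t => f (X^~ t)).

(** Boundedness makes every integral finite, so linearity and Fubini hold in [R] without
    integrability side conditions. *)
Definition nice f : Prop :=
  sample_measurable f /\ exists M, forall w, `|f w| <= M.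

Definition upd w i z : nat -> S := fun j => if j == i then z else w j.

Lemma upd_eq w i z : upd w i z i = z.
Proof. by rewrite /upd eqxx. Qed.

Lemma upd_neq w i z j : j != i -> upd w i z j = w j.
Proof. by rewrite /upd => /negbTE ->. Qed.

Lemma upd_upd w i z z' : upd (upd w i z) i z' = upd w i z'.
Proof. by apply/funext => j; rewrite /upd; case: eqP. Qed.

Lemma updC w i j z z' : i != j ->
  upd (upd w i z) j z' = upd (upd w j z') i z.
Proof.
move=> ij; apply/funext => k; rewrite /upd; case: (eqVneq k j) => // ->.
by rewrite eq_sym (negbTE ij).
Qed.

Lemma nice_cst (c : R) : nice (fun=> c).
Proof.
split; last by exists `|c|.
by move=> d1 T X mX; exact: measurable_cst.
Qed.

Lemma niceD f g : nice f -> nice g -> nice (fun w => f w + g w).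
Proof.
move=> [mf [M fM]] [mg [N gN]]; split.
  by move=> d1 T X mX; apply: measurable_funD; [exact: mf|exact: mg].
by exists (M + N) => w; rewrite (le_trans (ler_normD _ _))// lerD.
Qed.

Lemma niceM f g : nice f -> nice g -> nice (fun w => f w * g w).
Proof.
move=> [mf [M fM]] [mg [N gN]]; split.
  by move=> d1 T X mX; apply: measurable_funM; [exact: mf|exact: mg].
by exists (M * N) => w; rewrite normrM ler_pM.
Qed.

Lemma niceZ (c : R) f : nice f -> nice (fun w => c * f w).
Proof. by apply: niceM; exact: nice_cst. Qed.

Lemma niceN f : nice f -> nice (fun w => - f w).
Proof.
by move=> /(niceZ (-1)); congr nice; apply/funext => w; rewrite mulN1r.
Qed.

Lemma niceB f g : nice f -> nice g -> nice (fun w => f w - g w).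
Proof. by move=> nf ng; apply: niceD => //; exact: niceN. Qed.

Lemma nice_sum (I : Type) (r : seq I) (P : pred I) (F : I -> (nat -> S) -> R) :
  (forall i, P i -> nice (F i)) -> nice (fun w => \sum_(i <- r | P i) F i w).
Proof.
move=> nF; elim: r => [|i r IH].
  by under [X in nice X]eq_fun do rewrite big_nil; exact: nice_cst.
under [X in nice X]eq_fun do rewrite big_cons.
by case: (boolP (P i)) => // Pi; apply: niceD => //; exact: nF.
Qed.

Lemma nice_bool (E : (nat -> S) -> bool) :
  sample_measurable E -> nice (fun w => (E w)%:R).
Proof.
move=> mE; split; last first.
  by exists 1 => w; case: (E w); rewrite /= ?normr1 ?normr0.
move=> d1 T X mX.
rewrite (_ : (fun _ => _) = (fun t => if E (X^~ t) then 1 else 0 : R)).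
  by apply: measurable_fun_ifT => //; exact: mE.
by apply/funext => t; case: (E _).
Qed.

Lemma measurable_upd d1 (T : measurableType d1) (X : nat -> T -> S)
    (Z : T -> S) i :
  (forall j, measurable_fun setT (X j)) -> measurable_fun setT Z ->
  forall j, measurable_fun setT (fun t => upd (X^~ t) i (Z t) j).
Proof. by move=> mX mZ j; rewrite /upd; case: eqP => _. Qed.

Lemma measurable_fun_upd f w i : sample_measurable f ->
  measurable_fun setT (fun z => f (upd w i z)).
Proof.
move=> mf; apply: (mf _ _ (fun j z => upd w i z j)).
by apply: (measurable_upd (X := fun j _ => w j)) => // j; exact: measurable_cst.
Qed.

Lemma nice_integrable f w i : nice f ->
  mu.-integrable setT (EFin \o (fun z => f (upd w i z))).
Proof.
move=> [mf [M fM]]; apply: measurable_bounded_integrable => //.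
- by rewrite [ltLHS]probability_setT ltry.
- exact: measurable_fun_upd.
- exists M; split; first exact: num_real.
  by move=> x Mx y _ /=; rewrite (le_trans (fM _))// ltW.
Qed.

(** The conditional expectation given all coordinates but [i]. It is again a function of the whole
    sequence, so that these operators compose. *)
Definition Ecoord i f w : R := \int[mu]_z f (upd w i z).

Lemma Ecoord_fin i f w : nice f ->
  (Ecoord i f w)%:E = (\int[mu]_z (f (upd w i z))%:E)%E.
Proof.
by move=> nf; rewrite /Ecoord /Rintegral fineK// integrable_fin_num//;
  exact: nice_integrable.
Qed.

Lemma Ecoord_cst i (c : R) w : Ecoord i (fun=> c) w = c.
Proof.
rewrite /Ecoord Rintegral_cst// [X in fine X](_ : _ = 1%E) ?mulr1//.
exact: probability_setT.
Qed.

Lemma EcoordD i f g w : nice f -> nice g ->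
  Ecoord i (fun w => f w + g w) w = Ecoord i f w + Ecoord i g w.
Proof. by move=> nf ng; rewrite /Ecoord RintegralD//; exact: nice_integrable. Qed.

Lemma EcoordZ i (c : R) f w : nice f ->
  Ecoord i (fun w => c * f w) w = c * Ecoord i f w.
Proof. by move=> nf; rewrite /Ecoord RintegralZl//; exact: nice_integrable. Qed.

Lemma le_Ecoord i f g w : nice f -> nice g -> (forall w, f w <= g w) ->
  Ecoord i f w <= Ecoord i g w.
Proof.
by move=> nf ng fg; apply: le_Rintegral => //; exact: nice_integrable.
Qed.

Lemma nice_Ecoord i f : nice f -> nice (Ecoord i f).
Proof.
move=> nf; have [mf [M fM]] := nf; split; last first.
  exists M => w; rewrite ler_norml -[X in _ <= _ <= X](Ecoord_cst i M w).
  rewrite -[X in X <= _ <= _](Ecoord_cst i (- M) w).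
  have h v : - M <= f v <= M by rewrite -ler_norml.
  by rewrite !le_Ecoord//; try exact: nice_cst; move=> v;
    have /andP[] := h v.
move=> d1 T X mX.
(* Adding [M] makes the integrand nonnegative, as Tonelli's measurability statement requires. *)
have -> : (fun t => Ecoord i f (X^~ t)) =
    (fun t => fine (\int[mu]_z (f (upd (X^~ t) i z) + M)%:E)%E - M).
  apply/funext => t.
  have := EcoordD i (X^~ t) nf (nice_cst M).
  by rewrite Ecoord_cst => /eqP; rewrite -subr_eq => /eqP <-.
apply: measurable_funB; last exact: measurable_cst.
apply: (measurableT_comp (f := fine)) => //.
apply: (measurable_fun_fubini_tonelli_F
   (fun tz : T * S => (f (upd (X^~ tz.1) i tz.2) + M)%:E)) => [|[t z]] /=; last first.
  by rewrite lee_fin -lerBlDr sub0r; have := fM (upd (X^~ t) i z);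
    rewrite ler_norml => /andP[].
apply/measurable_EFinP/measurable_funD; last exact: measurable_cst.
apply: (mf _ _ (fun j (tz : T * S) => upd (X^~ tz.1) i tz.2 j)).
apply: (measurable_upd (X := fun j (tz : T * S) => X j tz.1)) => //.
by move=> j; apply: measurableT_comp (mX j) _; exact: measurable_fst.
Qed.

Lemma EcoordC i j f : nice f -> Ecoord i (Ecoord j f) = Ecoord j (Ecoord i f).
Proof.
move=> nf; case: (eqVneq i j) => [->//|ij].
have [mf [M fM]] := nf.
apply/funext => w; apply: EFin_inj.
rewrite !Ecoord_fin; [|exact: nice_Ecoord|exact: nice_Ecoord].
under eq_integral do rewrite Ecoord_fin//.
under [RHS]eq_integral do (rewrite Ecoord_fin//;
  under eq_integral do rewrite updC 1?eq_sym//).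
apply: (Fubini (f := fun zz : S * S => (f (upd (upd w i zz.1) j zz.2))%:E)).
apply: (@measurable_bounded_integrable _ _ _ _
  (fun zz : S * S => f (upd (upd w i zz.1) j zz.2))) => //.
- rewrite -setXTT [ltLHS]product_measure1E//=.
  by rewrite (_ : mu setT = 1%E) ?mule1 ?ltry//; exact: probability_setT.
- apply: (mf _ _ (fun k (zz : S * S) => upd (upd w i zz.1) j zz.2 k)).
  apply: measurable_upd => //.
  apply: (measurable_upd (X := fun k _ => w k)) => // k; exact: measurable_cst.
- exists M; split; first exact: num_real.
  by move=> x Mx y _ /=; rewrite (le_trans (fM _))// ltW.
Qed.

Lemma Ecoord_idem i f : Ecoord i (Ecoord i f) = Ecoord i f.
Proof.
apply/funext => w; rewrite {1}/Ecoord.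
under eq_Rintegral => z _.
  rewrite (_ : Ecoord i f (upd w i z) = Ecoord i f w).
    over.
  by apply: eq_Rintegral => z' _; rewrite upd_upd.
by rewrite -/(Ecoord i (fun=> Ecoord i f w) w) Ecoord_cst.
Qed.

Definition Eseq l f : (nat -> S) -> R := foldr Ecoord f l.

Lemma nice_Eseq l f : nice f -> nice (Eseq l f).
Proof. by move=> nf; elim: l => //= i l; exact: nice_Ecoord. Qed.

Lemma eq_in_Eseq l f g w :
  (forall v, (forall i, i \notin l -> v i = w i) -> f v = g v) ->
  Eseq l f w = Eseq l g w.
Proof.
elim: l w => [|i l IH] w fg /=; first exact: fg.
apply: eq_Rintegral => z _; apply: IH => v vw; apply: fg => j.
by rewrite inE negb_or => /andP[ji jl]; rewrite vw// upd_neq.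
Qed.

Lemma eq_Eseq l f g : f =1 g -> Eseq l f = Eseq l g.
Proof. by move=> /funext ->. Qed.

Lemma Eseq_cst l (c : R) w : Eseq l (fun=> c) w = c.
Proof.
elim: l w => //= i l IH w.
by rewrite (_ : Eseq l _ = fun=> c) ?Ecoord_cst//; apply/funext.
Qed.

Lemma EseqD l f g w : nice f -> nice g ->
  Eseq l (fun w => f w + g w) w = Eseq l f w + Eseq l g w.
Proof.
move=> nf ng; elim: l w => //= i l IH w.
by rewrite -EcoordD; [congr Ecoord; apply/funext|exact: nice_Eseq..].
Qed.

Lemma EseqZ l (c : R) f w : nice f ->
  Eseq l (fun w => c * f w) w = c * Eseq l f w.
Proof.
move=> nf; elim: l w => //= i l IH w.
by rewrite -EcoordZ; [congr Ecoord; apply/funext|exact: nice_Eseq].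
Qed.

Lemma EseqB l f g w : nice f -> nice g ->
  Eseq l (fun w => f w - g w) w = Eseq l f w - Eseq l g w.
Proof.
move=> nf ng; rewrite EseqD//; last exact: niceN.
rewrite (@eq_Eseq l (fun w => - g w) (fun w => -1 * g w)); last first.
  by move=> v; rewrite mulN1r.
by rewrite EseqZ// mulN1r.
Qed.

Lemma Eseq_sum l (I : Type) (r : seq I) (P : pred I)
    (F : I -> (nat -> S) -> R) w :
  (forall i, P i -> nice (F i)) ->
  Eseq l (fun w => \sum_(i <- r | P i) F i w) w =
  \sum_(i <- r | P i) Eseq l (F i) w.
Proof.
move=> nF; elim: r => [|i r IH].
  rewrite big_nil -[RHS](Eseq_cst l 0 w).
  by congr (Eseq l _ w); apply/funext => v; rewrite big_nil.
rewrite big_cons (_ : (fun w => _) = (fun w => (if P i then F i w else 0) +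
   \sum_(i <- r | P i) F i w)); last first.
  by apply/funext => v; rewrite big_cons; case: ifP; rewrite ?add0r.
rewrite EseqD ?IH//; [|by case: (boolP (P i)) => [/nF//|_]; exact: nice_cst|exact: nice_sum].
by case: ifP => _//; rewrite Eseq_cst add0r.
Qed.

Lemma le_Eseq l f g w : nice f -> nice g -> (forall v, f v <= g v) ->
  Eseq l f w <= Eseq l g w.
Proof.
move=> nf ng fg; elim: l w => //= i l IH w.
by apply: le_Ecoord => //; exact: nice_Eseq.
Qed.

Lemma Ecoord_Eseq i l f : nice f ->
  Ecoord i (Eseq l f) = Eseq l (Ecoord i f).
Proof. by move=> nf; elim: l => //= j l <-; rewrite EcoordC//; exact: nice_Eseq. Qed.

Lemma Eseq_absorb1 i l f : nice f -> i \in l -> Eseq l (Ecoord i f) = Eseq l f.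
Proof.
move=> nf; elim: l => //= j l IH; rewrite inE => /predU1P[<-|/IH ->//].
by rewrite -Ecoord_Eseq// Ecoord_idem.
Qed.

(** The tower property: each inner integration commutes outwards until it meets the integration over
    the same coordinate, where idempotence removes it. *)
Lemma Eseq_absorb l l' f : nice f -> {subset l' <= l} ->
  Eseq l (Eseq l' f) = Eseq l f.
Proof.
move=> nf; elim: l' => //= i l' IH sub.
rewrite Eseq_absorb1; [|exact: nice_Eseq|by apply: sub; rewrite inE eqxx].
by apply: IH => j jl; apply: sub; rewrite inE jl orbT.
Qed.

(** Taking out what is known: this is the form in which independence enters all later
    computations. *)
Lemma Eseq_mull l f g w : nice g ->
  (forall v v', (forall i, i \notin l -> v i = v' i) -> f v = f v') ->
  Eseq l (fun v => f v * g v) w = f w * Eseq l g w.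
Proof.
move=> ng nf; rewrite -EseqZ//; apply: eq_in_Eseq => v vw.
by rewrite (nf v w).
Qed.

End Sampling.

(** * Patterns of a sample *)

Section Patterns.
Set Implicit Arguments.
Unset Strict Implicit.
Variable R : realType.
Local Notation pt := (R * R)%type.
Local Notation z0 := (Defs.z0 R).
Implicit Types (s t : seq pt) (z : pt).

(** Ranks are attached to points instead of positions, which makes pattern predicates invariant
    under reordering the sample. *)
Definition below1 s z : nat := count (fun w => w.1 < z.1) s.
Definition below2 s z : nat := count (fun w => w.2 < z.2) s.

(** If x < y, the point [x] itself is counted below [y] but not below [x]; hence the membership
    hypothesis on [x]. *)
Lemma count_lt_mono (s : seq R) (x y : R) : x \in s ->
  (count (fun w => w < x)%R s < count (fun w => w < y)%R s)%N = (x < y).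
Proof.
move=> xs; case: (ltP x y) => xy; last first.
  apply/negbTE; rewrite -leqNgt; apply: sub_count => w /= wy.
  exact: lt_le_trans xy.
have := count_predC (fun w => w < x) [seq w <- s | w < y].
rewrite !count_filter size_filter => <-.
rewrite (_ : count (predI _ (fun w => w < y)) s = count (fun w => w < x) s).
  rewrite -[X in (X < _)%N]addn0 ltn_add2l -has_count.
  by apply/hasP; exists x => //=; rewrite ltxx.
apply: eq_count => w /=; apply/andP/idP => [[]//|wx]; split => //.
exact: lt_trans xy.
Qed.

Lemma below1_lt s z z' : z \in s -> (below1 s z < below1 s z')%N = (z.1 < z'.1).
Proof.
move=> zs; rewrite -(count_lt_mono (s := map fst s)) ?map_f//.
by rewrite !count_map.
Qed.

Lemma below2_lt s z z' : z \in s -> (below2 s z < below2 s z')%N = (z.2 < z'.2).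
Proof.
move=> zs; rewrite -(count_lt_mono (s := map snd s)) ?map_f//.
by rewrite !count_map.
Qed.

Lemma below1_lt_size s z : z \in s -> (below1 s z < size s)%N.
Proof.
move=> zs; rewrite -(count_predC (fun w => w.1 < z.1) s) -[X in (X < _)%N]addn0.
by rewrite ltn_add2l -has_count; apply/hasP; exists z => //=; rewrite ltxx.
Qed.

Lemma below2_lt_size s z : z \in s -> (below2 s z < size s)%N.
Proof.
move=> zs; rewrite -(count_predC (fun w => w.2 < z.2) s) -[X in (X < _)%N]addn0.
by rewrite ltn_add2l -has_count; apply/hasP; exists z => //=; rewrite ltxx.
Qed.

Lemma permnE k (sigma : 'S_k) (i : 'I_k) : permn sigma i = sigma i.
Proof. by rewrite /permn valK. Qed.

Lemma permn_lt k (sigma : 'S_k) r : (r < k)%N -> (permn sigma r < k)%N.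
Proof. by move=> rk; rewrite (permnE sigma (Ordinal rk)). Qed.

Lemma permn_inj k (sigma : 'S_k) r r' : (r < k)%N -> (r' < k)%N ->
  permn sigma r = permn sigma r' -> r = r'.
Proof.
move=> rk rk'; rewrite (permnE sigma (Ordinal rk)) (permnE sigma (Ordinal rk')).
by move=> /val_inj /perm_inj [].
Qed.

Lemma notiesE s : noties s = uniq (map fst s) && uniq (map snd s).
Proof.
apply/idP/andP => [/forallP nt|[u1 u2]].
  have nt' i j : (i < size s)%N -> (j < size s)%N -> i != j ->
      ((nth z0 s i).1 != (nth z0 s j).1) && ((nth z0 s i).2 != (nth z0 s j).2).
    move=> li lj ij; have /forallP := nt (Ordinal li).
    by move=> /(_ (Ordinal lj)) /implyP; apply.
  split; apply/(uniqP (0 : R)) => i j; rewrite !inE size_map => li lj.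
    rewrite !(nth_map z0)//; apply: contra_eq => ij.
    by have /andP[] := nt' i j li lj ij.
  rewrite !(nth_map z0)//; apply: contra_eq => ij.
  by have /andP[] := nt' i j li lj ij.
apply/forallP => i; apply/forallP => j; apply/implyP => ij.
rewrite -!(nth_map z0 0 fst)// -!(nth_map z0 0 snd)//.
by rewrite !nth_uniq ?size_map// ij.
Qed.

Lemma has_patternE k (sigma : 'S_k) s : has_pattern sigma s =
  [&& size s == k, uniq (map fst s), uniq (map snd s) &
   all (fun z => permn sigma (below1 s z) == below2 s z) s].
Proof.
rewrite /has_pattern notiesE -!andbA; case: eqP => //= sk.
congr (_ && (_ && _)); apply/forallP/(all_nthP z0) => H i.
  by rewrite sk => ik; have := H (Ordinal ik).
by have := H i; rewrite sk; apply.
Qed.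

Lemma has_pattern_perm k (sigma : 'S_k) s t : perm_eq s t ->
  has_pattern sigma s = has_pattern sigma t.
Proof.
move=> st; rewrite !has_patternE (perm_size st).
rewrite (perm_uniq (perm_map fst st)) (perm_uniq (perm_map snd st)).
rewrite (perm_all _ st); congr [&& _, _, _ & _].
by apply: eq_all => z; rewrite /below1 /below2 !(seq.permP st).
Qed.

Lemma perm_eq_iota (T : seq nat) : uniq T -> all (fun x => x < size T)%N T ->
  perm_eq T (iota 0 (size T)).
Proof.
move=> uT aT.
have sT : {subset T <= iota 0 (size T)}.
  by move=> x xT; rewrite mem_iota add0n leq0n (allP aT).
have [_ eqT] := uniq_min_size uT sT (eq_leq (size_iota _ _)).
by apply: uniq_perm => //; exact: iota_uniq.
Qed.

Lemma count_lt_ranks (T : seq nat) m : uniq T -> all (fun x => x < size T)%N T ->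
  (m <= size T)%N -> count (fun x => x < m)%N T = m.
Proof.
move=> uT aT mT; rewrite (seq.permP (perm_eq_iota uT aT)).
rewrite -(subnKC mT) iotaD count_cat add0n.
rewrite (_ : count _ (iota 0 m) = size (iota 0 m)); last first.
  by apply/eqP; rewrite -all_count; apply/allP => x; rewrite mem_iota.
rewrite size_iota (_ : count _ _ = 0%N) ?addn0//.
by apply/eqP; rewrite -leqn0 leqNgt -has_count; apply/hasP => -[x];
  rewrite mem_iota => /andP[mx _]; rewrite ltnNge mx.
Qed.

Lemma uniq_map_inj (T U : eqType) (f : T -> U) (t : seq T) :
  uniq (map f t) -> {in t &, injective f}.
Proof.
elim: t => //= x t IH /andP[fx u] a b; rewrite !inE.
move=> /predU1P[->|ta] /predU1P[->|tb] // e; last exact: IH.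
  by move: fx; rewrite e map_f.
by move: fx; rewrite -e map_f.
Qed.

(** Passes from equality of ranks to pairwise comparisons, the form used by [occurs_at]. Conversely,
    the values [permn sigma (below1 t z)] exhaust 0, ..., k-1, so counting the smaller ones recovers
    the rank in the second coordinate. *)
Lemma has_pattern_iso k (sigma : 'S_k) t :
  size t = k -> uniq (map fst t) -> uniq (map snd t) ->
  has_pattern sigma t = all (fun z => all (fun z' =>
    (z.2 < z'.2) == (permn sigma (below1 t z) < permn sigma (below1 t z'))%N) t) t.
Proof.
move=> tk u1 u2; rewrite has_patternE tk eqxx u1 u2 /=.
have blt z : z \in t -> (permn sigma (below1 t z) < k)%N.
  by move=> zt; apply: permn_lt; rewrite -tk below1_lt_size.
apply/allP/allP => [H z zt|H z zt].
  apply/allP => z' zt'.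
  by rewrite (eqP (H z zt)) (eqP (H z' zt')) below2_lt.
have inj : {in t &, injective (fun z => permn sigma (below1 t z))}.
  move=> a b ta tb /permn_inj; rewrite -tk !below1_lt_size// => /(_ isT isT) ab.
  suff : a.1 = b.1.
    by exact: (uniq_map_inj u1).
  by apply/eqP; rewrite eq_le !leNgt -!(below1_lt (s := t))// ab ltnn.
rewrite /below2; rewrite (@eq_in_count _ _ (fun w =>
    permn sigma (below1 t w) < permn sigma (below1 t z))%N); last first.
  by move=> w wt; have /allP/(_ z zt)/eqP := H w wt.
rewrite -(count_map (fun w => permn sigma (below1 t w))
   (fun x => x < permn sigma (below1 t z))%N).
rewrite count_lt_ranks ?size_map ?tk//; last by rewrite ltnW// blt.
  by rewrite map_inj_in_uniq// (map_uniq u1).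
by apply/allP => _ /mapP[w wt ->]; exact: blt.
Qed.

Lemma uniq_map_nth_inj (T : eqType) (f : pt -> T) s i j : uniq (map f s) ->
  (i < size s)%N -> (j < size s)%N ->
  f (nth z0 s i) = f (nth z0 s j) -> i = j.
Proof.
move=> u li lj e; apply/eqP; rewrite -(nth_uniq (f z0) _ _ u) ?size_map//.
by rewrite !(nth_map z0) ?e.
Qed.

Lemma nth_rank1 s i : rank1 s i = below1 s (nth z0 s i). Proof. by []. Qed.
Lemma nth_rank2 s i : rank2 s i = below2 s (nth z0 s i). Proof. by []. Qed.

Lemma rank1_lt s i j : (i < size s)%N ->
  (rank1 s i < rank1 s j)%N = ((nth z0 s i).1 < (nth z0 s j).1).
Proof. by move=> li; rewrite nth_rank1 below1_lt ?mem_nth. Qed.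

Lemma rank2_lt s i j : (i < size s)%N ->
  (rank2 s i < rank2 s j)%N = ((nth z0 s i).2 < (nth z0 s j).2).
Proof. by move=> li; rewrite nth_rank2 below2_lt ?mem_nth. Qed.

Lemma rank_perm1 s n : size s = n -> uniq (map fst s) ->
  {rho : 'S_n | forall i : 'I_n, rho i = rank1 s i :> nat}.
Proof.
move=> sn u1.
have lt (i : 'I_n) : (rank1 s i < n)%N.
  have li : (i < size s)%N by rewrite sn.
  by have := below1_lt_size (mem_nth z0 li); rewrite sn.
have inj : injective (fun i => Ordinal (lt i)).
  move=> i j [ij]; apply/val_inj/(uniq_map_nth_inj u1); rewrite ?sn ?ltn_ord//.
  by apply/eqP; rewrite eq_le !leNgt -!rank1_lt ?sn ?ltn_ord// ij ltnn.
by exists (perm inj) => i; rewrite permE.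
Qed.

Lemma rank_perm2 s n : size s = n -> uniq (map snd s) ->
  {rho : 'S_n | forall i : 'I_n, rho i = rank2 s i :> nat}.
Proof.
move=> sn u2.
have lt (i : 'I_n) : (rank2 s i < n)%N.
  have li : (i < size s)%N by rewrite sn.
  by have := below2_lt_size (mem_nth z0 li); rewrite sn.
have inj : injective (fun i => Ordinal (lt i)).
  move=> i j [ij]; apply/val_inj/(uniq_map_nth_inj u2); rewrite ?sn ?ltn_ord//.
  by apply/eqP; rewrite eq_le !leNgt -!rank2_lt ?sn ?ltn_ord// ij ltnn.
by exists (perm inj) => i; rewrite permE.
Qed.

Lemma pattern_exists s n : size s = n -> noties s ->
  exists pi : 'S_n, has_pattern pi s.
Proof.
move=> sn; rewrite notiesE => /andP[u1 u2].
have [rho hrho] := rank_perm1 sn u1; have [tau htau] := rank_perm2 sn u2.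
(* Products act from left to right: a first rank is sent to its position, then to the second rank
   found there. *)
exists (rho^-1 * tau)%g; rewrite /has_pattern sn eqxx notiesE u1 u2 /=.
by apply/forallP => i; rewrite -hrho permnE permM permK htau.
Qed.

Lemma pattern_unique s n (pi pi' : 'S_n) :
  has_pattern pi s -> has_pattern pi' s -> pi = pi'.
Proof.
rewrite /has_pattern notiesE => /andP[/andP[/eqP sn /andP[u1 u2]] /forallP h].
move=> /andP[_ /forallP h'].
have [rho hrho] := rank_perm1 sn u1.
apply/permP => x; rewrite -(permKV rho x); apply: val_inj => /=.
have /eqP := h (rho^-1%g x); rewrite -hrho permnE => ->.
by have /eqP := h' (rho^-1%g x); rewrite -hrho permnE => ->.
Qed.

Definition subsample n s (I : {set 'I_n}) : seq pt :=
  [seq nth z0 s (val i) | i <- enum I].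

Lemma count_subsample n s (I : {set 'I_n}) (a : pred pt) :
  count a (subsample s I) = #|[set i in I | a (nth z0 s i)]|.
Proof.
rewrite count_map -sum1_count big_enum_cond -sum1_card.
by apply: eq_bigl => i; rewrite inE.
Qed.

Lemma uniq_subsample n s (I : {set 'I_n}) (T : eqType) (f : pt -> T) : size s = n ->
  uniq (map f s) -> uniq (map f (subsample s I)).
Proof.
move=> sn us; rewrite -map_comp map_inj_in_uniq ?enum_uniq// => i j _ _ /= ij.
by apply/val_inj/(uniq_map_nth_inj us); rewrite ?sn ?ltn_ord.
Qed.

Lemma size_subsample n s (I : {set 'I_n}) : size (subsample s I) = #|I|.
Proof. by rewrite size_map -cardE. Qed.

(* The proportion of [j]-subsets of the sample itself carrying the pattern
   [sigma]; [tdens] selects the same subsets through ranks. *)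
Definition sample_density j (sigma : 'S_j) n s : R :=
  (\sum_(I : {set 'I_n} | #|I| == j) (has_pattern sigma (subsample s I))%:R)
  / 'C(n, j)%:R.

(** [pi] is read along first ranks and the sample along positions; [rho] translates positions into
    first ranks, so the index set has to be moved along with it. *)
Lemma occurs_at_subsample n j (pi : 'S_n) (sigma : 'S_j) s (rho : 'S_n)
    (I : {set 'I_n}) :
  has_pattern pi s -> (forall i : 'I_n, rho i = rank1 s i :> nat) -> #|I| = j ->
  occurs_at pi sigma (rho @: I) = has_pattern sigma (subsample s I).
Proof.
rewrite /has_pattern notiesE => /andP[/andP[/eqP sn /andP[u1 u2]] /forallP h].
move=> hrho Ij.
have pirho i : pi (rho i) = rank2 s i :> nat.
  by have /eqP := h i; rewrite -hrho permnE => ->.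
have pos i : i \in I -> pos_in (rho @: I) (rho i) =
    below1 (subsample s I) (nth z0 s i).
  move=> iI; rewrite /below1 count_subsample /pos_in.
  rewrite -[RHS](card_imset _ (@perm_inj _ rho)); apply: eq_card => x.
  rewrite inE; apply/andP/imsetP.
    case=> /imsetP[i' i'I ->]; rewrite !hrho rank1_lt ?sn// => lt.
    by exists i' => //; rewrite inE i'I.
  move=> [i']; rewrite inE => /andP[i'I lt] ->; split; first exact: imset_f.
  by rewrite !hrho rank1_lt ?sn.
rewrite -/(has_pattern _ _) has_pattern_iso ?size_subsample ?uniq_subsample//.
apply/forall_inP/allP => [H _ /mapP[i iI ->]|H _ /imsetP[i iI ->]].
  rewrite mem_enum in iI; apply/allP => _ /mapP[i' i'I ->].
  rewrite mem_enum in i'I.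
  have /forall_inP /(_ (rho i') (imset_f rho i'I)) := H (rho i) (imset_f rho iI).
  by rewrite !pos// !pirho rank2_lt ?sn.
apply/forall_inP => _ /imsetP[i' i'I ->].
have ms x : x \in I -> nth z0 s x \in subsample s I.
  by move=> xI; apply: (map_f (fun i : 'I_n => nth z0 s i)); rewrite mem_enum.
have /allP /(_ _ (ms _ i'I)) := H _ (ms _ iI).
by rewrite !pos// !pirho rank2_lt ?sn.
Qed.

Lemma tdens_sample n j (pi : 'S_n) (sigma : 'S_j) s :
  has_pattern pi s -> tdens R pi sigma = sample_density sigma n s.
Proof.
move=> hp; rewrite /tdens /sample_density; congr (_ / _).
have := hp; rewrite /has_pattern notiesE.
move=> /andP[/andP[/eqP sn /andP[u1 u2]] _].
have [rho hrho] := rank_perm1 sn u1.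
rewrite -sum1_card natr_sum (reindex_inj (imset_inj (@perm_inj _ rho))) /=.
rewrite big_mkcond [RHS]big_mkcond; apply: eq_bigr => I _.
rewrite unfold_in /in_set /= asboolb card_imset; last exact: perm_inj.
case: eqP => //= Ij; rewrite (occurs_at_subsample sigma hp hrho Ij).
by rewrite -/(has_pattern sigma _); case: (has_pattern sigma _).
Qed.

End Patterns.

(** * Measurability of statistics that depend only on the order of the sample *)

Section OrderDetermined.
Set Implicit Arguments.
Unset Strict Implicit.
Variable R : realType.
Local Notation pt := (R * R)%type.
Local Notation z0 := (Defs.z0 R).
Implicit Types (s t : seq pt) (w : nat -> pt).

(** Finitely many Boolean tests cut the space into finitely many measurable cells, and [f] is
    constant on each. *)
Lemma sample_measurable_finite d (S : measurableType d) (T : finType)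
    (b : T -> (nat -> S) -> bool) d' (U : measurableType d')
    (f : (nat -> S) -> U) :
  (forall i : T, sample_measurable (b i)) ->
  (forall v v' : nat -> S, (forall i : T, b i v = b i v') -> f v = f v') ->
  sample_measurable f.
Proof.
move=> mb fb d1 T1 X mX _ Y mY; rewrite setTI.
rewrite (_ : _ @^-1` _ = \bigcup_(c in [set c : {ffun T -> bool} |
    exists v : nat -> S, (forall i : T, b i v = c i) /\ Y (f v)])
    \bigcap_(i in [set: T]) ((fun x => b i (X^~ x)) @^-1` [set c i])).
  apply: fin_bigcup_measurable; first exact: finite_finset.
  move=> c _; apply: fin_bigcap_measurable; first exact: finite_finset.
  by move=> i _; rewrite -[X in measurable X]setTI; exact: mb.
apply/seteqP; split => [x Yx|x [c [w [bw Yw]] H]] /=.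
  exists [ffun i => b i (X^~ x)]; last by move=> i _ /=; rewrite ffunE.
  by exists (X^~ x); split=> // i; rewrite ffunE.
by rewrite (fb _ w)// => i; rewrite bw; exact: H.
Qed.

(** Patterns, densities and the test statistic all factor through these finitely many comparisons,
    so one argument gives the measurability of all of them. *)
Definition order_equiv s t : Prop := size s = size t /\
  forall i j, (i < size s)%N -> (j < size s)%N ->
   ((nth z0 s i).1 < (nth z0 s j).1) = ((nth z0 t i).1 < (nth z0 t j).1) /\
   ((nth z0 s i).2 < (nth z0 s j).2) = ((nth z0 t i).2 < (nth z0 t j).2).

Definition order_determined n U (F : seq pt -> U) : Prop :=
  forall s t, size s = n -> order_equiv s t -> F s = F t.

Lemma measurable_order_determined n d' (U : measurableType d') (F : seq pt -> U)
    (l : seq nat) : order_determined n F -> size l = n ->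
  sample_measurable (fun w => F (map w l)).
Proof.
move=> oF ln.
pose b (x : 'I_n * 'I_n * bool) w : bool :=
  let zi := w (nth 0%N l x.1.1) in let zj := w (nth 0%N l x.1.2) in
  if x.2 then zi.1 < zj.1 else zi.2 < zj.2.
apply: (@sample_measurable_finite _ _ _ b) => [[[i j] []]|w w' bw].
- move=> d1 T X mX; apply: measurable_fun_ltr => /=;
  by apply: (measurableT_comp measurable_fst).
- move=> d1 T X mX; apply: measurable_fun_ltr => /=;
  by apply: (measurableT_comp measurable_snd).
apply: oF; first by rewrite size_map.
split; first by rewrite !size_map.
move=> i j; rewrite size_map ln => li lj.
rewrite !(nth_map 0%N) ?ln//; split.
  exact: (bw (Ordinal li, Ordinal lj, true)).
exact: (bw (Ordinal li, Ordinal lj, false)).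
Qed.

Lemma order_equiv_rank1 s t i : order_equiv s t -> (i < size s)%N ->
  rank1 s i = rank1 t i.
Proof.
move=> [st H] li; rewrite /rank1 -!sum1_count !(big_nth z0) -st.
by apply: congr_big_nat => // j jn; have [->] := H j i jn li.
Qed.

Lemma order_equiv_rank2 s t i : order_equiv s t -> (i < size s)%N ->
  rank2 s i = rank2 t i.
Proof.
move=> [st H] li; rewrite /rank2 -!sum1_count !(big_nth z0) -st.
by apply: congr_big_nat => // j jn; have [_ ->] := H j i jn li.
Qed.

(** [order_equiv] only preserves strict comparisons, so distinctness is rewritten as a disjunction
    of two of them. *)
Lemma noties_nth s : noties s = all (fun i => all (fun j => (i != j) ==>
   (((nth z0 s i).1 < (nth z0 s j).1) || ((nth z0 s j).1 < (nth z0 s i).1)) &&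
   (((nth z0 s i).2 < (nth z0 s j).2) || ((nth z0 s j).2 < (nth z0 s i).2)))
   (iota 0 (size s))) (iota 0 (size s)).
Proof.
apply/forallP/allP => [H i|H i].
  rewrite mem_iota add0n => /andP[_ li]; apply/allP => j.
  rewrite mem_iota add0n => /andP[_ lj]; rewrite -!neq_lt.
  by have /forallP /(_ (Ordinal lj)) := H (Ordinal li).
apply/forallP => j.
have mi (x : 'I_(size s)) : val x \in iota 0 (size s) by rewrite mem_iota add0n ltn_ord.
by have /allP /(_ _ (mi j)) := H _ (mi i); rewrite -!neq_lt.
Qed.

Lemma noties_order_determined n : order_determined n (@noties R).
Proof.
move=> s t sn st; have [eqs H] := st; rewrite !noties_nth -eqs.
apply: eq_in_all => i; rewrite mem_iota add0n => /andP[_ li].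
apply: eq_in_all => j; rewrite mem_iota add0n => /andP[_ lj].
have [-> ->] := H i j li lj; have [-> ->] := H j i lj li.
by [].
Qed.

Lemma has_pattern_order_determined n k (sigma : 'S_k) :
  order_determined n (@has_pattern R k sigma).
Proof.
move=> s t sn st; have [eqs H] := st.
rewrite /has_pattern -eqs (noties_order_determined sn st).
case: eqP => //= sk; congr (_ && _); apply: eq_forallb => i.
by rewrite (order_equiv_rank1 st) ?(order_equiv_rank2 st) ?sk.
Qed.

Lemma subsample_mkseq n w (I : {set 'I_n}) :
  subsample (mkseq w n) I = map w (map val (enum I)).
Proof.
rewrite -map_comp; apply: eq_map => i /=.
by rewrite nth_mkseq.
Qed.

Lemma order_equiv_subsample n s t (I : {set 'I_n}) : size s = n ->
  order_equiv s t -> order_equiv (subsample s I) (subsample t I).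
Proof.
move=> sn [st H]; split; first by rewrite !size_subsample.
move=> i j; rewrite size_subsample cardE => li lj.
have nthE u (k : nat) : (k < size (enum I))%N -> nth z0 (subsample u I) k =
    nth z0 u (nth 0%N (map val (enum I)) k).
  by move=> lk; rewrite /subsample (map_comp (nth z0 u) val) (nth_map 0%N) ?size_map.
have lt k : (k < size (enum I))%N -> (nth 0%N (map val (enum I)) k < size s)%N.
  move=> lk; have : nth 0%N (map val (enum I)) k \in map val (enum I).
    by rewrite mem_nth ?size_map.
  by case/mapP => i' _ ->; rewrite sn ltn_ord.
by rewrite !nthE//; apply: H; exact: lt.
Qed.

Lemma sample_density_order_determined n j (sigma : 'S_j) :
  order_determined n (sample_density (R := R) sigma n).
Proof.
move=> s t sn st; rewrite /sample_density; congr (_ / _).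
apply: eq_bigr => I /eqP Ij; congr (_ %:R); congr nat_of_bool.
apply: (has_pattern_order_determined (n := j)).
  by rewrite size_subsample.
exact: order_equiv_subsample.
Qed.

End OrderDetermined.

(** * Expectations over the sample, and absence of ties *)

Section SampleExpectation.
Set Implicit Arguments.
Unset Strict Implicit.
Variable R : realType.
Local Notation pt := (R * R)%type.
Local Notation z0 := (Defs.z0 R).
Variable mu : probability pt R.
Implicit Types (s t : seq pt) (w : nat -> pt).

Definition nice_seq (n : nat) (F : seq pt -> R) : Prop :=
  forall l, size l = n -> nice (fun w => F (map w l)).

(** The list [l0] holds the coordinates whose points are already drawn; the induction moves the head
    of [l] to its end. *)
Lemma iprod_Eseq (F : seq pt -> R) l l0 w :
  nice_seq (size (l0 ++ l)) F -> uniq l -> (forall i, i \in l -> i \notin l0) ->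
  iprod mu (size l) (fun s => (F (map w l0 ++ s))%:E) =
  (Eseq mu l (fun v => F (map v (l0 ++ l))) w)%:E.
Proof.
elim: l l0 w => [|i l IH] l0 w nF /=; first by rewrite !cats0.
move=> /andP[il ul] dl.
have nF' : nice (fun v => F (map v (l0 ++ i :: l))) by exact: nF.
rewrite Ecoord_fin; last exact: nice_Eseq.
apply: eq_integral => z _.
have e : map w l0 ++ [:: z] = map (upd w i z) (rcons l0 i).
  rewrite map_rcons upd_eq cats1; congr rcons; apply/eq_in_map => j jl0.
  rewrite upd_neq//; apply: contraTneq jl0 => ->.
  by apply: dl; rewrite inE eqxx.
transitivity (iprod mu (size l)
   (fun s => (F (map (upd w i z) (rcons l0 i) ++ s))%:E)).
  by congr iprod; apply/funext => s; rewrite -e -catA.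
rewrite IH ?cat_rcons//.
move=> j jl; rewrite mem_rcons inE negb_or dl ?inE ?jl ?orbT// andbT.
by apply: contraNneq il => <-.
Qed.

Definition Ex n (f : (nat -> pt) -> R) : R := Eseq mu (iota 0 n) f (fun=> z0).

Lemma iprod_Ex n (F : seq pt -> R) : nice_seq n F ->
  iprod mu n (fun s => (F s)%:E) = (Ex n (fun w => F (mkseq w n)))%:E.
Proof.
move=> nF; rewrite /Ex -(iprod_Eseq (l0 := [::]))//= ?size_iota//.
exact: iota_uniq.
Qed.

Lemma nice_seq_bool n (E : seq pt -> bool) : order_determined n E ->
  nice_seq n (fun s => (E s)%:R).
Proof.
move=> oE l ln; apply: nice_bool; exact: (measurable_order_determined oE ln).
Qed.

Lemma sampleP_Ex n (E : seq pt -> bool) : order_determined n E ->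
  sampleP mu n E = (Ex n (fun w => (E (mkseq w n))%:R))%:E.
Proof.
by move=> oE; rewrite /sampleP (iprod_Ex (nice_seq_bool oE)).
Qed.

(** Both sides equal the same [iprod], which sees only the number of points: any distinct
    coordinates have the law of the first ones. *)
Lemma Eseq_marginal (F : seq pt -> R) l : nice_seq (size l) F -> uniq l ->
  forall w, Eseq mu l (fun v => F (map v l)) w =
    Ex (size l) (fun v => F (mkseq v (size l))).
Proof.
move=> nF ul w; apply: EFin_inj.
by rewrite -(iprod_Eseq (l0 := [::]) w)// -iprod_Ex.
Qed.

Lemma Ex_absorb n l f : nice f -> {subset l <= iota 0 n} ->
  Ex n f = Ex n (Eseq mu l f).
Proof. by move=> nf sub; rewrite /Ex Eseq_absorb. Qed.

Lemma Ex_cst n c : Ex n (fun=> c) = c.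
Proof. exact: Eseq_cst. Qed.

Lemma eq_Ex n f g : f =1 g -> Ex n f = Ex n g.
Proof. by move=> /funext ->. Qed.

Lemma Ex_marginal n (F : seq pt -> R) l :
  nice_seq (size l) F -> uniq l -> {subset l <= iota 0 n} ->
  Ex n (fun w => F (map w l)) = Ex (size l) (fun w => F (mkseq w (size l))).
Proof.
move=> nF ul sub; rewrite (Ex_absorb (l := l))//; last exact: nF.
rewrite (_ : Eseq mu l _ = fun=> Ex (size l) (fun w => F (mkseq w (size l)))).
  exact: Ex_cst.
by apply/funext => w; exact: Eseq_marginal.
Qed.

Lemma ExD n f g : nice f -> nice g ->
  Ex n (fun w => f w + g w) = Ex n f + Ex n g.
Proof. exact: EseqD. Qed.

Lemma ExB n f g : nice f -> nice g ->
  Ex n (fun w => f w - g w) = Ex n f - Ex n g.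
Proof. exact: EseqB. Qed.

Lemma ExZ n c f : nice f -> Ex n (fun w => c * f w) = c * Ex n f.
Proof. exact: EseqZ. Qed.

Lemma Ex_sum n (I : Type) (r : seq I) (P : pred I) (F : I -> (nat -> pt) -> R) :
  (forall i, P i -> nice (F i)) ->
  Ex n (fun w => \sum_(i <- r | P i) F i w) = \sum_(i <- r | P i) Ex n (F i).
Proof. exact: Eseq_sum. Qed.

Lemma le_Ex n f g : nice f -> nice g -> (forall w, f w <= g w) ->
  Ex n f <= Ex n g.
Proof. by move=> nf ng fg; exact: le_Eseq. Qed.

Lemma Ex_ge0 n f : nice f -> (forall w, 0 <= f w) -> 0 <= Ex n f.
Proof. by move=> nf f0; rewrite -(Ex_cst n 0) le_Ex//; exact: nice_cst. Qed.

Lemma Ecoord_bool (E : pt -> bool) i w : measurable_fun setT E ->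
  Ecoord mu i (fun w => (E (w i))%:R) w = fine (mu [set z | E z]).
Proof.
move=> mE; rewrite /Ecoord /Rintegral; congr fine.
have mA : measurable [set z | E z].
  by have := mE measurableT [set true] I; rewrite setTI.
rewrite -[X in mu X](setIT [set z | E z]) -integral_indic//.
apply: eq_integral => z _; rewrite upd_eq indicE.
by congr (_%:R)%:E; rewrite unfold_in /in_set /= asboolb.
Qed.

Definition uniform_marginal (p : pt -> R) : Prop :=
  measurable_fun setT p /\
  forall u : R, mu [set z | p z <= u] = (clamp01 u)%:E.

Lemma Ecoord_marginal_cdf (p : pt -> R) i u w : uniform_marginal p ->
  Ecoord mu i (fun w => (p (w i) <= u)%R%:R) w = clamp01 u.
Proof.
move=> [mp pu]; rewrite (Ecoord_bool (E := fun z => p z <= u)) ?pu//.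
by apply: measurable_fun_ler => //; exact: measurable_cst.
Qed.

Lemma nice_marginal_cdf (p : pt -> R) i u : measurable_fun setT p ->
  nice (fun w => (p (w i) <= u)%R%:R : R).
Proof.
move=> mp; apply: nice_bool => d T X mX; apply: measurable_fun_ler.
  exact: measurableT_comp.
exact: measurable_cst.
Qed.

Lemma nice_marginal_eq (p : pt -> R) i j : measurable_fun setT p ->
  nice (fun w => (p (w i) == p (w j))%:R : R).
Proof.
move=> mp; apply: nice_bool => d T X mX.
by apply: measurable_fun_eqr; exact: measurableT_comp.
Qed.

Lemma clamp01_lip (u e : R) : 0 <= e -> clamp01 u - clamp01 (u - e) <= e.
Proof.
move=> e0; rewrite /clamp01 /Num.min /Num.max.
case: (ltP 0 u) => ?; case: (ltP 0 (u - e)) => ?;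
  rewrite ?(ltr01, ltr10) ?[1 < 0](le_gtF (@ler01 R));
  try case: (ltP 1 u) => ?; try case: (ltP 1 (u - e)) => ?; lra.
Qed.

(** With [w j] fixed at level a, a tie forces p (w i) into (a - e, a], which has mass at most e by
    the uniform marginal. *)
Lemma Ex_tie (p : pt -> R) n i j : uniform_marginal p -> i != j ->
  (i < n)%N -> Ex n (fun w => (p (w i) == p (w j))%:R) = 0.
Proof.
move=> up ij li; have [mp _] := up.
rewrite (Ex_absorb (l := [:: i])); last 2 first.
- exact: nice_marginal_eq.
- by move=> k; rewrite inE => /eqP ->; rewrite mem_iota add0n li.
rewrite (_ : Eseq _ _ _ = fun=> 0) ?Ex_cst//; apply/funext => w /=.
apply/eqP; rewrite eq_le; apply/andP; split; last first.
  by apply: Rintegral_ge0 => z _; exact: ler0n.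
apply/ler_addgt0Pl => e e0; rewrite addr0.
set a := p (w j).
rewrite (_ : Ecoord _ _ _ _ = Ecoord mu i (fun w => (p (w i) == a)%:R) w); last first.
  by apply: eq_Rintegral => z _; rewrite upd_eq upd_neq// eq_sym.
apply: (@le_trans _ _ (clamp01 a - clamp01 (a - e))); last first.
  by apply: clamp01_lip; exact: ltW.
rewrite -(Ecoord_marginal_cdf i a w up) -(Ecoord_marginal_cdf i (a - e) w up).
rewrite -mulN1r -EcoordZ; last exact: nice_marginal_cdf.
rewrite -EcoordD; [|exact: nice_marginal_cdf|exact/niceZ/nice_marginal_cdf].
apply: le_Ecoord.
- apply: nice_bool => d T X mX; apply: measurable_fun_eqr; last exact: measurable_cst.
  exact: measurableT_comp.
- by apply: niceD; [exact: nice_marginal_cdf|exact/niceZ/nice_marginal_cdf].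
- move=> v; case: (eqVneq (p (v i)) a) => [->|_] /=.
    by rewrite lexx (_ : (a <= a - e) = false) ?mulr0 ?addr0//; apply/negbTE; lra.
  by case: (leP (p (v i)) a); case: (leP (p (v i)) (a - e)) => /=; lra.
Qed.

Lemma is_copula_marginals : is_copula mu ->
  uniform_marginal fst /\ uniform_marginal snd.
Proof.
move=> [h1 h2]; by split; split.
Qed.

Lemma nice_noties n : nice (fun w => (noties (mkseq w n))%:R : R).
Proof.
apply: (nice_seq_bool (@noties_order_determined R n)); exact: size_iota.
Qed.

(** Union bound over ordered pairs of positions, each of which has a tie with probability zero. *)
Lemma Ex_noties n : is_copula mu -> Ex n (fun w => (noties (mkseq w n))%:R) = 1.
Proof.
move=> /is_copula_marginals [u1 u2].
apply/eqP; rewrite eq_le; apply/andP; split.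
  rewrite -[leRHS](Ex_cst n 1); apply: le_Ex; [exact: nice_noties|exact: nice_cst|].
  by move=> w; case: noties.
rewrite -subr_le0 -[X in X - _](Ex_cst n 1) -ExB; [|exact: nice_cst|exact: nice_noties].
pose f (x : 'I_n * 'I_n) w : R :=
  ((w x.1).1 == (w x.2).1)%:R + ((w x.1).2 == (w x.2).2)%:R.
have nf x : nice (f x) by apply: niceD;
  [apply: (nice_marginal_eq (p := fst))|apply: (nice_marginal_eq (p := snd))];
  [exact: measurable_fst|exact: measurable_snd].
have <- : \sum_(x : 'I_n * 'I_n | x.1 != x.2) Ex n (f x) = 0.
  apply: big1 => -[i j] /= ij.
  rewrite /f ExD; [|apply: (nice_marginal_eq (p := fst)); exact: measurable_fst
    |apply: (nice_marginal_eq (p := snd)); exact: measurable_snd].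
  by rewrite (Ex_tie (p := fst))// (Ex_tie (p := snd))// addr0.
rewrite -Ex_sum; last by move=> x _; exact: nf.
apply: le_Ex.
- by apply: niceB; [exact: nice_cst|exact: nice_noties].
- by apply: nice_sum => x _; exact: nf.
move=> w; case: (boolP (noties _)) => [_|].
  by rewrite subrr; apply: sumr_ge0 => x _; rewrite addr_ge0// ler0n.
rewrite subr0 /noties negb_forall => /existsP[i]; rewrite negb_forall.
move=> /existsP[j]; rewrite negb_imply => /andP[ij].
have ltn (k : 'I_(size (mkseq w n))) : (k < n)%N.
  by rewrite -[X in (_ < X)%N](size_mkseq w n) ltn_ord.
rewrite !nth_mkseq// => tie.
rewrite (bigD1 (Ordinal (ltn i), Ordinal (ltn j))) /=; last first.
  by apply: contraNneq ij => -[] /val_inj ->.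
rewrite ler_wpDr//; first by apply: sumr_ge0 => x _; rewrite addr_ge0// ler0n.
rewrite /f /=; move: tie; rewrite negb_and !negbK => /orP[] -> /=.
  by rewrite lerDl ler0n.
by rewrite lerDr ler0n.
Qed.

End SampleExpectation.

(** * The Littlewood-Offord bound *)

Section WalkNumbers.
Set Implicit Arguments.
Unset Strict Implicit.

(* The numbers [walkD m q], [q = 0, 1, ...], list the binomial coefficients
   'C(m, _) in decreasing order, so that [walkN m r] is the sum of the [r]
   largest ones: the Erdos bound for the number of subset sums lying in a union
   of [r] disjoint half-open intervals. *)
Definition walkD (m q : nat) : nat := 'C(m, (m + q).+1./2).
Definition walkN (m r : nat) : nat := \sum_(q < r) walkD m q.

Lemma walkDS m q : walkD m.+1 q.+1 = (walkD m q.+2 + walkD m q)%N.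
Proof. by rewrite /walkD addSn !addnS /= -binS. Qed.

Lemma walkDS0 m : walkD m.+1 0 = (walkD m 1 + walkD m 0)%N.
Proof.
rewrite /walkD !addn0 addn1 /= binS; congr addn.
have half_le : (m./2 <= m)%N by move: (odd_double_half m); rewrite -addnn; lia.
rewrite -(bin_sub half_le); congr 'C(_, _).
by have := odd_double_half m; have := uphalf_half m; rewrite -addnn /=; lia.
Qed.

(** Pascal's rule for the largest binomial coefficients, in the shape of the recursion of
    [count_selsum_le]. *)
Lemma walkNS m r : walkN m.+1 r.+1 = (walkN m r.+2 + walkN m r)%N.
Proof.
rewrite /walkN; elim: r => [|r IH].
  by rewrite big_ord_recr !big_ord0 !big_ord_recr !big_ord0 /= walkDS0; lia.
rewrite big_ord_recr IH [X in _ = (X + _)%N]big_ord_recr.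
by rewrite [X in _ = (_ + X)%N]big_ord_recr /= walkDS; lia.
Qed.

Lemma walkN0 r : walkN 0 r.+1 = 1%N.
Proof.
rewrite /walkN big_ord_recl big1 /walkD//= => i _.
Qed.

Lemma walkD_anti m q : (walkD m q.+1 <= walkD m q)%N.
Proof.
elim: m q => [|m IH] q; first by rewrite /walkD; case: q.
case: q => [|q]; first by rewrite walkDS walkDS0 leq_add.
by rewrite !walkDS leq_add.
Qed.

Lemma walkD_le m q : (walkD m q <= walkD m 0)%N.
Proof. by elim: q => // q; apply: leq_trans; exact: walkD_anti. Qed.

Lemma walkN_le m r : (walkN m r <= r * walkD m 0)%N.
Proof.
apply: (@leq_trans (\sum_(q < r) walkD m 0)).
  by apply: leq_sum => q _; exact: walkD_le.
by rewrite sum_nat_const card_ord.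
Qed.

(** The factor 2k+1 closes the induction: consecutive central coefficients have ratio 2(2k+1)/(k+1),
    and (2k+1)(2k+3) <= 4(k+1)^2. This yields the order 1/sqrt m without Stirling's formula. *)
Lemma central_bin_sqr k : ('C(k.*2, k) ^ 2 * k.*2.+1 <= 4 ^ k.*2)%N.
Proof.
elim: k => // k IH.
have e : (k.+1 * 'C(k.+1.*2, k.+1) = 2 * k.*2.+1 * 'C(k.*2, k))%N.
  rewrite -mul_bin_diag doubleS /=.
  have h2 := mul_bin_diag k.*2.+1 k.
  have h4 : ('C(k.*2.+1, k) = 'C(k.*2.+1, k.+1))%N.
    by rewrite -bin_sub; [congr 'C(_, _); rewrite -addnn; lia|rewrite -addnn; lia].
  by move: h2; rewrite h4 /= -addnn; nia.
rewrite -(@leq_pmul2l (k.+1 ^ 2)) ?expn_gt0//.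
rewrite mulnA -expnMn e doubleS !expnS expn0 muln1.
set c := 'C(k.*2, k) in IH *; set q := (4 ^ k.*2)%N in IH *.
rewrite -addnn in IH *; rewrite expnS expn1 in IH.
nia.
Qed.

Lemma walkD0_sqr m : (walkD m 0 ^ 2 * m <= 4 ^ m)%N.
Proof.
have even k : walkD k.*2 0 = 'C(k.*2, k).
  by rewrite /walkD addn0 /= uphalf_double.
rewrite -(odd_double_half m); case: odd => /=.
  rewrite add1n; have := central_bin_sqr m./2; rewrite -even.
  have : (walkD m./2.*2.+1 0 <= 2 * walkD m./2.*2 0)%N.
    by rewrite walkDS0; have := walkD_anti m./2.*2 0; lia.
  move=> h1 h2; apply: leq_trans (_ : (2 * walkD m./2.*2 0) ^ 2 * m./2.*2.+1 <= _)%N.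
    by rewrite leq_mul2r leq_exp2r// h1 orbT.
  by rewrite expnMn -mulnA (expnS 4) leq_mul.
rewrite add0n even; apply: leq_trans (central_bin_sqr _).
by rewrite leq_mul2l leqnSn orbT.
Qed.

End WalkNumbers.

Section LittlewoodOfford.
Set Implicit Arguments.
Unset Strict Implicit.
Variable (R : realFieldType) (d : R).
Hypothesis d_gt0 : 0 < d.
Implicit Types (ys : seq R) (ps : seq (R * R)).

Fixpoint bits (n : nat) : seq (seq bool) :=
  if n is n'.+1 then map (cons false) (bits n') ++ map (cons true) (bits n')
  else [:: [::]].

Lemma size_bits n : size (bits n) = (2 ^ n)%N.
Proof. by elim: n => //= n IH; rewrite size_cat !size_map IH addnn -mul2n expnS. Qed.

Lemma mem_bits n b : b \in bits n -> size b = n.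
Proof.
elim: n b => [|n IH] b /=; first by rewrite inE => /eqP ->.
by rewrite mem_cat => /orP[] /mapP[b' /IH <- ->].
Qed.

Fixpoint selsum (b : seq bool) ps : R :=
  match b, ps with
  | c :: b', p :: ps' => (if c then p.2 else p.1) + selsum b' ps'
  | _, _ => 0
  end.

(** Counting with multiplicity makes the total additive in the list of pieces, which allows pieces
    to be exchanged between two lists. *)
Definition in_pieces ys (x : R) : nat := count (fun y => y <= x < y + d) ys.

(** Left ends are listed in decreasing order, so a piece lying above all the others is added at the
    head. *)
Definition separated ys : bool := sorted (fun a b => b + d <= a) ys.

Definition shift (a : R) ys : seq R := [seq y - a | y <- ys].

Lemma in_pieces_shift a ys x : in_pieces ys (a + x) = in_pieces (shift a ys) x.
Proof.
rewrite /in_pieces count_map; apply: eq_count => y /=.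
by rewrite lerBlDl; congr (_ && _); apply/idP/idP => ?; lra.
Qed.

Lemma separated_shift a ys : separated ys -> separated (shift a ys).
Proof.
rewrite /separated sorted_map; congr is_true; apply: eq_sorted => x y /=.
by apply/idP/idP; lra.
Qed.

Lemma in_pieces_le1 ys x : separated ys -> (in_pieces ys x <= (0 < size ys))%N.
Proof.
elim: ys => //= y ys IH sy; have sys := path_sorted sy.
case: (boolP (y <= x < y + d)) => [/andP[yx _]|_]; rewrite /in_pieces /=.
  rewrite (_ : count _ _ = 0%N) //.
  apply/eqP; rewrite -leqn0 leqNgt -has_count; apply/hasP => -[y' y'ys].
  have trans : transitive (fun a b : R => b + d <= a).
    by move=> a b c ab bc; have := d_gt0; lra.
  have /allP /(_ _ y'ys) h := order_path_min trans sy.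
  by move=> /andP[_]; lra.
by rewrite add0n; apply: leq_trans (IH sys) _; case: size.
Qed.

Definition spread (p : R * R) : bool := d <= `|p.2 - p.1|.

Definition count_selsum ps ys : nat :=
  \sum_(b <- bits (size ps)) in_pieces ys (selsum b ps).

Lemma count_selsum_cons p ps ys : count_selsum (p :: ps) ys =
  (count_selsum ps (shift p.1 ys) + count_selsum ps (shift p.2 ys))%N.
Proof.
rewrite /count_selsum /= big_cat !big_map /=.
by congr addn; apply: eq_bigr => b _; rewrite in_pieces_shift.
Qed.

Lemma count_selsum_cat ps ys zs : count_selsum ps (ys ++ zs) =
  (count_selsum ps ys + count_selsum ps zs)%N.
Proof.
rewrite /count_selsum -big_split; apply: eq_bigr => b _.
by rewrite /in_pieces count_cat.
Qed.

Lemma count_selsum_nil ps : count_selsum ps [::] = 0%N.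
Proof. by rewrite /count_selsum big1. Qed.

Lemma separated_cons y y' ys : separated (y' :: ys) -> y' + d <= y ->
  separated (y :: y' :: ys).
Proof. by rewrite /separated /= => -> ->. Qed.

(** Induction on the pairs. A pair that is not spread only doubles the bound. For a spread pair, the
    top piece of the family shifted by the smaller value lies above every piece of the other family
    and can be moved there: two families of r+1 separated pieces become families of r+2 and r
    pieces. *)
Lemma count_selsum_le ps ys : separated ys ->
  (count_selsum ps ys <=
   2 ^ count (predC spread) ps * walkN (count spread ps) (size ys))%N.
Proof.
elim: ps ys => [|p ps IH] ys sys.
  rewrite /count_selsum /= big_seq1 expn0 mul1n.
  apply: leq_trans (in_pieces_le1 _ sys) _.
  by case: ys {sys} => //= y ys; rewrite walkN0.
rewrite count_selsum_cons /=; case: (boolP (spread p)) => sp /=; last first.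
  rewrite add0n add1n expnS mul2n -addnn mulnDl.
  apply: leq_add.
    by have := IH _ (separated_shift p.1 sys); rewrite size_map.
  by have := IH _ (separated_shift p.2 sys); rewrite size_map.
case: ys sys => [|y ys] sys; first by rewrite !count_selsum_nil.
rewrite add0n add1n walkNS mulnDr.
have step a b : b + d <= a ->
   (count_selsum ps (shift b (y :: ys)) + count_selsum ps (shift a (y :: ys)) <=
   2 ^ count (predC spread) ps * walkN (count spread ps) (size ys).+2 +
   2 ^ count (predC spread) ps * walkN (count spread ps) (size ys))%N.
  move=> ba; rewrite -cat1s {1}/shift map_cat /= -/(shift b ys) -cat1s.
  rewrite count_selsum_cat addnAC addnC -count_selsum_cat addnC.
  apply: leq_add; last first.
    rewrite -(size_map (fun y => y - b) ys); apply/IH/separated_shift.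
    exact: path_sorted sys.
  rewrite -(size_map (fun y => y - a) ys) -/(shift a ys).
  apply: (IH (y - b :: y - a :: shift a ys)); apply: separated_cons; last by lra.
  exact: (separated_shift a sys).
have [pp|pp] := leP p.1 p.2; move: sp; rewrite /spread.
  by rewrite ger0_norm ?subr_ge0// => sp; apply: step; lra.
rewrite ltr0_norm ?subr_lt0// => sp.
by rewrite [X in (X <= _)%N]addnC; apply: step; lra.
Qed.

Definition ladder (y : R) (r : nat) : seq R :=
  rev [seq y + d *+ k | k <- iota 0 r].

Lemma separated_ladder y r : separated (ladder y r).
Proof.
rewrite /separated rev_sorted sorted_map.
case: r => //= r; elim: r 0%N => //= r IH k.
by rewrite IH andbT mulrS; lra.
Qed.

Lemma in_pieces_ladder y r x : y <= x < y + d *+ r ->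
  (1 <= in_pieces (ladder y r) x)%N.
Proof.
rewrite /in_pieces /ladder count_rev -has_count.
elim: r => [|r IH] /andP[yx xr].
  by move: xr; rewrite mulr0n addr0 ltNge yx.
case: (ltP x (y + d *+ r)) => h.
  have /IH : y <= x < y + d *+ r by rewrite yx.
  by rewrite -[r.+1]addn1 iotaD map_cat has_cat => ->.
rewrite -[r.+1]addn1 iotaD map_cat has_cat /= add0n h.
by move: xr; rewrite mulrS => xr; rewrite (_ : _ < _) ?orbT//; lra.
Qed.

Lemma littlewood_offord ps y r :
  (\sum_(b <- bits (size ps)) nat_of_bool (y <= selsum b ps < y + d *+ r)%R <=
   2 ^ count (predC spread) ps * (r * walkD (count spread ps) 0))%N.
Proof.
apply: leq_trans (_ : count_selsum ps (ladder y r) <= _)%N.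
  apply: leq_sum => b _; case: (boolP (_ <= _ < _)) => // h.
  exact: in_pieces_ladder.
apply: leq_trans (count_selsum_le _ (separated_ladder y r)) _.
by rewrite leq_mul2l /ladder size_rev size_map size_iota walkN_le orbT.
Qed.

End LittlewoodOfford.

(** * Second moments and small balls of sums *)

Section SecondMoments.
Set Implicit Arguments.
Unset Strict Implicit.
Variable R : realType.
Local Notation pt := (R * R)%type.
Local Notation z0 := (Defs.z0 R).
Variable mu : probability pt R.
Implicit Types (s : seq pt) (w : nat -> pt) (f g : (nat -> pt) -> R).
Local Notation Ex := (Ex mu).

Lemma nice_sqr f : nice f -> nice (fun w => f w ^+ 2).
Proof. by move=> nf; apply: niceM. Qed.

Lemma nice_ge f t : nice f -> nice (fun w => (t <= `|f w|)%R%:R : R).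
Proof.
move=> [mf _]; apply: nice_bool => d T X mX.
apply: measurable_fun_ler; first exact: measurable_cst.
by apply: measurableT_comp => //; exact: mf.
Qed.

Lemma Ex_chebyshev n f t : nice f -> 0 < t ->
  Ex n (fun w => (t <= `|f w|)%R%:R) <= Ex n (fun w => f w ^+ 2) / t ^+ 2.
Proof.
move=> nf t0; rewrite ler_pdivlMr ?exprn_gt0// mulrC -ExZ; last exact: nice_ge.
apply: le_Ex; [exact/niceZ/nice_ge|exact: nice_sqr|] => w.
case: (leP t `|f w|) => [tf|_]; last by rewrite mulr0 sqr_ge0.
by rewrite mulr1 -[leRHS]real_normK ?num_real// ler_sqr ?nnegrE// ltW.
Qed.

(** Given the coordinates outside [l], [f] is a constant factor and [g] has mean zero. *)
Lemma Ex_orthogonal n l f g : nice f -> nice g -> {subset l <= iota 0 n} ->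
  (forall v v', (forall i, i \notin l -> v i = v' i) -> f v = f v') ->
  (forall w, Eseq mu l g w = 0) -> Ex n (fun w => f w * g w) = 0.
Proof.
move=> nf ng sub fl g0; rewrite (@Ex_absorb _ _ _ l)//; last exact: niceM.
rewrite (_ : Eseq mu l _ = fun=> 0) ?Ex_cst//.
by apply/funext => w; rewrite Eseq_mull// g0 mulr0.
Qed.

(** Reduces variance bounds to counting: after expanding the square only the related pairs survive,
    each contributing at most M^2. *)
Lemma second_moment_le n (T : finType) (P : pred T) (xi : T -> (nat -> pt) -> R)
    (M : R) (rel : T -> T -> bool) :
  (forall a, P a -> nice (xi a)) -> (forall a w, P a -> `|xi a w| <= M) ->
  (forall a b, P a -> P b -> ~~ rel a b -> Ex n (fun w => xi a w * xi b w) = 0) ->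
  Ex n (fun w => (\sum_(a | P a) xi a w) ^+ 2) <=
  M ^+ 2 * (\sum_(a | P a) \sum_(b | P b) rel a b)%:R.
Proof.
move=> nxi bxi orth.
have nxx a b : P a -> P b -> nice (fun w => xi a w * xi b w).
  by move=> Pa Pb; apply: niceM; exact: nxi.
rewrite (@eq_Ex _ _ _ _ (fun w => \sum_(a | P a) \sum_(b | P b) xi a w * xi b w)).
  rewrite Ex_sum; last by move=> a Pa; apply: nice_sum => b; exact: nxx.
  rewrite natr_sum mulr_sumr; apply: ler_sum => a Pa.
  rewrite Ex_sum; last by move=> b; exact: nxx.
  rewrite natr_sum mulr_sumr; apply: ler_sum => b Pb.
  case: (boolP (rel a b)) => [_|nab]; last by rewrite orth// mulr0.
  rewrite mulr1 -[leRHS](Ex_cst mu n); apply: le_Ex; [exact: nxx|exact: nice_cst|].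
  move=> w; rewrite (le_trans (ler_norm _))// normrM expr2 ler_pM//; exact: bxi.
by move=> w; rewrite expr2 mulr_suml; apply: eq_bigr => a _; rewrite mulr_sumr.
Qed.

End SecondMoments.

Section SumSmallBall.
Set Implicit Arguments.
Unset Strict Implicit.
Variable R : realType.
Local Notation pt := (R * R)%type.
Local Notation z0 := (Defs.z0 R).
Variable mu : probability pt R.
Implicit Types (s : seq pt) (w : nat -> pt).
Local Notation Ex := (Ex mu).
Variables (h : pt -> R) (d : R) (n : nat).
Hypothesis mh : measurable_fun setT h.
Hypotheses (d_gt0 : 0 < d) (n_gt0 : (0 < n)%N).

Let far s : R := (spread d (h (nth z0 s 0), h (nth z0 s 1)))%:R.
Let p : R := Ex 2 (fun w => far (mkseq w 2)).
(** The independent copy of the point [i] is stored at coordinate [n + i] of a sample of size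
    [n + n]. *)
Let farw i w : R := (spread d (h (w i), h (w (n + i)%N)))%:R.

Let nice_far : nice_seq 2 far.
Proof.
move=> [|i [|j []]]// _; apply: nice_bool => d1 T X mX; rewrite /spread /=.
apply: measurable_fun_ler; first exact: measurable_cst.
apply: (measurableT_comp (f := fun x : R => `|x|)) => //.
by apply: measurable_funB; exact: measurableT_comp.
Qed.

Let nice_farw i : nice (farw i).
Proof. exact: (nice_far (l := [:: i; (n + i)%N])). Qed.

Let Eseq_farw i w : Eseq mu [:: i; (n + i)%N] (farw i) w = p.
Proof.
apply: (@Eseq_marginal _ mu far [:: i; (n + i)%N]).
  exact: nice_far.
by rewrite /= inE andbT; apply/eqP; lia.
Qed.

Let p_itv : 0 <= p <= 1.
Proof.
apply/andP; split; first by apply: Ex_ge0 => [|w]; [apply: (nice_far (l := [:: 0%N; 1%N]))|exact: ler0n].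
rewrite -[leRHS](Ex_cst mu 2); apply: le_Ex; [exact: (nice_far (l := [:: 0%N; 1%N]))|exact: nice_cst|].
by move=> w; rewrite /far; case: spread.
Qed.

(** The indicators for different i use disjoint pairs of coordinates, so only the n diagonal terms
    remain. *)
Let far_moment :
  Ex (n + n) (fun w => (\sum_(i < n) (farw i w - p)) ^+ 2) <= n%:R.
Proof.
apply: le_trans (_ : 1 ^+ 2 * (\sum_(i < n) \sum_(j < n) (i == j))%:R <= _); last first.
  rewrite expr1n mul1r ler_nat -[leqRHS]card_ord -sum1_card leq_sum// => i _.
  by rewrite (bigD1 i)//= eqxx big1// => j; rewrite eq_sym => /negbTE ->.
have nf i : nice (fun w => farw i w - p) by apply: niceB => //; exact: nice_cst.
apply: second_moment_le => [i _|i w _|i j _ _ ij]; first exact: nf.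
  by have := p_itv; rewrite /farw ler_norml; case: spread => /=; lra.
apply: (Ex_orthogonal (l := [:: j : nat; (n + j)%N])); [exact: nf|exact: nf|..].
- move=> k; rewrite !inE mem_iota add0n leq0n /=.
  by have := ltn_ord j; move=> jn /orP[] /eqP ->; lia.
- move=> v v' vv'; have ij' : (i != j :> nat) by [].
  rewrite /farw !vv'// !inE; have := ltn_ord i; have := ltn_ord j; lia.
- move=> w; rewrite EseqB//; [|exact: nice_cst].
  by rewrite Eseq_cst Eseq_farw subrr.
Qed.

Let choice (b : seq bool) : seq nat :=
  [seq if c.1 then (n + c.2)%N else c.2 | c <- zip b (iota 0 n)].

Let size_choice b : size b = n -> size (choice b) = n.
Proof. by move=> bn; rewrite size_map size1_zip ?size_iota ?bn. Qed.

Let choice_lt b (c : bool * nat) : size b = n -> c \in zip b (iota 0 n) -> (c.2 < n)%N.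
Proof.
move=> bn cb; have : c.2 \in unzip2 (zip b (iota 0 n)) by exact: map_f.
by rewrite unzip2_zip ?size_iota ?bn// mem_iota add0n.
Qed.

Let uniq_choice b : size b = n -> uniq (choice b).
Proof.
move=> bn; have u2 : uniq (unzip2 (zip b (iota 0 n))).
  by rewrite unzip2_zip ?size_iota ?bn// iota_uniq.
rewrite map_inj_in_uniq; first exact: map_uniq u2.
move=> c c' cz cz' e; apply: (uniq_map_inj u2) => //.
have := choice_lt bn cz; have := choice_lt bn cz'.
by move: e; case: ifP => _; case: ifP => _; lia.
Qed.

Let sub_choice b : size b = n -> {subset choice b <= iota 0 (n + n)}.
Proof.
move=> bn _ /mapP[c cz ->]; rewrite mem_iota add0n leq0n /=.
by have := choice_lt bn cz; case: ifP => _; lia.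
Qed.

Let vals w : seq (R * R) := [seq (h (w i), h (w (n + i)%N)) | i <- iota 0 n].

Let selsum_vals b w : size b = n ->
  selsum b (vals w) = \sum_(i <- choice b) h (w i).
Proof.
rewrite /choice /vals big_map; move: (iota 0 n) (size_iota 0 n) => l ln bn.
have {ln bn} : size b = size l by rewrite ln.
elim: b l => [|c b IH] [|i l] //= => [_|[bl]]; first by rewrite big_nil.
by rewrite big_cons IH//=; case: c.
Qed.

Let walkD_le_sqrt m : p * n%:R / 2 <= m%:R -> 0 < p ->
  (walkD m 0)%:R <= 2 ^+ m * Num.sqrt (2 / (p * n%:R)).
Proof.
move=> pm p0; have pn0 : 0 < p * n%:R by rewrite mulr_gt0// ltr0n.
have q0 : 0 <= 2 / (p * n%:R) by rewrite divr_ge0// ltW.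
rewrite -ler_sqr ?nnegrE ?mulr_ge0 ?exprn_ge0 ?sqrtr_ge0//.
rewrite exprMn sqr_sqrtr// mulrA ler_pdivlMr//.
have := walkD0_sqr m; rewrite -(ler_nat R) natrM !natrX => hm.
have -> : (2 ^+ m) ^+ 2 = 4%:R ^+ m :> R.
  by rewrite -exprM mulnC exprM; congr (_ ^+ _); rewrite -natrX.
have h0 : 0 <= (walkD m 0)%:R ^+ 2 :> R by rewrite sqr_ge0.
have : (walkD m 0)%:R ^+ 2 * (p * n%:R / 2) <= 4%:R ^+ m :> R.
  by apply: le_trans hm; rewrite ler_wpM2l.
by lra.
Qed.

(* Each pair [w i], [w (n + i)] is exchangeable, so the sum may be randomised
   over all choices of one point per pair; the choices are then controlled
   by the Littlewood-Offord bound. *)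
Lemma sum_small_ball y r : 0 < p ->
  Ex n (fun w => (y <= \sum_(i < n) h (w i) < y + d *+ r)%R%:R) <=
  4 / (p ^+ 2 * n%:R) + r%:R * Num.sqrt (2 / (p * n%:R)).
Proof.
move=> p0; set rt := Num.sqrt _.
have n0 : 0 < n%:R :> R by rewrite ltr0n.
pose F s : R := (y <= \sum_(z <- s) h z < y + d *+ r)%R%:R.
have nF : nice_seq n F.
  move=> l _; apply: nice_bool => d1 T X mX.
  have ms : measurable_fun setT (fun t => \sum_(z <- map (X^~ t) l) h z).
    under eq_fun do rewrite big_map.
    by apply: measurable_sum => i; exact: measurableT_comp.
  by apply: measurable_and; [apply: measurable_fun_ler => //|
    apply: measurable_fun_ltr => //]; exact: measurable_cst.
have nFc b : b \in bits n -> nice (fun w => F (map w (choice b))).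
  by move=> /mem_bits bn; apply: nF; exact: size_choice.
have -> : Ex n (fun w => (y <= \sum_(i < n) h (w i) < y + d *+ r)%R%:R) =
    Ex n (fun w => F (mkseq w n)).
  by apply: eq_Ex => w; rewrite /F big_map -(big_mkord xpredT (fun i => h (w i)))
    /index_iota subn0.
(* Each of the 2^n choices consists of n distinct coordinates and therefore has the law of the
   original sample. *)
have avg : 2 ^+ n * Ex n (fun w => F (mkseq w n)) =
    Ex (n + n) (fun w => \sum_(b <- bits n | b \in bits n) F (map w (choice b))).
  rewrite Ex_sum// (eq_bigr (fun=> Ex n (fun w => F (mkseq w n)))); last first.
    move=> b /mem_bits bn.
    rewrite (@Ex_marginal _ _ _ F) ?size_choice//; [exact: uniq_choice|exact: sub_choice].
  by rewrite -big_seq big_const_seq count_predT size_bits iter_addr_0 -natrX mulr_natl.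
have ncheb : nice (fun w =>
    ((p * n%:R / 2 <= `|\sum_(i < n) (farw i w - p)|)%R%:R : R)).
  by apply: nice_ge; apply: nice_sum => i _; apply: niceB => //; exact: nice_cst.
have two_gt0 : 0 < 2 ^+ n :> R by rewrite exprn_gt0.
rewrite -(ler_pM2l two_gt0) avg.
(* Either the number of spread pairs deviates from its mean pn by at least pn/2, which Chebyshev
   bounds by 4/(p^2 n), or at least pn/2 pairs are spread and the deterministic bound applies to
   this outcome. *)
apply: (@le_trans _ _ (Ex (n + n) (fun w => 2 ^+ n *
   ((p * n%:R / 2 <= `|\sum_(i < n) (farw i w - p)|)%R%:R + r%:R * rt)))); last first.
  rewrite ExZ; last by apply: niceD => //; exact: nice_cst.
  rewrite ler_pM2l// ExD ?Ex_cst ?lerD2r//; last exact: nice_cst.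
  apply: le_trans (Ex_chebyshev _ _ _ _) _.
  - by apply: nice_sum => i _; apply: niceB => //; exact: nice_cst.
  - by rewrite !mulr_gt0.
  rewrite ler_pdivrMr ?exprn_gt0 ?mulr_gt0//.
  apply: le_trans far_moment _.
  rewrite (_ : 4 / (p ^+ 2 * n%:R) * (p * n%:R / 2) ^+ 2 = n%:R)//.
  by field; rewrite !gt_eqF.
apply: le_Ex.
- by apply: nice_sum => b; exact: nFc.
- by apply: niceZ; apply: niceD => //; exact: nice_cst.
move=> w; rewrite -big_seq.
have -> : \sum_(b <- bits n) F (map w (choice b)) =
   (\sum_(b <- bits (size (vals w)))
      nat_of_bool (y <= selsum b (vals w) < y + d *+ r)%R)%:R.
  rewrite natr_sum size_map size_iota big_seq [RHS]big_seq.
  by apply: eq_bigr => b /mem_bits bn; rewrite /F big_map selsum_vals.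
have rt0 : 0 <= r%:R * rt by rewrite mulr_ge0// sqrtr_ge0.
case: (leP (p * n%:R / 2) `|_|) => [_|lo].
  apply: (@le_trans _ _ (2 ^+ n)); last by rewrite mulrDr mulr1 lerDl mulr_ge0// ltW.
  rewrite -natrX ler_nat -(size_bits n) size_map size_iota -sum1_size.
  by apply: leq_sum => b _; case: (_ && _).
rewrite add0r.
set m := count (spread d) (vals w).
have mE : m%:R = \sum_(i < n) farw i w.
  rewrite /m /vals count_map -sum1_count natr_sum -(big_mkord xpredT (fun i => farw i w)).
  rewrite /index_iota subn0 big_mkcond; apply: eq_bigr => i _ /=.
  by rewrite /farw; case: spread.
have pm : p * n%:R / 2 <= m%:R.
  move: lo; rewrite sumrB -mE sumr_const card_ord -mulr_natr ltr_norml => /andP[].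
  by lra.
apply: le_trans (_ : (2 ^ count (predC (spread d)) (vals w) * (r * walkD m 0))%:R <= _).
  by rewrite ler_nat; exact: littlewood_offord.
(* The powers of two from the pairs that are not spread and from [walkD_le_sqrt] recombine to the
   total 2^n. *)
have e : (count (predC (spread d)) (vals w) + m = n)%N.
  by rewrite addnC count_predC size_map size_iota.
rewrite !natrM natrX -[in leRHS]e exprD -!mulrA ler_wpM2l ?exprn_ge0//.
by rewrite mulrCA ler_wpM2l// walkD_le_sqrt.
Qed.

End SumSmallBall.

(** * Hoeffding projection of pattern densities *)

Section UStatistics.
Set Implicit Arguments.
Unset Strict Implicit.
Variable R : realType.
Local Notation pt := (R * R)%type.
Local Notation z0 := (Defs.z0 R).
Variable mu : probability pt R.
Implicit Types (s : seq pt) (w : nat -> pt) (i : nat).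
Local Notation Ex := (Ex mu).
Variables (k : nat) (sigma : 'S_k).
Hypothesis k_gt0 : (0 < k)%N.

Let pat s : R := (has_pattern sigma s)%:R.

Lemma nice_seq_pattern : nice_seq k pat.
Proof. exact: nice_seq_bool (@has_pattern_order_determined R k k sigma). Qed.

Lemma CSE : CS mu sigma = Ex k (fun w => pat (mkseq w k)).
Proof.
by rewrite /CS sampleP_Ex//; exact: has_pattern_order_determined.
Qed.

(* The first-order projection [P (Pi_k (z, Z_2, ..., Z_k) = sigma)]. *)
Definition projection (z : pt) : R :=
  Eseq mu (iota 1 k.-1) (fun w => pat (map w (0%N :: iota 1 k.-1))) (fun=> z).

Lemma Eseq_pattern i l w : uniq (i :: l) -> size l = k.-1 ->
  Eseq mu l (fun v => pat (map v (i :: l))) w = projection (w i).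
Proof.
move=> /= /andP[il ul] sl; apply: EFin_inj; rewrite /projection.
have n1 : nice_seq (size ([:: i] ++ l)) pat by rewrite /= sl prednK//; exact: nice_seq_pattern.
have n2 : nice_seq (size ([:: 0%N] ++ iota 1 k.-1)) pat.
  by rewrite /= size_iota prednK//; exact: nice_seq_pattern.
rewrite -(iprod_Eseq mu (l0 := [:: i]) w n1 ul); last first.
  by move=> j jl; rewrite inE; apply: contraNneq il => <-.
rewrite -(iprod_Eseq mu (l0 := [:: 0%N]) (fun=> w i) n2 (iota_uniq _ _)).
  by rewrite size_iota sl.
by move=> j; rewrite mem_iota inE => /andP[j0 _]; rewrite -lt0n.
Qed.

Lemma nice_projection i : nice (fun w => projection (w i)).
Proof.
pose l := iota i.+1 k.-1.
have ul : uniq (i :: l) by rewrite (iota_uniq i k.-1.+1).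
rewrite (_ : (fun w => _) = Eseq mu l (fun v => pat (map v (i :: l)))).
  apply: nice_Eseq; apply: nice_seq_pattern.
  by rewrite /= size_iota prednK.
by apply/funext => w; rewrite Eseq_pattern ?size_iota.
Qed.

Lemma measurable_projection : measurable_fun setT projection.
Proof. by have [/(_ _ _ (fun=> id)) + _] := nice_projection 0; apply. Qed.

Lemma projection_itv z : 0 <= projection z <= 1.
Proof.
have nf : nice (fun w => pat (map w (0%N :: iota 1 k.-1))).
  by apply: nice_seq_pattern; rewrite /= size_iota prednK.
apply/andP; split.
  rewrite -(Eseq_cst mu (iota 1 k.-1) 0 (fun=> z)).
  by apply: le_Eseq; [exact: nice_cst|exact: nf|move=> v; exact: ler0n].
rewrite -[leRHS](Eseq_cst mu (iota 1 k.-1) 1 (fun=> z)).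
by apply: le_Eseq; [exact: nf|exact: nice_cst|move=> v; rewrite /pat; case: has_pattern].
Qed.

Lemma Ecoord_projection i w :
  Ecoord mu i (fun v => projection (v i)) w = CS mu sigma.
Proof.
pose l := iota i.+1 k.-1.
have ul : uniq (i :: l) by rewrite (iota_uniq i k.-1.+1).
have sl : size (i :: l) = k by rewrite /= size_iota prednK.
rewrite (_ : (fun w => _) = Eseq mu l (fun v => pat (map v (i :: l)))); last first.
  by apply/funext => v; rewrite Eseq_pattern ?size_iota.
rewrite CSE -[in RHS]sl -(@Eseq_marginal _ mu pat (i :: l) _ ul w)// sl.
exact: nice_seq_pattern.
Qed.

Lemma Eseq_projection i l w : i \in l ->
  Eseq mu l (fun v => projection (v i)) w = CS mu sigma.
Proof.
move=> il; rewrite -(Eseq_absorb1 mu (nice_projection i) il).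
by rewrite -[RHS](Eseq_cst mu l _ w); congr (Eseq mu l _ w); apply/funext => v;
  rewrite Ecoord_projection.
Qed.

Lemma CS_itv : 0 <= CS mu sigma <= 1.
Proof.
rewrite -(Ecoord_projection 0 (fun=> z0)).
apply/andP; split.
  rewrite -[leLHS](Ecoord_cst mu 0 0 (fun=> z0)).
  apply: le_Ecoord; [exact: nice_cst|exact: nice_projection|move=> w].
  by have /andP[] := projection_itv (w 0%N).
rewrite -[leRHS](Ecoord_cst mu 0 1 (fun=> z0)).
apply: le_Ecoord; [exact: nice_projection|exact: nice_cst|move=> w].
by have /andP[] := projection_itv (w 0%N).
Qed.

Section Subsets.
Local Close Scope classical_set_scope.
Variable n : nat.
Implicit Types I J B : {set 'I_n}.

Definition idx I : seq nat := map val (enum I).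

Lemma uniq_idx I : uniq (idx I).
Proof. by rewrite map_inj_uniq ?enum_uniq//; exact: val_inj. Qed.

Lemma size_idx I : size (idx I) = #|I|.
Proof. by rewrite size_map -cardE. Qed.

Lemma mem_idx I (i : 'I_n) : (val i \in idx I) = (i \in I).
Proof. by rewrite mem_map ?mem_enum//; exact: val_inj. Qed.

Lemma sub_idx I : {subset idx I <= iota 0 n}.
Proof. by move=> _ /mapP[i _ ->]; rewrite mem_iota add0n ltn_ord. Qed.

Definition kernel I w : R := pat (map w (idx I)).

Lemma nice_kernel I : #|I| == k -> nice (kernel I).
Proof. by move=> /eqP Ik; apply: nice_seq_pattern; rewrite size_idx. Qed.

Lemma Eseq_kernel I w : #|I| == k -> Eseq mu (idx I) (kernel I) w = CS mu sigma.
Proof.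
move=> /eqP Ik; rewrite /kernel (@Eseq_marginal _ mu pat) ?uniq_idx// size_idx Ik.
  by rewrite CSE.
exact: nice_seq_pattern.
Qed.

(** The point [i] may stand anywhere in [enum I], while [projection] expects it first; patterns do
    not see the order of the sample. *)
Lemma Eseq_kernel1 I (i : 'I_n) w : #|I| == k -> i \in I ->
  Eseq mu (idx (I :\ i)) (kernel I) w = projection (w i).
Proof.
move=> /eqP Ik iI.
have u : uniq (val i :: idx (I :\ i)).
  by rewrite /= uniq_idx andbT mem_idx !inE eqxx.
rewrite -(Eseq_pattern w u); last first.
  by rewrite size_idx; have := cardsD1 i I; rewrite iI Ik add1n => ->.
congr (Eseq mu _ _ w); apply/funext => v; rewrite /kernel /pat.
congr ((nat_of_bool _)%:R); apply/has_pattern_perm/perm_map/uniq_perm => //.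
  exact: uniq_idx.
move=> j; apply/mapP/idP => [[j' j'I ->]|].
  move: j'I; rewrite mem_enum inE => j'I; case: (eqVneq j' i) => [->|ne].
    by rewrite eqxx.
  by rewrite mem_idx !inE ne j'I orbT.
rewrite inE => /predU1P[->|/mapP[j' +] ->]; first by exists i; rewrite ?mem_enum.
by rewrite mem_enum !inE => /andP[_ j'I]; exists j'; rewrite ?mem_enum.
Qed.

Lemma nice_projC i : nice (fun w => projection (w i) - CS mu sigma).
Proof. by apply: niceB; [exact: nice_projection|exact: nice_cst]. Qed.

Lemma nice_kernelC I : #|I| == k -> nice (fun w => kernel I w - CS mu sigma).
Proof. by move=> Ik; apply: niceB; [exact: nice_kernel|exact: nice_cst]. Qed.

Lemma kernelC_le1 I w : `|kernel I w - CS mu sigma| <= 1.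
Proof.
by have := CS_itv; rewrite /kernel /pat ler_norml; case: has_pattern => /=; lra.
Qed.

(** The completely first-order degenerate part of the Hoeffding decomposition of the kernel. *)
Definition residual I w : R :=
  kernel I w - CS mu sigma - \sum_(i in I) (projection (w i) - CS mu sigma).

Lemma nice_residual I : #|I| == k -> nice (residual I).
Proof.
move=> Ik; apply: niceB; first exact: nice_kernelC.
by apply: nice_sum => i _; exact: nice_projC.
Qed.

Lemma residual_le I w : #|I| == k -> `|residual I w| <= k%:R + 1.
Proof.
move=> /eqP Ik; rewrite (le_trans (ler_normB _ _))// addrC lerD ?kernelC_le1//.
have -> : k%:R = \sum_(i in I) 1 :> R by rewrite sumr_const Ik.
rewrite (le_trans (ler_norm_sum _ _ _))// ler_sum// => i _.
by have := CS_itv; have := projection_itv (w i); rewrite ler_norml; lra.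
Qed.

Lemma kernel_indep I (l : seq nat) v v' : {in idx I, forall i, i \notin l} ->
  (forall i, i \notin l -> v i = v' i) -> kernel I v = kernel I v'.
Proof.
move=> dis vv'; rewrite /kernel; congr pat; apply/eq_in_map => i iI.
by apply: vv'; exact: dis.
Qed.

Lemma residual_indep I (l : seq nat) v v' : {in idx I, forall i, i \notin l} ->
  (forall i, i \notin l -> v i = v' i) -> residual I v = residual I v'.
Proof.
move=> dis vv'; rewrite /residual (kernel_indep dis vv'); congr (_ - _).
apply: eq_bigr => i iI; rewrite vv'//.
by apply: dis; rewrite mem_idx.
Qed.

(** Integrating out all points of [I] but [i] turns the kernel into its projection at [i], which the
    term of [i] cancels; the terms of the other points average to zero. *)
Lemma Eseq_residual I (i : 'I_n) w : #|I| == k -> i \in I ->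
  Eseq mu (idx (I :\ i)) (residual I) w = 0.
Proof.
move=> Ik iI; rewrite EseqB; [|exact: nice_kernelC|by apply: nice_sum => j _; exact: nice_projC].
rewrite EseqB; [|exact: nice_kernel|exact: nice_cst].
rewrite Eseq_cst Eseq_kernel1// Eseq_sum; last by move=> j _; exact: nice_projC.
rewrite (bigD1 i)//= big1 => [|j /andP[jI ji]].
  rewrite EseqB; [|exact: nice_projection|exact: nice_cst].
  rewrite Eseq_cst (_ : Eseq _ _ _ _ = projection (w i)) ?addr0 ?subrr//.
  rewrite -[RHS](Eseq_cst mu (idx (I :\ i)) _ w); apply: eq_in_Eseq => v vw.
  by rewrite vw// mem_idx !inE eqxx.
rewrite EseqB; [|exact: nice_projection|exact: nice_cst].
by rewrite Eseq_cst Eseq_projection ?subrr// mem_idx !inE ji.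
Qed.

Lemma idx_disjoint I J : [disjoint I & J] -> {in idx I, forall i, i \notin idx J}.
Proof.
move=> dIJ _ /mapP[i + ->]; rewrite mem_enum mem_idx => iI.
by rewrite (disjointFr dIJ).
Qed.

Lemma kernel_orthogonal I J : #|I| == k -> #|J| == k -> [disjoint I & J] ->
  Ex n (fun w => (kernel I w - CS mu sigma) * (kernel J w - CS mu sigma)) = 0.
Proof.
move=> Ik Jk dIJ; apply: (Ex_orthogonal (l := idx J)).
- exact: nice_kernelC.
- exact: nice_kernelC.
- exact: sub_idx.
- by move=> v v' vv'; rewrite (kernel_indep (idx_disjoint dIJ) vv').
- move=> w; rewrite EseqB; [|exact: nice_kernel|exact: nice_cst].
  by rewrite Eseq_kernel// Eseq_cst subrr.
Qed.

(** Integrate out [J] except its common point with [I], or except an arbitrary point if there is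
    none: the residual of [I] is unaffected and that of [J] vanishes. *)
Lemma residual_orthogonal I J : #|I| == k -> #|J| == k -> (#|I :&: J| <= 1)%N ->
  Ex n (fun w => residual I w * residual J w) = 0.
Proof.
move=> Ik Jk IJ.
have [i iJ dis] : exists2 i, i \in J & [disjoint I & J :\ i].
  have [e|[i]] := set_0Vmem (I :&: J).
    have /card_gt0P[i iJ] : (0 < #|J|)%N by rewrite (eqP Jk).
    exists i => //; apply: disjointWr (subD1set _ _) _.
    by rewrite -setI_eq0 e.
  rewrite inE => /andP[iI iJ]; exists i => //.
  rewrite -setI_eq0 -finset.subset0; apply/fintype.subsetP => j; rewrite !inE.
  move=> /and3P[jI ji jJ]; move: IJ; rewrite leqNgt => /negP; case.
  by apply/card_gt1P; exists i, j; rewrite !inE iI iJ jI jJ eq_sym.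
apply: (Ex_orthogonal (l := idx (J :\ i))).
- exact: nice_residual.
- exact: nice_residual.
- exact: sub_idx.
- by move=> v v' vv'; rewrite (residual_indep (idx_disjoint dis) vv').
- by move=> w; exact: Eseq_residual.
Qed.

Lemma card_supersets B : (#|B| <= k)%N ->
  (\sum_(J : {set 'I_n} | #|J| == k) (B \subset J) = 'C(n - #|B|, k - #|B|))%N.
Proof.
move=> Bk; have <- : #|~: B| = (n - #|B|)%N by rewrite cardsCs finset.setCK card_ord.
rewrite -cards_draws -sum1_card;
rewrite [LHS](_ : _ = \sum_(J : {set 'I_n} | (#|J| == k) && (B \subset J)) 1)%N;
  last by rewrite [RHS]big_mkcondr; apply: eq_bigr => J _; case: (_ \subset _).
rewrite (reindex_onto (fun A : {set 'I_n} => A :|: B) (fun J => J :\: B)) /=.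
  apply: eq_bigl => A; rewrite inE finset.subsetUr andbT.
  apply/andP/andP => [[/eqP AB /eqP e]|[AB /eqP Ak]].
    have dAB : A \subset ~: B by rewrite -e finset.setDE finset.subsetIr.
    split => //; rewrite -AB cardsU (_ : A :&: B = finset.set0) ?cards0 ?subn0 ?addnK//.
    by apply/eqP; rewrite setI_eq0 finset.disjoints_subset.
  have dAB : A :&: B = finset.set0 by apply/eqP; rewrite setI_eq0 finset.disjoints_subset.
  split; first by rewrite cardsU dAB cards0 subn0 Ak subnK.
  apply/eqP/finset.setP => i; rewrite !inE; case: (boolP (i \in B)) => iB /=.
    by apply/esym/negbTE; apply/negP => iA; move/finset.setP/(_ i): dAB; rewrite !inE iA iB.
  by rewrite orbF.
move=> J /andP[_ BJ]; apply/finset.setP => i; rewrite !inE.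
by case: (boolP (i \in B)) => [/(fintype.subsetP BJ) ->|_]; rewrite ?orbT ?orbF.
Qed.

(** Union bound over the common point: at most k 'C(n-1, k-1) sets meet a given one, and n 'C(n-1,
    k-1) = k 'C(n, k). *)
Lemma count_meeting_pairs : (k <= n)%N ->
  (n * (\sum_(I : {set 'I_n} | #|I| == k) \sum_(J : {set 'I_n} | #|J| == k)
    ~~ [disjoint I & J]) <= k ^ 2 * 'C(n, k) ^ 2)%N.
Proof.
move=> kn; have n0 : (0 < n)%N by exact: leq_trans kn.
have cardk : (\sum_(I : {set 'I_n} | #|I| == k) 1 = 'C(n, k))%N.
  by rewrite -[in RHS](card_ord n) -card_draws -sum1_card; apply: eq_bigl => I; rewrite inE.
apply: (@leq_trans (n * \sum_(I : {set 'I_n} | #|I| == k) (k * 'C(n.-1, k.-1)))).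
  rewrite leq_mul2l; apply/orP; right; apply: leq_sum => I /eqP Ik.
  apply: (@leq_trans (\sum_(J : {set 'I_n} | #|J| == k) \sum_(i in I) (i \in J))).
    apply: leq_sum => J _; case: (boolP [disjoint I & J]) => //= dIJ.
    have /set0Pn[i] : I :&: J != finset.set0 by rewrite setI_eq0.
    by rewrite inE => /andP[iI iJ]; rewrite (bigD1 i)//= iJ.
  rewrite exchange_big /= -Ik -sum_nat_const; apply: leq_sum => i _.
  under eq_bigr do rewrite -finset.sub1set.
  by rewrite Ik card_supersets cards1 ?subn1.
have -> : (\sum_(I : {set 'I_n} | #|I| == k) (k * 'C(n.-1, k.-1)) = 'C(n, k) * (k * 'C(n.-1, k.-1)))%N.
  by rewrite -cardk big_distrl /=; apply: eq_bigr => I _; rewrite mul1n.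
have := mul_bin_diag n k.-1; rewrite prednK// => e.
by rewrite mulnCA (mulnCA n) e; apply/eq_leq; ring.
Qed.

(** Union bound over ordered pairs of common points; two absorption identities give k^3 (k-1), which
    is rounded up to k^4. *)
Lemma count_overlapping_pairs : (k <= n)%N ->
  (n * n.-1 * (\sum_(I : {set 'I_n} | #|I| == k) \sum_(J : {set 'I_n} | #|J| == k)
    (1 < #|I :&: J|)) <= k ^ 4 * 'C(n, k) ^ 2)%N.
Proof.
move=> kn; have n0 : (0 < n)%N by exact: leq_trans kn.
have cardk : (\sum_(I : {set 'I_n} | #|I| == k) 1 = 'C(n, k))%N.
  by rewrite -[in RHS](card_ord n) -card_draws -sum1_card; apply: eq_bigl => I; rewrite inE.
(* For k = 1 the truncated [k.-2] breaks the absorption identity, but then no two sets share two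
   points. *)
case: (ltnP 1 k) => k1; last first.
  rewrite big1 ?muln0// => I /eqP Ik; apply: big1 => J _; apply/eqP.
  by rewrite eqb0 -leqNgt (leq_trans _ k1)// -Ik subset_leq_card// subsetIl.
apply: (@leq_trans (n * n.-1 * \sum_(I : {set 'I_n} | #|I| == k) (k ^ 2 * 'C(n.-2, k.-2)))).
  rewrite leq_mul2l; apply/orP; right; apply: leq_sum => I /eqP Ik.
  apply: (@leq_trans (\sum_(J : {set 'I_n} | #|J| == k)
     \sum_(i in I) \sum_(j in I) ((i != j) && ([set i; j] \subset J)))).
    apply: leq_sum => J _; case: ltnP => //= /card_gt1P[i [j []]].
    rewrite !inE => /andP[iI iJ] /andP[jI jJ] ij.
    rewrite (bigD1 i)//= (bigD1 j)//= ij (_ : _ \subset _) //.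
    by apply/fintype.subsetP => x; rewrite !inE => /orP[] /eqP ->.
  rewrite exchange_big /= expnS expn1 -mulnA -[X in (_ <= X * _)%N]Ik -sum_nat_const.
  apply: leq_sum => i _; rewrite exchange_big /= -[X in (_ <= X * _)%N]Ik -sum_nat_const.
  apply: leq_sum => j _; case: (eqVneq i j) => [_|ij] /=; first by rewrite big1.
  by rewrite card_supersets cards2 ij//= !subn2.
have -> : (\sum_(I : {set 'I_n} | #|I| == k) (k ^ 2 * 'C(n.-2, k.-2)) = 'C(n, k) * (k ^ 2 * 'C(n.-2, k.-2)))%N.
  by rewrite -cardk big_distrl /=; apply: eq_bigr => I _; rewrite mul1n.
have e1 := mul_bin_diag n k.-1; rewrite prednK// in e1.
have e2 := mul_bin_diag n.-1 k.-2.
have k2 : (k.-2.+1 = k.-1)%N by rewrite -subn2 -subn1; lia.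
rewrite k2 in e2.
have e : (n * n.-1 * 'C(n.-2, k.-2) = k * k.-1 * 'C(n, k))%N.
  by rewrite -mulnA e2 mulnCA e1; ring.
rewrite (_ : n * n.-1 * ('C(n, k) * (k ^ 2 * 'C(n.-2, k.-2))) =
  'C(n, k) ^ 2 * (k ^ 3 * k.-1))%N; last first.
  rewrite (_ : n * n.-1 * ('C(n, k) * (k ^ 2 * 'C(n.-2, k.-2))) =
   'C(n, k) * k ^ 2 * (n * n.-1 * 'C(n.-2, k.-2)))%N; last by ring.
  by rewrite e; ring.
rewrite mulnC leq_mul2r; apply/orP; right.
by rewrite (expnS k 3) mulnC leq_mul2r leq_pred orbT.
Qed.

End Subsets.

End UStatistics.

(** * Moments of the pattern densities and nondegeneracy *)

Section UMoments.
Set Implicit Arguments.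
Unset Strict Implicit.
Variable R : realType.
Local Notation pt := (R * R)%type.
Local Notation z0 := (Defs.z0 R).
Variable mu : probability pt R.
Implicit Types (s : seq pt) (w : nat -> pt) (i : nat).
Local Notation Ex := (Ex mu).
Variables (k : nat) (sigma : 'S_k).
Hypothesis k_gt0 : (0 < k)%N.
Local Notation c := (CS mu sigma).
Local Notation proj := (projection mu sigma).

Lemma sample_densityE n w : sample_density sigma n (mkseq w n) =
  (\sum_(I : {set 'I_n} | #|I| == k) kernel sigma I w) / 'C(n, k)%:R :> R.
Proof.
rewrite /sample_density; congr (_ / _); apply: eq_bigr => I _.
by rewrite subsample_mkseq.
Qed.

Lemma card_ksets n : (\sum_(I : {set 'I_n} | #|I| == k) 1 = 'C(n, k))%N.
Proof.
rewrite -[in RHS](card_ord n) -card_draws -sum1_card.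
by apply: eq_bigl => I; rewrite inE.
Qed.

Lemma nice_sample_density n : nice (fun w => sample_density sigma n (mkseq w n) : R).
Proof.
rewrite (_ : (fun w => _) = fun w =>
  ('C(n, k)%:R)^-1 * \sum_(I : {set 'I_n} | #|I| == k) kernel sigma I w).
  by apply: niceZ; apply: nice_sum => I; exact: nice_kernel.
by apply/funext => w; rewrite sample_densityE mulrC.
Qed.

Lemma density_centered n w : (k <= n)%N ->
  sample_density sigma n (mkseq w n) - c =
  (\sum_(I : {set 'I_n} | #|I| == k) (kernel sigma I w - c)) / 'C(n, k)%:R.
Proof.
move=> kn; have C0 : 'C(n, k)%:R != 0 :> R by rewrite pnatr_eq0 -lt0n bin_gt0.
rewrite sample_densityE sumrB mulrBl; congr (_ - _).
rewrite (eq_bigr (fun=> c * 1%:R)) => [|I _]; last by rewrite mulr1.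
by rewrite -mulr_sumr -natr_sum card_ksets mulfK.
Qed.

(** Centred kernels on disjoint index sets are orthogonal, and the proportion of pairs that meet is
    at most k^2/n. *)
Lemma density_variance n : (k <= n)%N ->
  n%:R * Ex n (fun w => (sample_density sigma n (mkseq w n) - c) ^+ 2) <= k%:R ^+ 2.
Proof.
move=> kn; have C0 : 0 < 'C(n, k)%:R :> R by rewrite ltr0n bin_gt0.
have nS : nice (fun w => \sum_(I : {set 'I_n} | #|I| == k) (kernel sigma I w - c)).
  by apply: nice_sum => I Ik; exact: nice_kernelC.
rewrite (@eq_Ex _ _ _ _ (fun w => ('C(n, k)%:R ^+ 2)^-1 *
   (\sum_(I : {set 'I_n} | #|I| == k) (kernel sigma I w - c)) ^+ 2)); last first.
  by move=> w; rewrite density_centered// expr_div_n mulrC.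
rewrite ExZ; last exact: nice_sqr.
rewrite mulrCA mulrC ler_pdivrMr ?exprn_gt0//.
apply: (@le_trans _ _ (n%:R * (1 ^+ 2 * (\sum_(I : {set 'I_n} | #|I| == k)
    \sum_(J : {set 'I_n} | #|J| == k) ~~ [disjoint I & J]%B)%:R))).
  rewrite ler_wpM2l//; apply: second_moment_le => [I Ik|I w _|I J Ik Jk].
  - exact: nice_kernelC.
  - exact: kernelC_le1.
  - by rewrite negbK => dIJ; exact: kernel_orthogonal.
rewrite expr1n mul1r -natrM -!natrX -natrM ler_nat.
exact: count_meeting_pairs.
Qed.

Lemma sum_ksets n (x : 'I_n -> R) : (0 < n)%N ->
  \sum_(I : {set 'I_n} | #|I| == k) \sum_(i in I) x i =
  'C(n.-1, k.-1)%:R * \sum_i x i.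
Proof.
move=> n0.
rewrite (eq_bigr (fun I : {set 'I_n} => \sum_i (i \in I)%:R * x i)); last first.
  by move=> I _; rewrite big_mkcond; apply: eq_bigr => i _;
    case: (i \in I); rewrite ?mul1r ?mul0r.
rewrite exchange_big mulr_sumr; apply: eq_bigr => i _.
rewrite -mulr_suml -natr_sum; congr (_%:R * _).
rewrite -[n.-1]subn1 -[k.-1]subn1 -(cards1 i) -card_supersets ?cards1//.
by apply: eq_bigr => I _; rewrite finset.sub1set.
Qed.

(** The Hajek projection of the centred density; k/n is the proportion of k-subsets that contain a
    given point. *)
Definition linear_part n w : R :=
  k%:R / n%:R * \sum_(i < n) (proj (w i) - c).

Lemma nice_linear_part n : nice (linear_part n).
Proof. by apply: niceZ; apply: nice_sum => i _; exact: nice_projC. Qed.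

(* Hoeffding: the density minus its linear part is the average of the
   residuals, which are orthogonal unless two index sets share two points. *)
Lemma hoeffding_remainder n : (k <= n)%N ->
  n%:R * n.-1%:R *
    Ex n (fun w => (sample_density sigma n (mkseq w n) - c - linear_part n w) ^+ 2)
  <= (k%:R + 1) ^+ 2 * k%:R ^+ 4.
Proof.
move=> kn; have C0 : 0 < 'C(n, k)%:R :> R by rewrite ltr0n bin_gt0.
have n0 : (0 < n)%N by exact: leq_trans kn.
have nS : nice (fun w => \sum_(I : {set 'I_n} | #|I| == k) residual mu sigma I w).
  by apply: nice_sum => I Ik; exact: nice_residual.
rewrite (@eq_Ex _ _ _ _ (fun w => ('C(n, k)%:R ^+ 2)^-1 *
   (\sum_(I : {set 'I_n} | #|I| == k) residual mu sigma I w) ^+ 2)); last first.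
  move=> w; rewrite density_centered//.
  have -> : \sum_(I : {set 'I_n} | #|I| == k) residual mu sigma I w =
      \sum_(I : {set 'I_n} | #|I| == k) (kernel sigma I w - c) -
      'C(n.-1, k.-1)%:R * \sum_(i < n) (proj (w i) - c).
    by rewrite /residual sumrB sum_ksets.
  suff -> : linear_part n w =
      'C(n.-1, k.-1)%:R * (\sum_(i < n) (proj (w i) - c)) / 'C(n, k)%:R.
    by rewrite -mulrBl expr_div_n mulrC.
  rewrite /linear_part [RHS]mulrAC; congr (_ * _).
  have := mul_bin_diag n k.-1; rewrite prednK// => /(congr1 (fun m => m%:R : R)).
  rewrite !natrM => e; apply/eqP; rewrite eqr_div; [|by rewrite pnatr_eq0 -lt0n|by rewrite gt_eqF].
  by apply/eqP; rewrite [RHS]mulrC e.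
rewrite ExZ; last exact: nice_sqr.
rewrite mulrCA mulrC ler_pdivrMr ?exprn_gt0//.
apply: (@le_trans _ _ (n%:R * n.-1%:R * ((k%:R + 1) ^+ 2 *
    (\sum_(I : {set 'I_n} | #|I| == k)
    \sum_(J : {set 'I_n} | #|J| == k) (1 < #|I :&: J|))%:R))).
  rewrite ler_wpM2l//; apply: second_moment_le => [I Ik|I w Ik|I J Ik Jk].
  - exact: nice_residual.
  - exact: residual_le.
  - by rewrite -leqNgt => dIJ; exact: residual_orthogonal.
rewrite mulrCA -[leRHS]mulrA ler_wpM2l ?sqr_ge0// -!natrX -!natrM ler_nat.
exact: count_overlapping_pairs.
Qed.

(** Given the shared first point the two patterns are independent, each with conditional probability
    [proj]. The nondegeneracy condition thus says that the projection has positive variance. *)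
Lemma CS2_second_moment :
  CS2 mu sigma sigma = Ecoord mu 0 (fun w => proj (w 0%N) ^+ 2) (fun=> z0).
Proof.
pose pat s : R := (has_pattern sigma s)%:R.
set m := (k + k - 1)%N.
pose F s : R := pat (take k s) * pat (take 1 s ++ drop k s).
have km : (k <= m)%N by rewrite /m; lia.
have nF : nice_seq m F.
  move=> l lm; rewrite /F; apply: niceM.
    under eq_fun do rewrite -map_take.
    by apply: nice_seq_pattern; rewrite size_take lm; case: ltnP => //; lia.
  under eq_fun do rewrite -map_take -map_drop -map_cat.
  apply: nice_seq_pattern; rewrite size_cat size_drop size_take lm.
  by case: ltnP; rewrite /m; lia.
have -> : CS2 mu sigma sigma = fine (iprod mu m (fun s => (F s)%:E)).
  rewrite /CS2 /sampleP; congr (fine (iprod _ _ _)); apply/funext => s.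
  by rewrite /F /pat -natrM mulnb.
rewrite iprod_Ex//=.
(* Coordinate 0 is the shared point; [l1] and [l2] are the private coordinates of the two
   patterns. *)
pose l1 := iota 1 k.-1; pose l2 := iota k k.-1.
have sl1 : size l1 = k.-1 by rewrite size_iota.
have sl2 : size l2 = k.-1 by rewrite size_iota.
have e : iota 0 m = (0%N :: l1) ++ l2.
  rewrite -[0%N :: l1]/(iota 0 k.-1.+1) prednK// /l2 -[X in iota X k.-1]add0n -iotaD.
  by congr iota; rewrite /m; lia.
have u : uniq ((0%N :: l1) ++ l2) by rewrite -e iota_uniq.
have np l : size l = k.-1 -> nice (fun w => pat (map w (0%N :: l))).
  by move=> sl; apply: nice_seq_pattern; rewrite /= sl prednK.
rewrite (@eq_Ex _ _ _ _ (fun w => pat (map w (0%N :: l1)) * pat (map w (0%N :: l2)))); last first.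
  move=> w; rewrite /F /mkseq e map_cat take_size_cat; last by rewrite size_map /= sl1 prednK.
  rewrite drop_size_cat; last by rewrite size_map /= sl1 prednK.
  by rewrite /= take0.
rewrite (@Ex_absorb _ _ _ l2); last 2 first.
- by apply: niceM; exact: np.
- by move=> j jl; rewrite e mem_cat jl orbT.
rewrite (@eq_Ex _ _ _ _ (fun w => proj (w 0%N) * pat (map w (0%N :: l1)))); last first.
  move=> w; rewrite Eseq_mull; last 2 first.
  - exact: np.
  - move=> v v' vv'; congr pat; apply/eq_in_map => j jl; apply: vv'.
    by move: u; rewrite cat_uniq => /and3P[_ /hasPn h _]; apply/negP => /h; rewrite jl.
  rewrite mulrC Eseq_pattern//.
  by move: u; rewrite cat_cons /= mem_cat negb_or cat_uniq => /andP[/andP[_ ->] /and3P[]].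
have n1 : nice (fun w => proj (w 0%N)) by exact: nice_projection.
rewrite (@Ex_absorb _ _ _ l1); last 2 first.
- by apply: niceM => //; exact: np.
- by move=> j jl; rewrite e mem_cat inE jl orbT.
have u1 : uniq (0%N :: l1) by move: u; rewrite cat_uniq => /andP[].
rewrite (@eq_Ex _ _ _ _ (fun w => proj (w 0%N) ^+ 2)); last first.
  move=> w; rewrite Eseq_mull; last 2 first.
  - exact: np.
  - by move=> v v' vv'; rewrite vv'//; move: u1 => /= /andP[].
  by rewrite Eseq_pattern.
rewrite (@Ex_absorb _ _ _ [:: 0%N]); last 2 first.
- exact: nice_sqr.
- by move=> j; rewrite inE => /eqP ->; rewrite e.
rewrite /= (_ : Ecoord _ _ _ = fun=> Ecoord mu 0 (fun w => proj (w 0%N) ^+ 2) (fun=> z0)) ?Ex_cst//.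
Qed.

Definition far_prob d : R :=
  Ex 2 (fun w => (spread d (proj (nth z0 (mkseq w 2) 0), proj (nth z0 (mkseq w 2) 1)))%:R).

(** Let v be the variance of the projection and d = sqrt v. The squared difference of two
    independent projections has mean 2v, is at most 1 on the spread event and at most v off it;
    hence the spread event has probability at least v. *)
Lemma nondegenerate_spread : CS2 mu sigma sigma - c ^+ 2 != 0 ->
  exists2 d : R, 0 < d & 0 < far_prob d.
Proof.
rewrite CS2_second_moment; set m2 := Ecoord _ _ _ _ => nd.
have n0 i : nice (fun w => proj (w i)) by exact: nice_projection.
have E2 i w : Ecoord mu i (fun v => proj (v i) ^+ 2) w = m2.
  by apply: eq_Rintegral => z _; rewrite !upd_eq.
have nD : nice (fun w => (proj (w 1%N) - proj (w 0%N)) ^+ 2).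
  by apply: nice_sqr; exact: niceB.
have var : Ex 2 (fun w => (proj (w 1%N) - proj (w 0%N)) ^+ 2) = 2 * (m2 - c ^+ 2).
  rewrite (@eq_Ex _ _ _ _ (fun w => proj (w 1%N) ^+ 2 + (proj (w 0%N) ^+ 2 +
    (-2) * (proj (w 0%N) * proj (w 1%N))))); last by move=> w; ring.
  have ns i : nice (fun w => proj (w i) ^+ 2) by exact: nice_sqr.
  have nm : nice (fun w => proj (w 0%N) * proj (w 1%N)) by exact: niceM.
  rewrite ExD//; last by apply: niceD => //; exact: niceZ.
  rewrite ExD//; last exact: niceZ.
  rewrite ExZ//.
  have sq i : (i < 2)%N -> Ex 2 (fun w => proj (w i) ^+ 2) = m2.
    move=> i2; rewrite (@Ex_absorb _ _ _ [:: i])//; last first.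
      by move=> j; rewrite inE mem_iota => /eqP ->.
    by rewrite (_ : Eseq _ _ _ = fun=> m2) ?Ex_cst//; apply/funext => w; exact: E2.
  rewrite !sq// (@Ex_absorb _ _ _ [:: 1%N])//; last by move=> j; rewrite inE => /eqP ->.
  rewrite (@eq_Ex _ _ _ _ (fun w => c * proj (w 0%N))); last first.
    move=> w; rewrite Eseq_mull//; last by move=> v v' vv'; rewrite vv'.
    by rewrite /= Ecoord_projection// mulrC.
  rewrite ExZ// (@Ex_absorb _ _ _ [:: 0%N])//; last by move=> j; rewrite inE => /eqP ->.
  rewrite (_ : Eseq _ _ _ = fun=> c) ?Ex_cst; first by ring.
  by apply/funext => w; rewrite /= Ecoord_projection.
have v0 : 0 < m2 - c ^+ 2.
  rewrite lt_neqAle eq_sym nd -(pmulr_rge0 _ (ltr0n _ 2)) -var.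
  by apply: Ex_ge0 => // w; exact: sqr_ge0.
exists (Num.sqrt (m2 - c ^+ 2)); first by rewrite sqrtr_gt0.
apply: (@lt_le_trans _ _ (2 * (m2 - c ^+ 2) - (m2 - c ^+ 2))); first by lra.
rewrite -{1}var lerBlDr -[X in _ + X](Ex_cst mu 2).
have nf : nice (fun w => (spread (Num.sqrt (m2 - c ^+ 2))
   (proj (nth z0 (mkseq w 2) 0), proj (nth z0 (mkseq w 2) 1)))%:R : R).
  by apply: (nice_ge (f := fun w => proj (w 1%N) - proj (w 0%N))); exact: niceB.
rewrite /far_prob -ExD//; last exact: nice_cst.
apply: le_Ex => //; first by apply: niceD => //; exact: nice_cst.
move=> w; rewrite /spread /=; set x := proj _; set y := proj _.
have /andP[x0 x1] := projection_itv mu sigma k_gt0 (w 1%N).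
have /andP[y0 y1] := projection_itv mu sigma k_gt0 (w 0%N).
rewrite -/x -/y in x0 x1 y0 y1.
case: (leP (Num.sqrt (m2 - c ^+ 2)) `|x - y|) => [_|h] /=.
  have : 0 <= (1 - (x - y)) * (1 + (x - y)) by rewrite mulr_ge0//; lra.
  rewrite (_ : (1 - (x - y)) * (1 + (x - y)) = 1 - (x - y) ^+ 2); last by ring.
  by move: v0; lra.
rewrite add0r -(sqr_sqrtr (ltW v0)) -[leLHS]real_normK ?num_real//.
by rewrite ler_sqr ?nnegrE ?sqrtr_ge0// ltW.
Qed.

End UMoments.

(** * Small balls and atoms of one pattern density *)

Section DensityAsymptotics.
Set Implicit Arguments.
Unset Strict Implicit.
Variable R : realType.
Local Notation pt := (R * R)%type.
Local Notation z0 := (Defs.z0 R).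
Variable mu : probability pt R.
Implicit Types (s : seq pt) (w : nat -> pt) (i : nat).
Local Notation Ex := (Ex mu).
Variables (k : nat) (sigma : 'S_k).
Hypothesis k_gt0 : (0 < k)%N.
Local Notation c := (CS mu sigma).
Local Notation proj := (projection mu sigma).
Local Notation dens n w := (sample_density sigma n (mkseq w n)).

Let K : R := (k%:R + 1) ^+ 2 * k%:R ^+ 4.

Lemma nice_le_density n (a x y : R) :
  nice (fun w => (a * `|dens n w - y| <= x)%R%:R : R).
Proof.
have [mf _] := niceB (@nice_sample_density R k sigma n) (@nice_cst _ _ R y).
apply: nice_bool => d T X mX; apply: measurable_fun_ler; last exact: measurable_cst.
apply: measurable_funM; first exact: measurable_cst.
by apply: (measurableT_comp (f := fun x : R => `|x|)) => //; exact: mf.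
Qed.

Lemma nice_eq_density n (a x y : R) :
  nice (fun w => (a * `|dens n w - y| == x)%R%:R : R).
Proof.
have [mf _] := niceB (@nice_sample_density R k sigma n) (@nice_cst _ _ R y).
apply: nice_bool => d T X mX; apply: measurable_fun_eqr; last exact: measurable_cst.
apply: measurable_funM; first exact: measurable_cst.
by apply: (measurableT_comp (f := fun x : R => `|x|)) => //; exact: mf.
Qed.

Lemma hoeffding_remainder1 n : (k <= n)%N -> (1 < n)%N ->
  n%:R * Ex n (fun w => (dens n w - c - linear_part mu sigma n w) ^+ 2) <=
  K / n.-1%:R.
Proof.
move=> kn n1; rewrite ler_pdivlMr ?ltr0n; last by lia.
by rewrite mulrAC; exact: hoeffding_remainder.
Qed.

(** Either the Hoeffding remainder is at least delta / sqrt n, or the linear part alone stays within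
    2 delta / sqrt n of its target. The latter confines the sum of projections to an interval of
    length 4 delta sqrt n / k, which r pieces of length d cover. *)
Lemma density_small_ball_bound n (d delta y : R) : (k <= n)%N -> (1 < n)%N ->
  0 < d -> 0 < delta -> 0 < far_prob mu sigma d ->
  Ex n (fun w => (Num.sqrt n%:R * `|dens n w - y| <= delta)%R%:R) <=
  K / n.-1%:R / delta ^+ 2 + (4 / (far_prob mu sigma d ^+ 2 * n%:R) +
   (Num.trunc (4 * delta * Num.sqrt n%:R / (k%:R * d))).+1%:R *
     Num.sqrt (2 / (far_prob mu sigma d * n%:R))).
Proof.
move=> kn n1 d0 delta0 p0; set r := (Num.trunc _).+1.
have n0 : (0 < n)%N by lia.
have nR0 : 0 < n%:R :> R by rewrite ltr0n.
have kR0 : 0 < k%:R :> R by rewrite ltr0n.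
set sn := Num.sqrt n%:R; have sn0 : 0 < sn by rewrite sqrtr_gt0.
have snn : sn * sn = n%:R by rewrite -expr2 sqr_sqrtr// ltW.
(* The left end of that interval; its centre is the value of the sum at which [c] plus the linear
   part equals [y]. *)
pose y' := n%:R * c - n%:R / k%:R * (c - y) - 2 * delta * sn / k%:R.
have nrem : nice (fun w => dens n w - c - linear_part mu sigma n w).
  apply: niceB; last exact: nice_linear_part.
  by apply: niceB; [exact: nice_sample_density|exact: nice_cst].
have mp := measurable_projection mu sigma k_gt0.
have nball : nice (fun w => (y' <= \sum_(i < n) proj (w i) < y' + d *+ r)%R%:R : R).
  apply: nice_bool => d1 T X mX.
  have ms : measurable_fun setT (fun t => \sum_(i < n) proj (X i t)).
    by apply: measurable_sum => i; exact: measurableT_comp.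
  by apply: measurable_and; [apply: measurable_fun_ler => //|
    apply: measurable_fun_ltr => //]; exact: measurable_cst.
apply: (@le_trans _ _ (Ex n (fun w =>
  (delta / sn <= `|dens n w - c - linear_part mu sigma n w|)%R%:R +
  (y' <= \sum_(i < n) proj (w i) < y' + d *+ r)%R%:R))); last first.
  rewrite ExD//; last exact: nice_ge.
  apply: lerD; last exact: (sum_small_ball mp d0 n0 y' r p0).
  apply: le_trans (Ex_chebyshev _ _ _ _) _ => //; first exact: divr_gt0.
  rewrite ler_pdivlMr ?exprn_gt0//.
  apply: le_trans (hoeffding_remainder1 kn n1).
  rewrite -[X in X * Ex _ _]snn le_eqVlt; apply/orP; left; apply/eqP.
  by field; rewrite !gt_eqF.
apply: le_Ex; [exact: nice_le_density|apply: niceD => //; exact: nice_ge|].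
move=> w; case: (boolP (sn * _ <= delta)) => [le_d|_]; last by rewrite addr_ge0.
case: (leP (delta / sn) `|_|) => [_|lt_rem]; first by rewrite lerDl.
rewrite add0r (_ : (_ && _) = true) //.
move: le_d lt_rem; set D := dens n w; rewrite /linear_part => le_d.
rewrite ltr_pdivlMr//.
rewrite sumrB sumr_const card_ord -[c *+ n]mulr_natl.
set S := \sum_(i < n) _ => lt_rem.
have : `|sn * (c + k%:R / n%:R * (S - n%:R * c) - y)| < 2 * delta.
  have -> : sn * (c + k%:R / n%:R * (S - n%:R * c) - y) =
    sn * (D - y) - sn * (D - c - k%:R / n%:R * (S - n%:R * c)) by ring.
  apply: le_lt_trans (ler_normB _ _) _; rewrite !normrM (gtr0_norm sn0).
  by move: le_d lt_rem; lra.
have -> : sn * (c + k%:R / n%:R * (S - n%:R * c) - y) =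
   (S - (n%:R * c - n%:R / k%:R * (c - y))) * (k%:R / sn).
  by rewrite -snn; field; rewrite !gt_eqF.
rewrite normrM (gtr0_norm (divr_gt0 kR0 sn0)) mulrA ltr_pdivrMr//.
rewrite -ltr_pdivlMr// ltr_norml => /andP[lo hi].
have rd : 4 * delta * sn / k%:R < d *+ r.
  have := truncnS_gt (4 * delta * sn / (k%:R * d)).
  rewrite -/r ltr_pdivrMr ?mulr_gt0// -mulr_natr => h.
  by rewrite ltr_pdivrMr//; move: h; lra.
apply/andP; split; rewrite /y'; first by move: lo; lra.
have e4 : 4 * delta * sn / k%:R = 2 * (2 * delta * sn / k%:R) by ring.
by rewrite e4 in rd; move: hi rd; lra.
Qed.

(** The centre [y] is quantified after [n], since the balls used later sit at places that depend on
    [n]. *)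
Lemma density_small_ball (eps : R) : CS2 mu sigma sigma - c ^+ 2 != 0 -> 0 < eps ->
  exists2 delta : R, 0 < delta & \forall n \near \oo, forall y,
   Ex n (fun w => (Num.sqrt n%:R * `|dens n w - y| <= delta)%R%:R) <= eps.
Proof.
move=> /(nondegenerate_spread k_gt0)[d d0]; set p := far_prob mu sigma d => p0 eps0.
have kR0 : 0 < k%:R :> R by rewrite ltr0n.
set q := Num.sqrt (2 / p).
have q0 : 0 < q by rewrite sqrtr_gt0 divr_gt0.
(* Makes the leading term 4 delta q / (k d) equal to eps/4. The remainder, the Chebyshev term and
   the rounding in r take another eps/4 each for large n. *)
pose delta := eps * k%:R * d / (16 * q).
have delta0 : 0 < delta by rewrite divr_gt0// ?mulr_gt0.
exists delta => //; near=> n; move=> y.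
have n1 : (1 < n)%N by near: n; exact: nbhs_infty_gt.
have n0 : 0 < n%:R :> R by rewrite ltr0n; lia.
have n10 : 0 < n.-1%:R :> R by rewrite ltr0n; lia.
have nE : n%:R = n.-1%:R + 1 :> R by rewrite natr1 prednK//; lia.
have kn : (k <= n)%N by near: n; exact: nbhs_infty_ge.
apply: le_trans (density_small_ball_bound y kn n1 d0 delta0 p0) _; rewrite -/p.
set sn := Num.sqrt n%:R; have sn0 : 0 < sn by rewrite sqrtr_gt0.
have t1 : K / n.-1%:R / delta ^+ 2 <= eps / 4.
  rewrite ler_pdivrMr ?exprn_gt0// ler_pdivrMr//.
  have D0 : 0 < eps / 4 * delta ^+ 2.
    by apply: mulr_gt0; [exact: divr_gt0|exact: exprn_gt0].
  have : K / (eps / 4 * delta ^+ 2) + 1 <= n%:R by near: n; exact: nbhs_infty_ger.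
  by rewrite nE lerD2r ler_pdivrMr// => h; rewrite [leRHS]mulrC.
have t2 : 4 / (p ^+ 2 * n%:R) <= eps / 4.
  rewrite ler_pdivrMr ?mulr_gt0 ?exprn_gt0//.
  have : 4 / (eps / 4 * p ^+ 2) <= n%:R by near: n; exact: nbhs_infty_ger.
  by rewrite ler_pdivrMr ?mulr_gt0 ?exprn_gt0// => h; rewrite mulrA [leRHS]mulrC.
have qE : Num.sqrt (2 / (p * n%:R)) = q / sn.
  by rewrite invfM mulrA sqrtrM ?divr_ge0 ?ltW// sqrtrV ?ltW.
have t4 : q / sn <= eps / 4.
  rewrite ler_pdivrMr//.
  have h : (q / (eps / 4)) ^+ 2 <= n%:R by near: n; exact: nbhs_infty_ger.
  rewrite mulrC -ler_pdivrMr ?divr_gt0//.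
  have snn : sn ^+ 2 = n%:R by rewrite sqr_sqrtr// ltW.
  rewrite -(@ler_sqr _ (q / _)) ?snn// nnegrE; last exact: ltW.
  by rewrite divr_ge0// ltW// divr_gt0.
have t3 : (Num.trunc (4 * delta * sn / (k%:R * d))).+1%:R * (q / sn) <= eps / 4 + eps / 4.
  apply: (@le_trans _ _ ((4 * delta * sn / (k%:R * d) + 1) * (q / sn))).
    apply: ler_wpM2r; first by rewrite ltW// divr_gt0.
    rewrite -natr1 lerD2r truncn_le ltW// divr_gt0//; last exact: mulr_gt0.
    by apply: mulr_gt0 => //; apply: mulr_gt0.
  rewrite mulrDl mul1r lerD// /delta le_eqVlt; apply/orP; left; apply/eqP.
  by field; rewrite !gt_eqF.
by rewrite qE; lra.
Unshelve. all: by end_near. Qed.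

(** Degeneracy annihilates the diagonal terms of the expanded square, independence the others. *)
Lemma degenerate_linear_part n : CS2 mu sigma sigma - c ^+ 2 = 0 ->
  Ex n (fun w => linear_part mu sigma n w ^+ 2) = 0.
Proof.
rewrite CS2_second_moment// => deg.
have np i : nice (fun w => proj (w i) - c) by exact: nice_projC.
rewrite (@eq_Ex _ _ _ _ (fun w => (k%:R / n%:R) ^+ 2 *
  \sum_(i < n) \sum_(j < n) (proj (w i) - c) * (proj (w j) - c))); last first.
  move=> w; rewrite /linear_part exprMn; congr (_ * _).
  by rewrite expr2 mulr_suml; apply: eq_bigr => i _; rewrite mulr_sumr.
have nn (i j : 'I_n) : nice (fun w => (proj (w i) - c) * (proj (w j) - c)) by exact: niceM.
rewrite ExZ; last by apply: nice_sum => i _; apply: nice_sum => j _; exact: nn.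
rewrite Ex_sum; last by move=> i _; apply: nice_sum => j _; exact: nn.
rewrite big1 ?mulr0// => i _; rewrite Ex_sum//; apply: big1 => j _.
have n0 (l : nat) : nice (fun w => proj (w l)) by exact: nice_projection.
have sub (l : 'I_n) : {subset [:: val l] <= iota 0 n}.
  by move=> l'; rewrite inE mem_iota add0n => /eqP ->; rewrite ltn_ord.
case: (eqVneq i j) => [<-|ij].
  rewrite (@Ex_absorb _ _ _ [:: val i])//.
  rewrite (_ : Eseq _ _ _ = fun=> 0) ?Ex_cst//; apply/funext => w /=.
  rewrite (_ : (fun _ => _) = fun w : nat -> pt => proj (w i) ^+ 2 + ((- (2 * c)) * proj (w i) + c ^+ 2)).
    rewrite EcoordD; [|exact: nice_sqr|by apply: niceD; [exact: niceZ|exact: nice_cst]].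
    rewrite EcoordD; [|exact: niceZ|exact: nice_cst].
    rewrite EcoordZ// Ecoord_cst Ecoord_projection//.
    rewrite (_ : Ecoord _ _ _ _ = c ^+ 2); first by ring.
    apply/eqP; rewrite -subr_eq0 -[X in _ == X]deg; apply/eqP; congr (_ - _).
    by apply: eq_Rintegral => z _; rewrite !upd_eq.
  by apply/funext => v; ring.
apply: (Ex_orthogonal (l := [:: val j])) => //.
  by move=> v v' vv'; rewrite vv'// inE.
move=> w /=; rewrite EcoordD//; last exact: nice_cst.
by rewrite Ecoord_cst Ecoord_projection// subrr.
Qed.

(** The lower bound [delta] on the level keeps away from 0, where the term of a degenerate pattern
    concentrates. *)
Lemma density_atom (a delta eps : R) : 0 < a -> 0 < delta -> 0 < eps ->
  \forall n \near \oo, forall x, delta <= x ->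
   Ex n (fun w => (Num.sqrt n%:R * (a * `|dens n w - c|) == x)%R%:R) <= eps.
Proof.
move=> a0 delta0 eps0.
have nev n x : nice (fun w => (Num.sqrt n%:R * (a * `|dens n w - c|) == x)%R%:R : R).
  have := nice_eq_density n (Num.sqrt n%:R * a) x c.
  by congr nice; apply/funext => w; rewrite mulrA.
case: (eqVneq (CS2 mu sigma sigma - c ^+ 2) 0) => [deg|nd]; last first.
  have [d d0 ball] := density_small_ball nd (divr_gt0 eps0 (ltr0n _ 2)).
  near=> n; move=> x _.
  have n0 : 0 < n%:R :> R by rewrite ltr0n; near: n; exact: nbhs_infty_gt.
  have bn : forall y, Ex n (fun w => (Num.sqrt n%:R * `|dens n w - y| <= d)%R%:R) <= eps / 2.
    by near: n; exact: ball.
  move: bn; set sn := Num.sqrt n%:R => bn; have sn0 : 0 < sn by rewrite sqrtr_gt0.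
  (* Fixing the absolute deviation leaves two possible values of the density, each the centre of a
     ball of probability at most eps/2. *)
  apply: (@le_trans _ _ (Ex n (fun w =>
     (sn * `|dens n w - (c + x / (sn * a))| <= d)%R%:R +
     (sn * `|dens n w - (c - x / (sn * a))| <= d)%R%:R))); last first.
    rewrite ExD; [|exact: nice_le_density|exact: nice_le_density].
    by rewrite [leRHS]splitr lerD.
  apply: le_Ex; [exact: nev|by apply: niceD; exact: nice_le_density|].
  move=> w; case: eqP => [xE|_]; last by rewrite addr_ge0.
  have : `|dens n w - c| = x / (sn * a).
    by rewrite -xE; field; rewrite !gt_eqF.
  move: (x / (sn * a)) => u; case: (ger0P (dens n w - c)) => _ e.
    rewrite (_ : dens n w - (c + u) = 0); last by rewrite -e; ring.
    by rewrite normr0 mulr0 (ltW d0) lerDl.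
  rewrite [X in _ + X](_ : _ = 1) ?lerDr//.
  rewrite (_ : dens n w - (c - u) = 0); last by rewrite -e; ring.
  by rewrite normr0 mulr0 (ltW d0).
near=> n; move=> x dx.
have n1 : (1 < n)%N by near: n; exact: nbhs_infty_gt.
have kn : (k <= n)%N by near: n; exact: nbhs_infty_ge.
have n0 : 0 < n%:R :> R by rewrite ltr0n; lia.
have n10 : 0 < n.-1%:R :> R by rewrite ltr0n; lia.
have nE : n%:R = n.-1%:R + 1 :> R by rewrite natr1 prednK//; lia.
set sn := Num.sqrt n%:R; have sn0 : 0 < sn by rewrite sqrtr_gt0.
have nD : nice (fun w => dens n w - c).
  by apply: niceB; [exact: nice_sample_density|exact: nice_cst].
have nL := nice_linear_part mu sigma k_gt0 n.
have nrem : nice (fun w => dens n w - c - linear_part mu sigma n w) by exact: niceB.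
(* As the linear part vanishes in L^2, n times the variance is of order 1/n and Chebyshev at a fixed
   level suffices. *)
have var : n%:R * Ex n (fun w => (dens n w - c) ^+ 2) <= 2 * (K / n.-1%:R).
  apply: (@le_trans _ _ (n%:R * Ex n (fun w =>
     2 * (dens n w - c - linear_part mu sigma n w) ^+ 2 +
     2 * linear_part mu sigma n w ^+ 2))).
    rewrite ler_pM2l//; apply: le_Ex; first exact: nice_sqr.
      by apply: niceD; apply: niceZ; exact: nice_sqr.
    move=> w; set L := linear_part _ _ _ _; set D := dens n w - c.
    by rewrite -subr_ge0 (_ : _ - _ = (D - 2 * L) ^+ 2) ?sqr_ge0//; ring.
  rewrite ExD; [|by apply: niceZ; exact: nice_sqr|by apply: niceZ; exact: nice_sqr].
  rewrite !ExZ; [|exact: nice_sqr|exact: nice_sqr].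
  rewrite degenerate_linear_part// mulr0 addr0 mulrCA ler_pM2l//.
  exact: hoeffding_remainder1.
apply: (@le_trans _ _ (Ex n (fun w => (delta / (sn * a) <= `|dens n w - c|)%R%:R))).
  apply: le_Ex; [exact: nev|exact: nice_ge|].
  move=> w; case: eqP => [xE|_] //.
  suff le_d : delta / (sn * a) <= `|dens n w - c| by rewrite le_d.
  rewrite ler_pdivrMr ?mulr_gt0//.
  by apply: le_trans dx _; rewrite -xE le_eqVlt; apply/orP; left; apply/eqP; ring.
apply: le_trans (Ex_chebyshev _ _ _ _) _ => //; first by rewrite divr_gt0// mulr_gt0.
rewrite ler_pdivrMr ?exprn_gt0 ?divr_gt0 ?mulr_gt0//.
have -> : (delta / (sn * a)) ^+ 2 = delta ^+ 2 / (n%:R * a ^+ 2).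
  by rewrite expr_div_n exprMn sqr_sqrtr// ltW.
rewrite mulrA ler_pdivlMr; last by rewrite mulr_gt0 ?exprn_gt0.
rewrite mulrA [_ * n%:R]mulrC.
apply: le_trans (_ : 2 * (K / n.-1%:R) * a ^+ 2 <= _).
  by rewrite ler_wpM2r// exprn_ge0// ltW.
rewrite mulrA mulrAC ler_pdivrMr//.
have : 2 * K * a ^+ 2 / (eps * delta ^+ 2) + 1 <= n%:R by near: n; exact: nbhs_infty_ger.
by rewrite nE lerD2r ler_pdivrMr ?mulr_gt0 ?exprn_gt0// [X in _ <= X -> _]mulrC.
Unshelve. all: by end_near. Qed.

End DensityAsymptotics.

(** * The Kolmogorov-Smirnov statistic *)

Section KolmogorovSmirnov.
Set Implicit Arguments.
Unset Strict Implicit.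
Variable R : realType.
Local Notation pt := (R * R)%type.
Local Notation z0 := (Defs.z0 R).
Variable mu0 : probability pt R.
Implicit Types (s : seq pt) (w : nat -> pt).

Definition ks_weight j : R := Num.sqrt (pw R j) / j%:R.

Definition ks_term n j (sigma : 'S_j) s : R :=
  Num.sqrt n%:R * (ks_weight j * `|sample_density sigma n s - CS mu0 sigma|).

Definition ks_stat n s : R := Num.sqrt n%:R *
  \big[Num.max/0]_(j < n.+1 | (0 < j)%N) \big[Num.max/0]_(sigma : 'S_j)
     (ks_weight j * `|sample_density sigma n s - CS mu0 sigma|).

Lemma gamma_w_gt0 : 0 < gamma_w R.
Proof.
by rewrite /gamma_w divr_gt0 ?expR_gt0// subr_gt0 -expR0 ltr_expR oppr_lt0 invr_gt0.
Qed.

Lemma pw_gt0 j : 0 < pw R j.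
Proof.
by rewrite /pw divr_gt0 ?gamma_w_gt0// mulr_gt0 ?exprn_gt0// ltr0n fact_gt0.
Qed.

Lemma ks_weight_gt0 j : (0 < j)%N -> 0 < ks_weight j.
Proof. by move=> j0; rewrite divr_gt0 ?ltr0n// sqrtr_gt0 pw_gt0. Qed.

Lemma KSGF_sample n (pi : 'S_n) s : has_pattern pi s ->
  KSGF mu0 pi = ks_stat n s.
Proof.
move=> hp; rewrite /KSGF /ks_stat; congr (_ * _).
apply: eq_bigr => j _; apply: eq_bigr => sigma _.
by rewrite (tdens_sample sigma hp).
Qed.

(** A sample with ties has no pattern at all, whence the factor [noties]; under a copula it costs no
    probability. *)
Lemma KS_event_sample n P s : size s = n ->
  KS_event mu0 n P s = noties s && P (ks_stat n s).
Proof.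
move=> sn; apply/existsP/andP => [[pi /andP[hp]]|[nt Ps]].
  rewrite (KSGF_sample hp) => ->; split => //.
  by move: hp; rewrite /has_pattern => /andP[/andP[]].
by have [pi hp] := pattern_exists sn nt; exists pi; rewrite hp (KSGF_sample hp).
Qed.

Lemma ks_stat_ge n j (sigma : 'S_j) s : (0 < j)%N -> (j <= n)%N ->
  ks_term n sigma s <= ks_stat n s.
Proof.
move=> j0 jn; rewrite /ks_term /ks_stat ler_wpM2l ?sqrtr_ge0//.
have jn1 : (j < n.+1)%N by [].
apply: (le_trans _ (@le_bigmax_cond _ _ _ 0 (Ordinal jn1)
   (fun j : 'I_n.+1 => (0 < j)%N) (fun j : 'I_n.+1 => \big[Num.max/0]_(sigma : 'S_j)
     (ks_weight j * `|sample_density sigma n s - CS mu0 sigma|)) j0)).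
exact: (@le_bigmax _ _ _ 0 (fun sigma : 'S_j =>
  ks_weight j * `|sample_density sigma n s - CS mu0 sigma|)).
Qed.

Lemma ks_stat_ge0 n s : 0 <= ks_stat n s.
Proof. by rewrite mulr_ge0 ?sqrtr_ge0// bigmax_ge_id. Qed.

Lemma ks_stat_lt n s x : (0 < n)%N -> 0 < x ->
  (forall j (sigma : 'S_j), (0 < j)%N -> (j <= n)%N -> ks_term n sigma s < x) ->
  ks_stat n s < x.
Proof.
move=> n0 x0 H; have sn0 : 0 < Num.sqrt n%:R :> R by rewrite sqrtr_gt0 ltr0n.
rewrite /ks_stat mulrC -ltr_pdivlMr//.
apply: bigmax_lt => [|j j0]; first exact: divr_gt0.
apply: bigmax_lt => [|sigma _]; first exact: divr_gt0.
by rewrite ltr_pdivlMr// mulrC; apply: H => //; rewrite -ltnS.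
Qed.

(** Positivity rules out the default value 0 of the iterated maximum. *)
Lemma ks_stat_attained n s : (0 < n)%N -> 0 < ks_stat n s ->
  exists (j : 'I_n.+1) (sigma : 'S_j), (0 < j)%N /\ ks_term n sigma s = ks_stat n s.
Proof.
move=> n0 x0; apply: contrapT => H.
suff : ks_stat n s < ks_stat n s by rewrite ltxx.
apply: ks_stat_lt => // j sigma j0 jn; rewrite lt_neqAle ks_stat_ge// andbT.
apply/eqP => e; apply: H.
have jn1 : (j < n.+1)%N by [].
by exists (Ordinal jn1), sigma.
Qed.

Lemma ks_stat_order_determined n : order_determined n (ks_stat n).
Proof.
move=> s t sn st; rewrite /ks_stat; congr (_ * _).
apply: eq_bigr => j _; apply: eq_bigr => sigma _.
by rewrite (sample_density_order_determined sigma sn st).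
Qed.

Lemma ks_event_order_determined n (P : R -> bool) :
  order_determined n (fun s => noties s && P (ks_stat n s)).
Proof.
move=> s t sn st.
by rewrite (noties_order_determined sn st) (ks_stat_order_determined sn st).
Qed.

Section Probabilities.
Variable mu : probability pt R.
Local Notation Ex := (Ex mu).

Definition ks_prob n (P : R -> bool) : R :=
  Ex n (fun w => (noties (mkseq w n) && P (ks_stat n (mkseq w n)))%:R).

Lemma sampleP_KS_event n P : sampleP mu n (KS_event mu0 n P) = (ks_prob n P)%:E.
Proof.
have e s : size s = n -> KS_event mu0 n P s = noties s && P (ks_stat n s).
  exact: KS_event_sample.
rewrite sampleP_Ex.
  by congr EFin; apply: eq_Ex => w; rewrite e ?size_mkseq.
move=> s t sn st; rewrite !e//; first exact: (ks_event_order_determined P sn st).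
by have [<-] := st.
Qed.

Lemma nice_ks_event n (P : R -> bool) :
  nice (fun w => (noties (mkseq w n) && P (ks_stat n (mkseq w n)))%:R : R).
Proof.
by apply: (nice_seq_bool (ks_event_order_determined (n := n) P)); exact: size_iota.
Qed.

Lemma le_ks_prob n (P Q : R -> bool) : (forall s, size s = n -> noties s ->
    P (ks_stat n s) -> Q (ks_stat n s)) -> ks_prob n P <= ks_prob n Q.
Proof.
move=> PQ; apply: le_Ex; [exact: nice_ks_event|exact: nice_ks_event|] => w.
case: (boolP (noties _)) => //= nt; rewrite ler_nat.
case: (boolP (P _)) => // Pw; rewrite PQ ?size_mkseq//.
Qed.

Lemma ks_prob_all n (P : R -> bool) : is_copula mu ->
  (forall s, P (ks_stat n s)) -> ks_prob n P = 1.
Proof.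
move=> cop allP; rewrite -(Ex_noties n cop); apply: eq_Ex => w.
by rewrite allP andbT.
Qed.

End Probabilities.

Local Notation Ex := (Ex mu0).
Local Notation prob := (ks_prob mu0).

Lemma nice_term_ge n j (sigma : 'S_j) (x : R) :
  nice (fun w => (x <= ks_term n sigma (mkseq w n))%R%:R : R).
Proof.
have h : forall w, `|ks_term n sigma (mkseq w n)| = ks_term n sigma (mkseq w n).
  move=> w; rewrite ger0_norm// /ks_term mulr_ge0 ?sqrtr_ge0//.
  by rewrite mulr_ge0// divr_ge0 ?sqrtr_ge0.
rewrite (_ : (fun w => _) = fun w => (x <= `|ks_term n sigma (mkseq w n)|)%R%:R); last first.
  by apply/funext => w; rewrite h.
apply: nice_ge.
have nD : nice (fun w => sample_density sigma n (mkseq w n) - CS mu0 sigma).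
  by apply: niceB; [exact: nice_sample_density|exact: nice_cst].
apply: niceZ; apply: niceZ.
have [mD [M DM]] := nD; split; last by exists M => w; rewrite normr_id.
move=> d T X mX; apply: (measurableT_comp (f := fun x : R => `|x|)) => //.
exact: mD.
Qed.

(** Chebyshev: the 1/j in the weight cancels the bound j^2 on n times the variance, so that only
    p_sigma remains. *)
Lemma term_ge_prob n j (sigma : 'S_j) (x : R) : (0 < j)%N -> (j <= n)%N -> 0 < x ->
  Ex n (fun w => (x <= ks_term n sigma (mkseq w n))%R%:R) <= pw R j / x ^+ 2.
Proof.
move=> j0 jn x0.
have jR0 : 0 < j%:R :> R by rewrite ltr0n.
have nR0 : 0 < n%:R :> R by rewrite ltr0n (leq_trans j0).
have sn0 : 0 < Num.sqrt n%:R :> R by rewrite sqrtr_gt0.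
have a0 := ks_weight_gt0 j0.
rewrite (@eq_Ex _ _ _ _ (fun w => (x / (Num.sqrt n%:R * ks_weight j) <=
   `|sample_density sigma n (mkseq w n) - CS mu0 sigma|)%R%:R)); last first.
  move=> w; rewrite ler_pdivrMr; last exact: mulr_gt0.
  by rewrite /ks_term mulrA mulrC.
have nD : nice (fun w => sample_density sigma n (mkseq w n) - CS mu0 sigma).
  by apply: niceB; [exact: nice_sample_density|exact: nice_cst].
apply: le_trans (Ex_chebyshev _ _ nD _) _; first by rewrite divr_gt0// mulr_gt0.
have -> : (x / (Num.sqrt n%:R * ks_weight j)) ^+ 2 = x ^+ 2 / (n%:R * (pw R j / j%:R ^+ 2)).
  rewrite expr_div_n exprMn sqr_sqrtr ?ler0n// /ks_weight expr_div_n sqr_sqrtr//.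
  exact/ltW/pw_gt0.
set V := Ex n _.
have -> : V / (x ^+ 2 / (n%:R * (pw R j / j%:R ^+ 2))) =
    (n%:R * V) * (pw R j / j%:R ^+ 2 / x ^+ 2).
  by field; rewrite !gt_eqF ?pw_gt0.
apply: (@le_trans _ _ (j%:R ^+ 2 * (pw R j / j%:R ^+ 2 / x ^+ 2))).
  rewrite ler_wpM2r ?density_variance// divr_ge0 ?sqr_ge0//.
  by rewrite divr_ge0 ?sqr_ge0// ltW// pw_gt0.
rewrite le_eqVlt; apply/orP; left; apply/eqP.
by field; rewrite !gt_eqF.
Qed.

Lemma sum_half_pow (K n : nat) :
  \sum_(K <= i < n) (2 ^+ i.+1)^-1 <= (2 ^+ K)^-1 :> R.
Proof.
have e m : \sum_(K <= i < K + m) (2 ^+ i.+1)^-1 = (2 ^+ K)^-1 - (2 ^+ (K + m))^-1 :> R.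
  elim: m => [|m IH]; first by rewrite addn0 big_geq// subrr.
  rewrite addnS big_nat_recr ?leq_addr//= IH.
  have -> : (2 ^+ (K + m))^-1 = 2 * (2 ^+ (K + m).+1)^-1 :> R.
    by rewrite exprS invfM mulrA divff ?mul1r.
  by ring.
case: (leqP K n) => [/subnKC <-|/ltnW nK].
  by rewrite e lerBlDr lerDl invr_ge0 exprn_ge0.
by rewrite big_geq// invr_ge0 exprn_ge0.
Qed.

(* The weights beat the number j! of patterns of length j, so the large
   patterns contribute uniformly little. *)
Lemma tail_prob (K n : nat) (x : R) : 0 < x ->
  \sum_(j < n.+1 | (K < j)%N) \sum_(sigma : 'S_j)
    Ex n (fun w => (x <= ks_term n sigma (mkseq w n))%R%:R) <=
  gamma_w R / x ^+ 2 / 2 ^+ K.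
Proof.
move=> x0.
apply: (@le_trans _ _ (\sum_(j < n.+1 | (K < j)%N) gamma_w R / x ^+ 2 / 2 ^+ j)).
  apply: ler_sum => j Kj; have j0 : (0 < j)%N by exact: leq_ltn_trans Kj.
  have jn : (j <= n)%N by rewrite -ltnS.
  apply: (@le_trans _ _ (\sum_(sigma : 'S_j) pw R j / x ^+ 2)).
    by apply: ler_sum => sigma _; exact: term_ge_prob.
  rewrite sumr_const card_Sn.
  have f0 : 0 < (j`!)%:R :> R by rewrite ltr0n fact_gt0.
  have f1 : 1 <= (j`!)%:R :> R by rewrite ler1n fact_gt0.
  have -> : pw R j / x ^+ 2 *+ j`! = gamma_w R / x ^+ 2 / 2 ^+ j / (j`!)%:R.
    by rewrite -mulr_natr /pw; field; rewrite !gt_eqF ?exprn_gt0.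
  rewrite ler_pdivrMr// ler_peMr// divr_ge0 ?exprn_ge0// divr_ge0 ?sqr_ge0//.
  exact/ltW/gamma_w_gt0.
rewrite -mulr_sumr ler_wpM2l//.
  by rewrite divr_ge0 ?sqr_ge0// ltW// gamma_w_gt0.
apply: le_trans (sum_half_pow K n).
rewrite -(big_mkord (fun j => (K < j)%N) (fun j => (2 ^+ j)^-1)).
by rewrite -(big_nat_widenl _ 0%N n.+1 xpredT)// big_add1.
Qed.

Lemma nice_tail n (x : R) (P : pred 'I_n.+1) :
  nice (fun w => \sum_(j < n.+1 | P j) \sum_(sigma : 'S_j)
    (x <= ks_term n sigma (mkseq w n))%R%:R : R).
Proof.
by apply: nice_sum => j _; apply: nice_sum => sigma _; exact: nice_term_ge.
Qed.

Lemma Ex_tail n (x : R) (P : pred 'I_n.+1) :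
  \sum_(j < n.+1 | P j) \sum_(sigma : 'S_j)
    Ex n (fun w => (x <= ks_term n sigma (mkseq w n))%R%:R) =
  Ex n (fun w => \sum_(j < n.+1 | P j) \sum_(sigma : 'S_j)
    (x <= ks_term n sigma (mkseq w n))%R%:R).
Proof.
rewrite Ex_sum; last by move=> j _; apply: nice_sum => sigma _; exact: nice_term_ge.
by apply: eq_bigr => j _; rewrite Ex_sum// => sigma _; exact: nice_term_ge.
Qed.

(** The tail bound with K = 0, which covers the patterns of every positive length. *)
Lemma ks_prob_ge n (x : R) : (0 < n)%N -> 0 < x ->
  prob n (fun v => x <= v) <= gamma_w R / x ^+ 2.
Proof.
move=> n0 x0; rewrite -[leRHS]divr1 -[X in _ / X](expr0 2).
apply: le_trans (tail_prob 0 n x0); rewrite Ex_tail.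
apply: le_Ex; [exact: nice_ks_event|exact: nice_tail|] => w.
have sum0 (P : pred 'I_n.+1) : 0 <= \sum_(j < n.+1 | P j) \sum_(sigma : 'S_j)
    (x <= ks_term n sigma (mkseq w n))%R%:R :> R.
  by apply: sumr_ge0 => j _; apply: sumr_ge0 => sigma _; exact: ler0n.
case: (boolP (_ && _)) => //= /andP[_ xks].
have ks0 : 0 < ks_stat n (mkseq w n) by exact: lt_le_trans xks.
have [j [sigma [j0 e]]] := ks_stat_attained n0 ks0.
rewrite (bigD1 j)//= (bigD1 sigma)//= e xks -addrA lerDl addr_ge0//.
by apply: sumr_ge0 => tau _; exact: ler0n.
Qed.

Lemma ks_atom_vanishes (eps : R) : nondegenerate_copula mu0 -> 0 < eps ->
  \forall n \near \oo, forall x, prob n (fun v => v == x) <= eps.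
Proof.
move=> [k [sigma0 [k0 nd]]] eps0.
have [d d0 ball] := density_small_ball k0 nd eps0.
(* At a level below [delta] the term of [sigma0], being at most the maximum, forces its density into
   the ball of radius d / sqrt n around its mean. *)
pose delta := ks_weight k * d.
have a0 := ks_weight_gt0 k0.
have delta0 : 0 < delta by exact: mulr_gt0.
(* Patterns longer than [K] reach [delta] with probability at most eps/2, for all n at once; only
   finitely many patterns are left. *)
have [K Ksmall] : exists K : nat, gamma_w R / delta ^+ 2 / 2 ^+ K <= eps / 2.
  set A := gamma_w R / delta ^+ 2.
  have A0 : 0 < A by rewrite divr_gt0 ?gamma_w_gt0 ?exprn_gt0.
  have [K hK] : exists K : nat, A / (eps / 2) <= K%:R.
    by exists (Num.trunc (A / (eps / 2))).+1; apply: ltW; exact: truncnS_gt.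
  exists K; rewrite ler_pdivrMr ?exprn_gt0// mulrC -ler_pdivrMr ?divr_gt0//.
  apply: le_trans hK _; rewrite -natrX ler_nat.
  exact/ltnW/ltn_expl.
pose N : R := (\sum_(j < K.+1 | (0 < j)%N) \sum_(sigma : 'S_j) 1)%N%:R.
have N0 : 0 <= N by exact: ler0n.
(* The remaining eps/2 is shared among the [N] short patterns; for K = 0 there are none, and [N + 1]
   stays positive. *)
pose e1 := eps / 2 / (N + 1).
have e10 : 0 < e1 by rewrite divr_gt0 ?divr_gt0// ltr_pwDr.
have small : \forall n \near \oo, forall (j : 'I_K.+1) (sigma : 'S_j), (0 < j)%N ->
    forall x, delta <= x -> Ex n (fun w => (ks_term n sigma (mkseq w n) == x)%R%:R) <= e1.
  apply: filter_forall => j; apply: filter_forall => sigma.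
  have [j0|j0] := boolP (0 < j)%N; last by near=> n.
  have := density_atom mu0 sigma j0 (ks_weight_gt0 j0) delta0 e10.
  by apply: filterS => n H _ x; exact: H.
near=> n; move=> x.
have n0 : (0 < n)%N by near: n; exact: nbhs_infty_gt.
have kn : (k <= n)%N by near: n; exact: nbhs_infty_ge.
have Kn : (K <= n)%N by near: n; exact: nbhs_infty_ge.
have bn : forall y, Ex n (fun w => (Num.sqrt n%:R * `|sample_density sigma0 n (mkseq w n) - y| <= d)%R%:R) <= eps.
  by near: n; exact: ball.
have sn : forall (j : 'I_K.+1) (sigma : 'S_j), (0 < j)%N ->
    forall x, delta <= x -> Ex n (fun w => (ks_term n sigma (mkseq w n) == x)%R%:R) <= e1.
  by near: n; exact: small.
case: (ltP x delta) => [xd|dx].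
  apply: le_trans (bn (CS mu0 sigma0)).
  apply: le_Ex; [exact: (nice_ks_event n (fun v => v == x))|exact: nice_le_density|] => w.
  case: (boolP (_ && _)) => //= /andP[_ /eqP ex].
  suff le_d : Num.sqrt n%:R * `|sample_density sigma0 n (mkseq w n) - CS mu0 sigma0| <= d.
    by rewrite le_d.
  have := ks_stat_ge sigma0 (mkseq w n) k0 kn; rewrite ex /ks_term => h.
  have := le_lt_trans h xd; rewrite /delta mulrCA ltr_pM2l// => /ltW //.
pose head w : R := \sum_(j < K.+1 | (0 < j)%N) \sum_(sigma : 'S_j)
   (ks_term n sigma (mkseq w n) == x)%R%:R.
pose tail w : R := \sum_(j < n.+1 | (K < j)%N) \sum_(sigma : 'S_j)
   (delta <= ks_term n sigma (mkseq w n))%R%:R.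
have nterm (j : 'I_K.+1) (sigma : 'S_j) :
    nice (fun w => (ks_term n sigma (mkseq w n) == x)%R%:R : R).
  have := nice_eq_density sigma n (Num.sqrt n%:R * ks_weight j) x (CS mu0 sigma).
  by congr nice; apply/funext => w; rewrite /ks_term /ks_weight -!mulrA.
have nhead : nice head.
  by apply: nice_sum => j _; apply: nice_sum => sigma _; exact: nterm.
have ntail : nice tail by exact: nice_tail.
apply: (@le_trans _ _ (Ex n (fun w => head w + tail w))); last first.
  rewrite ExD// [leRHS]splitr lerD//; last first.
    by rewrite /tail -Ex_tail; apply: le_trans Ksmall; exact: tail_prob.
  rewrite /head Ex_sum; last by move=> j _; apply: nice_sum => sigma _; exact: nterm.
  apply: (@le_trans _ _ (N * e1)); last first.
    have N1 : 0 < N + 1 by exact: ltr_wpDl.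
    rewrite /e1 mulrCA; apply: ler_piMr; first by rewrite ltW// divr_gt0.
    by rewrite ler_pdivrMr// mul1r lerDl.
  rewrite /N natr_sum mulr_suml; apply: ler_sum => j j0.
  rewrite Ex_sum; last by move=> sigma _; exact: nterm.
  rewrite natr_sum mulr_suml; apply: ler_sum => sigma _; rewrite mul1r.
  exact: sn.
apply: le_Ex; [exact: (nice_ks_event n (fun v => v == x))|exact: niceD|] => w.
have tail0 : 0 <= tail w.
  by apply: sumr_ge0 => j _; apply: sumr_ge0 => sigma _; exact: ler0n.
have head0 : 0 <= head w.
  by apply: sumr_ge0 => j _; apply: sumr_ge0 => sigma _; exact: ler0n.
case: (boolP (_ && _)) => [/andP[_ /eqP ex]|_]; last by rewrite addr_ge0.
have ks0 : 0 < ks_stat n (mkseq w n) by rewrite ex; exact: lt_le_trans dx.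
have [j [sigma [j0]]] := ks_stat_attained n0 ks0; rewrite ex => e.
case: (ltnP K j) => [Kj|jK].
  rewrite ler_wpDl// /tail (bigD1 j)//= (bigD1 sigma)//= e dx -addrA lerDl addr_ge0//.
    by apply: sumr_ge0 => tau _; exact: ler0n.
  by rewrite sumr_ge0// => i _; apply: sumr_ge0 => tau _; exact: ler0n.
have jK1 : (j < K.+1)%N by [].
rewrite ler_wpDr// /head (bigD1 (Ordinal jK1))//= (bigD1 sigma)//= e eqxx -addrA lerDl addr_ge0//.
  by apply: sumr_ge0 => tau _; exact: ler0n.
by rewrite sumr_ge0// => i _; apply: sumr_ge0 => tau _; exact: ler0n.
Unshelve. all: by end_near. Qed.

End KolmogorovSmirnov.

(** * Quantile inequalities at a fixed sample size *)

Section Quantiles.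
Set Implicit Arguments.
Unset Strict Implicit.
Variable R : realType.
Local Notation pt := (R * R)%type.
Implicit Types (s : seq pt) (w : nat -> pt).

(** For fixed n the statistic takes finitely many values. The gap next to the quantile stands in for
    continuity of the measure; 1 is the default when no value exceeds q. *)
Lemma finite_gap_right (T : finType) (f : T -> R) (q : R) :
  exists2 e : R, 0 < e & forall x, q < f x -> q + e <= f x.
Proof.
exists (\big[Num.min/1]_(x | q < f x) (f x - q)).
  by apply: lt_bigmin => // x qx; rewrite subr_gt0.
by move=> x qx; rewrite -lerBrDl; apply: bigmin_le_cond.
Qed.

Lemma finite_gap_left (T : finType) (f : T -> R) (q : R) :
  exists2 e : R, 0 < e & forall x, f x < q -> f x <= q - e.
Proof.
have [e e0 H] := finite_gap_right (fun x => - f x) (- q).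
by exists e => // x xq; rewrite -lerN2 opprB addrC H// ltrN2.
Qed.

Variables (mu0 : probability pt R) (alpha : R) (n : nat).
Hypotheses (cop0 : is_copula mu0) (alpha_itv : 0 < alpha < 1) (n_gt0 : (0 < n)%N).
Local Notation prob := (ks_prob mu0 mu0 n).
Local Notation q := (qalpha mu0 alpha n).

Lemma ks_values s : size s = n -> noties s ->
  exists pi : 'S_n, ks_stat mu0 n s = KSGF mu0 pi.
Proof.
by move=> sn nt; have [pi hp] := pattern_exists sn nt; exists pi; rewrite (KSGF_sample _ hp).
Qed.

Let A : set R := [set t : R | prob (fun x => t < x) <= alpha].

Let qE : q = inf A.
Proof.
rewrite /qalpha; congr inf; apply/seteqP; split => t /=;
  by rewrite sampleP_KS_event lee_fin.
Qed.

Let A_lb t : A t -> 0 <= t.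
Proof.
move=> At; rewrite leNgt; apply/negP => t0.
move: At; rewrite /A /= ks_prob_all//.
  by have /andP[_ a1] := alpha_itv; rewrite leNgt a1.
by move=> s; apply: lt_le_trans t0 _; exact: ks_stat_ge0.
Qed.

(** The level at which the Chebyshev bound gamma / t0^2 equals alpha. *)
Let t0 : R := Num.sqrt (gamma_w R / alpha).

Let t0_gt0 : 0 < t0.
Proof. by have /andP[a0 _] := alpha_itv; rewrite sqrtr_gt0 divr_gt0// gamma_w_gt0. Qed.

Let A_t0 : A t0.
Proof.
have /andP[a0 _] := alpha_itv.
rewrite /A /=; apply: (@le_trans _ _ (prob (fun v => t0 <= v))).
  by apply: le_ks_prob => s _ _ /ltW.
apply: le_trans (ks_prob_ge mu0 n_gt0 t0_gt0) _.
rewrite sqr_sqrtr; last by rewrite divr_ge0 ?ltW ?gamma_w_gt0.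
by rewrite invfM invrK mulrA divff ?mul1r// gt_eqF// gamma_w_gt0.
Qed.

Let A_inf : has_inf A.
Proof. by split; [exists t0|exists 0 => t; exact: A_lb]. Qed.

Lemma qalpha_le : q <= Num.sqrt (gamma_w R / alpha).
Proof. by rewrite qE; apply: ge_inf A_t0; case: A_inf. Qed.

(** Some admissible t lies below q + e, and no value of the statistic lies strictly between q and q
    + e. *)
Lemma prob_gt_qalpha : prob (fun x => q < x) <= alpha.
Proof.
have [e e0 gap] := finite_gap_right (fun pi : 'S_n => KSGF mu0 pi) q.
have [t At tq] := inf_adherent e0 A_inf.
rewrite -qE in tq; apply: le_trans At; apply: le_ks_prob => s sn nt qs.
have [pi piE] := ks_values sn nt; rewrite piE in qs *.
exact: lt_le_trans tq (gap _ qs).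
Qed.

(** Otherwise q - e would be admissible as well, because no value lies strictly between q - e and
    q. *)
Lemma prob_ge_qalpha : alpha <= prob (fun x => q <= x).
Proof.
rewrite leNgt; apply/negP => small.
have [e e0 gap] := finite_gap_left (fun pi : 'S_n => KSGF mu0 pi) q.
suff : A (q - e).
  by move=> /(ge_inf A_inf.2); rewrite -qE lerBrDr gerDl leNgt e0.
rewrite /A /=; apply: le_trans (ltW small); apply: le_ks_prob => s sn nt.
have [pi ->] := ks_values sn nt => /= qs.
by rewrite leNgt; apply/negP => /gap; rewrite leNgt qs.
Qed.

Lemma prob_ge_split (x : R) :
  prob (fun v => x <= v) <= prob (fun v => x < v) + prob (fun v => v == x).
Proof.
rewrite /ks_prob -(ExD mu0 n (nice_ks_event mu0 n (fun v => x < v))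
  (nice_ks_event mu0 n (fun v => v == x))).
apply: le_Ex; [exact: nice_ks_event| |] => [|w].
  apply: niceD; first exact: nice_ks_event.
  exact: (nice_ks_event mu0 n (fun v => v == x)).
case: noties => /=; last by rewrite addr0.
by case: (ltgtP x (ks_stat mu0 n (mkseq w n))) => _ /=; rewrite ?addr0 ?add0r.
Qed.

End Quantiles.

(** * Divergence of the statistic under an alternative *)

Section Consistency.
Set Implicit Arguments.
Unset Strict Implicit.
Variable R : realType.
Local Notation pt := (R * R)%type.
Implicit Types (s : seq pt) (w : nat -> pt).
Variables (mu0 mu : probability pt R).

Lemma ks_stat_diverges k (sigma : 'S_k) (t eps : R) : (0 < k)%N -> is_copula mu ->
  CS mu sigma != CS mu0 sigma -> 0 < eps ->
  \forall n \near \oo, 1 - eps <= ks_prob mu0 mu n (fun x => t <= x).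
Proof.
move=> k0 cop ne eps0.
(* Half the distance of the two means: a density within [D] of its own mean is at least [D] away
   from the hypothetical one. *)
set D := `|CS mu sigma - CS mu0 sigma| / 2.
have D0 : 0 < D by rewrite divr_gt0// normr_gt0 subr_eq0.
have a0 := ks_weight_gt0 R k0.
near=> n.
have n1 : (0 < n)%N by near: n; exact: nbhs_infty_gt.
have kn : (k <= n)%N by near: n; exact: nbhs_infty_ge.
have n0 : 0 < n%:R :> R by rewrite ltr0n.
pose dens w := sample_density sigma n (mkseq w n).
have nD : nice (fun w => dens w - CS mu sigma).
  by apply: niceB; [exact: nice_sample_density|exact: nice_cst].
have far : Ex mu n (fun w => (D <= `|dens w - CS mu sigma|)%R%:R) <= eps.
  apply: le_trans (Ex_chebyshev _ _ nD D0) _.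
  rewrite ler_pdivrMr ?exprn_gt0// -(ler_pM2l n0).
  apply: le_trans (density_variance mu sigma k0 kn) _.
  have : k%:R ^+ 2 / (eps * D ^+ 2) <= n%:R by near: n; exact: nbhs_infty_ger.
  by rewrite ler_pdivrMr// mulr_gt0// exprn_gt0.
have tn : t <= Num.sqrt n%:R * (ks_weight R k * D).
  have wD0 : 0 < ks_weight R k * D by exact: mulr_gt0.
  rewrite -ler_pdivrMr//; apply: le_trans (ler_norm _) _.
  have h : `|t / (ks_weight R k * D)| ^+ 2 <= n%:R by near: n; exact: nbhs_infty_ger.
  by rewrite -(@ler_sqr _ `|_|) ?nnegrE ?sqrtr_ge0// sqr_sqrtr// ltW.
apply: (@le_trans _ _ (Ex mu n (fun w => (noties (mkseq w n))%:R -
    (D <= `|dens w - CS mu sigma|)%R%:R))).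
  rewrite ExB; [|exact: nice_noties|exact: nice_ge].
  by rewrite Ex_noties// lerD2l lerN2.
apply: le_Ex; [|exact: nice_ks_event|].
  by apply: niceB; [exact: nice_noties|exact: nice_ge].
move=> w; case: noties => /=; last by rewrite sub0r oppr_le0 ler0n.
case: (leP D `|_|) => [_|close]; first by rewrite subrr ler0n.
suff le_t : t <= ks_stat mu0 n (mkseq w n) by rewrite le_t subr0.
apply: le_trans (ks_stat_ge mu0 sigma (mkseq w n) k0 kn).
apply: le_trans tn _; rewrite /ks_term ler_wpM2l ?sqrtr_ge0// ler_wpM2l ?(ltW a0)//.
have : `|CS mu sigma - CS mu0 sigma| <= `|dens w - CS mu sigma| + `|dens w - CS mu0 sigma|.
  have -> : CS mu sigma - CS mu0 sigma =
    (CS mu sigma - dens w) + (dens w - CS mu0 sigma) by ring.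
  by rewrite [X in _ <= X + _]distrC ler_normD.
by move: close; rewrite /D /dens; lra.
Unshelve. all: by end_near. Qed.

End Consistency.

(** * Pattern probabilities determine the copula *)

Section Determination.
Set Implicit Arguments.
Unset Strict Implicit.
Variable R : realType.
Local Notation pt := (R * R)%type.
Local Notation z0 := (Defs.z0 R).
Implicit Types (s : seq pt) (w : nat -> pt).

Lemma natr_count (T : Type) (a : pred T) (t : seq T) :
  (count a t)%:R = \sum_(x <- t) (a x)%:R :> R.
Proof.
by rewrite -sum1_count natr_sum big_mkcond; apply: eq_bigr => x _; case: (a x).
Qed.

Lemma uniq_below (p : pt -> R) s : uniq (map p s) ->
  let T := map (fun z => count (fun z' => p z' < p z)%R s) s in
  uniq T /\ all (fun x => x < size T)%N T.
Proof.
move=> u /=; split.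
  rewrite map_inj_in_uniq; first exact: map_uniq u.
  move=> a b sa sb e; apply: (uniq_map_inj u) => //.
  have mono x y : x \in s ->
      (count (fun z' => p z' < p x)%R s < count (fun z' => p z' < p y)%R s)%N = (p x < p y).
    by move=> xs; rewrite -(count_lt_mono (s := map p s)) ?map_f// !count_map.
  by apply/eqP; rewrite eq_le !leNgt -!mono// e ltnn.
apply/allP => _ /mapP[z zs ->]; rewrite size_map.
rewrite -(count_predC (fun z' => p z' < p z)%R s) -[X in (X < _)%N]addn0 ltn_add2l -has_count.
by apply/hasP; exists z => //=; rewrite ltxx.
Qed.

(* Both predicates cut out initial segments of the sample in [p]-order, so one
   set contains the other and they differ by the difference of their sizes. *)
Lemma count_symdiff s (p : pt -> R) (m : nat) (u : R) :
  uniq (map p s) -> (m <= size s)%N ->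
  \sum_(z <- s) ((count (fun z' => p z' < p z)%R s < m)%N != (p z <= u)%R)%:R =
  `|(count (fun z => p z <= u)%R s)%:R - m%:R| :> R.
Proof.
move=> us ms.
pose a z := (count (fun z' => p z' < p z)%R s < m)%N.
pose b z := p z <= u.
have ca : count a s = m.
  rewrite -(count_map (fun z => count (fun z' => p z' < p z)%R s) (fun x => x < m)%N).
  by have [h1 h2] := uniq_below us; rewrite count_lt_ranks// size_map.
have mono x y : p x <= p y -> a y -> a x.
  move=> xy; apply: leq_ltn_trans; apply: sub_count => z /= zx.
  exact: lt_le_trans xy.
have -> : m%:R = (count a s)%:R :> R by rewrite ca.
rewrite !natr_count -sumrB.
case: (boolP (has (fun z => a z && ~~ b z) s)) => [/hasP[z zs /andP[az bz]]|/hasPn nab].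
  have ba x : b x -> a x.
    move=> bx; apply: mono az; apply: le_trans bx _; move: bz.
    by rewrite /b -ltNge => /ltW.
  rewrite ler0_norm; last first.
    by apply: sumr_le0 => x _; rewrite subr_le0 ler_nat -/(a x) -/(b x);
      case: (boolP (b x)) => // /ba ->.
  rewrite -sumrN; apply: eq_bigr => x _; rewrite -/(a x) -/(b x).
  by case: (boolP (b x)) => [/ba ->|_]; case: (a x) => /=; rewrite ?subrr ?oppr0 ?sub0r ?opprK.
have ab x : x \in s -> a x -> b x.
  by move=> /nab; rewrite negb_and negbK => /orP[/negbTE ->|].
rewrite ger0_norm; last first.
  rewrite big_seq; apply: sumr_ge0 => x xs; rewrite subr_ge0 ler_nat -/(a x) -/(b x).
  by case: (boolP (a x)) => // /(ab x xs) ->.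
rewrite big_seq [RHS]big_seq; apply: eq_bigr => x xs; rewrite -/(a x) -/(b x).
by case: (boolP (a x)) => [/(ab x xs) ->|_]; case: (b x) => /=; rewrite ?subrr ?subr0.
Qed.

(** The empirical copula of the sample at (m1/k, m2/k). *)
Definition rank_cdf k (m1 m2 : nat) s : R :=
  (count (fun z => (below1 s z < m1)%N && (below2 s z < m2)%N) s)%:R / k%:R.

(** The same empirical copula, read off the permutation. *)
Definition perm_cdf k (m1 m2 : nat) (pi : 'S_k) : R :=
  (count (fun x => (x < m1)%N && (permn pi x < m2)%N) (iota 0 k))%:R / k%:R.

Lemma rank_cdf_pattern k m1 m2 (pi : 'S_k) s : has_pattern pi s ->
  rank_cdf k m1 m2 s = perm_cdf m1 m2 pi.
Proof.
rewrite has_patternE => /and4P[/eqP sk u1 _ /allP h].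
rewrite /rank_cdf /perm_cdf; congr (_%:R / _).
rewrite (@eq_in_count _ _ (fun z => (below1 s z < m1)%N && (permn pi (below1 s z) < m2)%N)).
  rewrite -(count_map (below1 s) (fun x => (x < m1)%N && (permn pi x < m2)%N)).
  have [h1 h2] := uniq_below u1.
  by rewrite (seq.permP (perm_eq_iota h1 h2)) size_map sk.
by move=> z zs /=; rewrite (eqP (h z zs)).
Qed.

Lemma sum_patterns k m1 m2 s : size s = k ->
  \sum_(pi : 'S_k) (has_pattern pi s)%:R * perm_cdf m1 m2 pi =
  (noties s)%:R * rank_cdf k m1 m2 s.
Proof.
move=> sk; case: (boolP (noties s)) => nt.
  have [pi hp] := pattern_exists sk nt.
  rewrite (bigD1 pi)//= hp mul1r mul1r big1 ?addr0 ?(rank_cdf_pattern _ _ hp)//.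
  move=> pi' ne; rewrite (_ : has_pattern pi' s = false) ?mul0r//.
  by apply/negbTE; apply: contra ne => hp'; rewrite (pattern_unique hp' hp).
rewrite mul0r big1// => pi _; rewrite (_ : has_pattern pi s = false) ?mul0r//.
by apply/negbTE; apply: contra nt; rewrite /has_pattern => /andP[/andP[]].
Qed.

Section OneCopula.
Variable mu : probability pt R.
Local Notation Ex := (Ex mu).
Hypothesis cop : is_copula mu.

Lemma nice_has_pattern k (pi : 'S_k) : nice (fun w => (has_pattern pi (mkseq w k))%:R : R).
Proof. by apply: nice_seq_pattern; exact: size_iota. Qed.

Lemma Ex_rank_cdf k m1 m2 :
  Ex k (fun w => (noties (mkseq w k))%:R * rank_cdf k m1 m2 (mkseq w k)) =
  \sum_(pi : 'S_k) CS mu pi * perm_cdf m1 m2 pi.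
Proof.
rewrite (@eq_Ex _ _ _ _ (fun w =>
  \sum_(pi : 'S_k) perm_cdf m1 m2 pi * (has_pattern pi (mkseq w k))%:R)); last first.
  move=> w; rewrite -sum_patterns ?size_mkseq//.
  by apply: eq_bigr => pi _; rewrite mulrC.
rewrite Ex_sum; last by move=> pi _; apply: niceZ; exact: nice_has_pattern.
apply: eq_bigr => pi _; rewrite ExZ; last exact: nice_has_pattern.
by rewrite mulrC CSE.
Qed.

Lemma nice_rank_cdf k m1 m2 :
  nice (fun w => (noties (mkseq w k))%:R * rank_cdf k m1 m2 (mkseq w k)).
Proof.
rewrite (_ : (fun w => _) = (fun w =>
  \sum_(pi : 'S_k) perm_cdf m1 m2 pi * (has_pattern pi (mkseq w k))%:R)).
  by apply: nice_sum => pi _; apply: niceZ; exact: nice_has_pattern.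
apply/funext => w; rewrite -sum_patterns ?size_mkseq//.
by apply: eq_bigr => pi _; rewrite mulrC.
Qed.

Lemma marginal_deviation (p : pt -> R) (k : nat) (u : R) : (0 < k)%N -> 0 <= u <= 1 ->
  uniform_marginal mu p ->
  nice (fun w => `|\sum_(i < k) ((p (w i) <= u)%R%:R - u)|) /\
  Ex k (fun w => `|\sum_(i < k) ((p (w i) <= u)%R%:R - u)|) <= Num.sqrt k%:R.
Proof.
move=> k0 /andP[u0 u1] up; have [mp _] := up.
have n1 i : nice (fun w => (p (w i) <= u)%R%:R - u).
  by apply: niceB; [exact: nice_marginal_cdf|exact: nice_cst].
have nS : nice (fun w => \sum_(i < k) ((p (w i) <= u)%R%:R - u)).
  by apply: nice_sum => i _; exact: n1.
have nA : nice (fun w => `|\sum_(i < k) ((p (w i) <= u)%R%:R - u)|).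
  have [mS [M SM]] := nS; split; last by exists M => w; rewrite normr_id.
  move=> d T X mX; apply: (measurableT_comp (f := fun x : R => `|x|)) => //.
  exact: mS.
split => //.
have kR0 : 0 < k%:R :> R by rewrite ltr0n.
set sk := Num.sqrt k%:R; have sk0 : 0 < sk by rewrite sqrtr_gt0.
have skk : sk * sk = k%:R by rewrite -expr2 sqr_sqrtr// ltW.
have m2 : Ex k (fun w => (\sum_(i < k) ((p (w i) <= u)%R%:R - u)) ^+ 2) <= k%:R.
  apply: le_trans (_ : 1 ^+ 2 * (\sum_(i < k) \sum_(j < k) (i == j))%:R <= _); last first.
    rewrite expr1n mul1r ler_nat -[leqRHS]card_ord -sum1_card leq_sum// => i _.
    by rewrite (bigD1 i)//= eqxx big1// => j; rewrite eq_sym => /negbTE ->.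
  apply: second_moment_le => [i _|i w _|i j _ _ ij]; first exact: n1.
    by case: (p (w i) <= u); rewrite ler_norml /=; lra.
  apply: (Ex_orthogonal (l := [:: val j])); [exact: n1|exact: n1|..].
  - by move=> l; rewrite inE mem_iota add0n => /eqP ->; rewrite ltn_ord.
  - by move=> v v' vv'; rewrite vv'// inE.
  - move=> w; rewrite /= EcoordD; [|exact: nice_marginal_cdf|exact: nice_cst].
    rewrite Ecoord_cst (Ecoord_marginal_cdf _ _ _ up) /clamp01.
    by rewrite (max_idPr u0) (min_idPr u1) subrr.
(* The inequality |x| <= x^2 / (2 sk) + sk / 2 takes the place of Cauchy-Schwarz. *)
apply: (@le_trans _ _ (Ex k (fun w => (2 * sk)^-1 *
   (\sum_(i < k) ((p (w i) <= u)%R%:R - u)) ^+ 2 + sk / 2))).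
  apply: le_Ex => //; first by apply: niceD; [apply/niceZ/nice_sqr|exact: nice_cst].
  move=> w; set x := \sum_(i < k) _.
  rewrite -(ler_pM2l (mulr_gt0 (ltr0n R 2) sk0)) mulrDr mulrA divff ?mul1r; last first.
    by rewrite gt_eqF// mulr_gt0.
  have : 0 <= (`|x| - sk) ^+ 2 by rewrite sqr_ge0.
  by rewrite sqrrB real_normK ?num_real//; lra.
rewrite ExD; [|by apply/niceZ/nice_sqr|exact: nice_cst].
rewrite Ex_cst ExZ; last exact: nice_sqr.
have : (2 * sk)^-1 * Ex k (fun w => (\sum_(i < k) ((p (w i) <= u)%R%:R - u)) ^+ 2) <= sk / 2.
  rewrite mulrC ler_pdivrMr ?mulr_gt0//; apply: le_trans m2 _.
  by rewrite -skk; lra.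
by lra.
Qed.

Lemma trunc_close (k : nat) (u : R) : 0 <= u <= 1 ->
  (Num.trunc (u * k%:R) <= k)%N /\ `|u * k%:R - (Num.trunc (u * k%:R))%:R| <= 1.
Proof.
move=> /andP[u0 u1]; have uk0 : 0 <= u * k%:R by rewrite mulr_ge0.
have /andP[t1 t2] := truncn_itv uk0; split.
  by rewrite -(ler_nat R) (le_trans t1)// ler_piMl.
by rewrite ler_norml; move: t1 t2; rewrite -natr1; lra.
Qed.

Lemma rank_cdf_close (k : nat) (u v : R) : (0 < k)%N -> 0 <= u <= 1 -> 0 <= v <= 1 ->
  `|\sum_(pi : 'S_k) CS mu pi *
      perm_cdf (Num.trunc (u * k%:R)) (Num.trunc (v * k%:R)) pi -
    copula_fun mu u v| <= 4 / Num.sqrt k%:R.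
Proof.
move=> k0 u01 v01.
set m1 := Num.trunc (u * _); set m2 := Num.trunc (v * _).
have [um1 uc1] := trunc_close k u01; have [vm2 vc2] := trunc_close k v01.
rewrite -/m1 in um1 uc1; rewrite -/m2 in vm2 vc2.
have [up1 up2] := is_copula_marginals cop.
have kR0 : 0 < k%:R :> R by rewrite ltr0n.
have [n1 d1] := marginal_deviation k0 u01 up1.
have [n2 d2] := marginal_deviation k0 v01 up2.
set sk := Num.sqrt k%:R; have sk0 : 0 < sk by rewrite sqrtr_gt0.
have skk : sk * sk = k%:R by rewrite -expr2 sqr_sqrtr// ltW.
pose A w : R := (noties (mkseq w k))%:R * rank_cdf k m1 m2 (mkseq w k).
pose B w : R := k%:R^-1 * \sum_(i < k) ((w i).1 <= u)%R%:R * ((w i).2 <= v)%R%:R.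
pose S1 w : R := `|\sum_(i < k) (((w i).1 <= u)%R%:R - u)|.
pose S2 w : R := `|\sum_(i < k) (((w i).2 <= v)%R%:R - v)|.
(* The 2 accounts for the two truncations. Since ties have probability zero, the mean of [C] is at
   most (2 sqrt k + 2) / k, hence at most 4 / sqrt k. *)
pose C w : R := 1 - (noties (mkseq w k))%:R + k%:R^-1 * (S1 w + (S2 w + 2)).
have nbox i : nice (fun w => ((w i).1 <= u)%R%:R * ((w i).2 <= v)%R%:R : R).
  by apply: niceM; [apply: (nice_marginal_cdf (p := fst)); exact: measurable_fst
                   |apply: (nice_marginal_cdf (p := snd)); exact: measurable_snd].
have nA : nice A by exact: nice_rank_cdf.
have nB : nice B by apply: niceZ; apply: nice_sum => i _; exact: nbox.
have nS : nice (fun w => S1 w + (S2 w + 2)).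
  by apply: niceD => //; apply: niceD => //; exact: nice_cst.
have nN : nice (fun w => 1 - (noties (mkseq w k))%:R : R).
  by apply: niceB; [exact: nice_cst|exact: nice_noties].
have nC : nice C by apply: niceD => //; exact: niceZ.
have EB : Ex k B = copula_fun mu u v.
  rewrite /B ExZ; last by apply: nice_sum => i _; exact: nbox.
  rewrite Ex_sum; last by move=> i _; exact: nbox.
  rewrite (eq_bigr (fun=> copula_fun mu u v)).
    by rewrite sumr_const card_ord -[copula_fun mu u v *+ k]mulr_natl mulKf// gt_eqF.
  move=> i _; rewrite (@Ex_absorb _ _ _ [:: val i])//; last first.
    by move=> j; rewrite inE mem_iota add0n => /eqP ->; rewrite ltn_ord.
  rewrite (_ : Eseq _ _ _ = fun=> copula_fun mu u v) ?Ex_cst//.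
  apply/funext => w /=; rewrite (_ : (fun _ => _) =
    fun w : nat -> pt => (((w i).1 <= u)%R && ((w i).2 <= v)%R)%:R); last first.
    by apply/funext => w'; rewrite -natrM mulnb.
  rewrite (@Ecoord_bool _ mu (fun z => (z.1 <= u) && (z.2 <= v))).
    rewrite /copula_fun; congr (fine (mu _)); apply/seteqP; split => z /=.
      by move=> /andP[].
    by move=> [-> ->].
  by apply: measurable_and; apply: measurable_fun_ler => //; exact: measurable_cst.
have EC : Ex k C <= 4 / sk.
  rewrite /C ExD//; last exact: niceZ.
  rewrite ExB; [|exact: nice_cst|exact: nice_noties].
  rewrite Ex_cst Ex_noties// subrr add0r ExZ//.
  rewrite ExD//; last by apply: niceD => //; exact: nice_cst.
  rewrite ExD//; last exact: nice_cst.
  rewrite Ex_cst mulrC ler_pdivrMr//.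
  have -> : 4 / sk * k%:R = 4 * sk by rewrite -skk; field; rewrite gt_eqF.
  have sk1 : 1 <= sk by rewrite -sqrtr1 ler_sqrt// ler1n.
  by move: d1 d2; rewrite -/sk; lra.
have close w : `|A w - B w| <= C w.
  (* The two counts differ at most at the points where a rank test and the corresponding value test
     disagree; [count_symdiff] evaluates their number in each coordinate. *)
  have key : noties (mkseq w k) -> `|rank_cdf k m1 m2 (mkseq w k) - B w| <=
     k%:R^-1 * (S1 w + (S2 w + 2)).
    rewrite notiesE => /andP[q1 q2].
    set s := mkseq w k in q1 q2 *; have sk' : size s = k by rewrite size_mkseq.
    have sumE (f : pt -> R) : \sum_(i < k) f (w i) = \sum_(z <- s) f z.
      by rewrite /s big_map -(big_mkord xpredT (fun i => f (w i))) /index_iota subn0.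
    have S1E : S1 w = `|(count (fun z => z.1 <= u)%R s)%:R - u * k%:R|.
      by rewrite /S1 sumrB (sumE (fun z => (z.1 <= u)%R%:R)) natr_count sumr_const
        card_ord mulr_natr.
    have S2E : S2 w = `|(count (fun z => z.2 <= v)%R s)%:R - v * k%:R|.
      by rewrite /S2 sumrB (sumE (fun z => (z.2 <= v)%R%:R)) natr_count sumr_const
        card_ord mulr_natr.
    rewrite /rank_cdf /B (sumE (fun z => (z.1 <= u)%R%:R * (z.2 <= v)%R%:R)) mulrC.
    rewrite -mulrBr normrM ger0_norm ?invr_ge0// ler_wpM2l ?invr_ge0//.
    rewrite natr_count -sumrB.
    have sum1 := count_symdiff u q1 (_ : (m1 <= size s)%N).
    have sum2 := count_symdiff v q2 (_ : (m2 <= size s)%N).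
    rewrite sk' in sum1 sum2; have {}sum1 := sum1 um1; have {}sum2 := sum2 vm2.
    apply: (@le_trans _ _ (`|(count (fun z => z.1 <= u)%R s)%:R - m1%:R| +
       `|(count (fun z => z.2 <= v)%R s)%:R - m2%:R|)).
      rewrite -sum1 -sum2 -big_split /=.
      apply: le_trans (ler_norm_sum _ _ _) _; apply: ler_sum => z _.
      rewrite -/(below1 s z) -/(below2 s z).
      case: (below1 s z < m1)%N; case: (below2 s z < m2)%N;
        case: (z.1 <= u); case: (z.2 <= v) => /=;
        rewrite ?mulr1 ?mulr0 ?mul0r ?subr0 ?sub0r ?subrr ?normrN ?normr1 ?normr0; lra.
    rewrite S1E S2E.
    have h1 : `|(count (fun z => z.1 <= u)%R s)%:R - m1%:R| <=
      `|(count (fun z => z.1 <= u)%R s)%:R - u * k%:R| + `|u * k%:R - m1%:R|.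
      by apply: le_trans (ler_normD _ _); rewrite subrKA.
    have h2 : `|(count (fun z => z.2 <= v)%R s)%:R - m2%:R| <=
      `|(count (fun z => z.2 <= v)%R s)%:R - v * k%:R| + `|v * k%:R - m2%:R|.
      by apply: le_trans (ler_normD _ _); rewrite subrKA.
    by move: h1 h2 uc1 vc2; lra.
  rewrite /A /C; case: (boolP (noties _)) => [/key|_] /=.
    by rewrite mul1r subrr add0r.
  rewrite mul0r sub0r normrN subr0; apply: (@le_trans _ _ 1).
    rewrite ger0_norm; last first.
      by rewrite mulr_ge0 ?invr_ge0// sumr_ge0// => i _; rewrite mulr_ge0.
    rewrite /B mulrC ler_pdivrMr// mul1r.
    have -> : k%:R = \sum_(i < k) 1 :> R by rewrite sumr_const card_ord.
    apply: ler_sum => i _.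
    by case: (_ <= u); case: (_ <= v); rewrite /= ?mulr1 ?mulr0 ?mul0r.
  by rewrite lerDl mulr_ge0 ?invr_ge0// addr_ge0 ?normr_ge0// addr_ge0 ?normr_ge0.
rewrite -Ex_rank_cdf -/A -EB -ExB// ler_norml; apply/andP; split.
  rewrite lerNl; apply: le_trans EC; rewrite -mulN1r -ExZ; last exact: niceB.
  apply: le_Ex => //; first by apply: niceZ; exact: niceB.
  by move=> w; have := close w; rewrite ler_norml mulN1r lerNl => /andP[].
apply: le_trans EC; apply: le_Ex => //; first exact: niceB.
by move=> w; have := close w; rewrite ler_norml => /andP[].
Qed.

End OneCopula.

Lemma patterns_determine_copula (mu mu0 : probability pt R) (u v : R) :
  is_copula mu -> is_copula mu0 -> 0 <= u <= 1 -> 0 <= v <= 1 ->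
  (forall k (sigma : 'S_k), (0 < k)%N -> CS mu sigma = CS mu0 sigma) ->
  copula_fun mu u v = copula_fun mu0 u v.
Proof.
move=> cop cop0 u01 v01 eqCS; apply/eqP/negPn/negP => ne.
set D := `|copula_fun mu u v - copula_fun mu0 u v|.
have D0 : 0 < D by rewrite normr_gt0 subr_eq0.
(* Two approximation errors of 4 / sqrt k give D <= 8 / sqrt k, which this k contradicts. *)
set k := (Num.trunc ((8 / D) ^+ 2)).+1.
have hk : (8 / D) ^+ 2 < k%:R by exact: truncnS_gt.
have k0 : (0 < k)%N by [].
have kR0 : 0 < k%:R :> R by rewrite ltr0n.
have h := rank_cdf_close cop k0 u01 v01; have h0 := rank_cdf_close cop0 k0 u01 v01.
rewrite (eq_bigr (fun pi : 'S_k => CS mu0 pi *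
  perm_cdf (Num.trunc (u * k%:R)) (Num.trunc (v * k%:R)) pi)) in h; last first.
  by move=> pi _; rewrite eqCS.
move: h h0; set X := \sum_(pi : 'S_k) _ => h h0.
set sk := Num.sqrt k%:R in h h0; have sk0 : 0 < sk by rewrite sqrtr_gt0.
have : D <= 4 / sk + 4 / sk.
  rewrite (le_trans _ (lerD h h0))// /D [X in _ <= X + _]distrC.
  by apply: le_trans (ler_normD _ _); rewrite subrKA.
have lt8 : 8 / D < sk.
  rewrite -(@ltr_sqr _ (8 / D)) ?nnegrE ?(ltW sk0)//.
    by rewrite sqr_sqrtr// ltW.
  by rewrite ltW// divr_gt0.
move: lt8; rewrite ltr_pdivrMr// => lt8.
rewrite -mulrDl ler_pdivlMr// leNgt => /negP; apply.
by rewrite mulrC; move: lt8; lra.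
Qed.

End Determination.

Theorem theorem4p3 (R : realType) (mu0 : probability (R * R)%type R)
  (alpha : R) :
  is_copula mu0 -> nondegenerate_copula mu0 -> 0 < alpha < 1 ->
  ((fun n => sampleP mu0 n
       (KS_event mu0 n (fun x => qalpha mu0 alpha n <= x)))
     @ \oo --> alpha%:E) /\
  (forall mu : probability (R * R)%type R, is_copula mu ->
     (exists u v : R, 0 <= u <= 1 /\ 0 <= v <= 1 /\
        copula_fun mu u v != copula_fun mu0 u v) ->
     (fun n => sampleP mu n
       (KS_event mu0 n (fun x => qalpha mu0 alpha n <= x)))
     @ \oo --> 1%:E).
Proof.
move=> cop0 nd alpha_itv; split=> [|mu cop [u [v [u01 [v01 ne]]]]].
  rewrite (_ : (fun n => _) = (fun n => (ks_prob mu0 mu0 n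
    (fun x => qalpha mu0 alpha n <= x))%:E)); last first.
    by apply/funext => n; rewrite sampleP_KS_event.
  apply: cvg_EFin; first by near=> n.
  apply/cvgrPdist_le => eps eps0; near=> n.
  have n0 : (0 < n)%N by near: n; exact: nbhs_infty_gt.
  have atom : forall x, ks_prob mu0 mu0 n (fun v => v == x) <= eps.
    by near: n; exact: ks_atom_vanishes.
  have h1 := prob_ge_qalpha cop0 alpha_itv n0.
  have h2 := prob_gt_qalpha cop0 alpha_itv n0.
  have h3 := prob_ge_split mu0 n (qalpha mu0 alpha n).
  have h4 := atom (qalpha mu0 alpha n).
  by rewrite /= distrC ger0_norm ?subr_ge0//; lra.
have [k [sigma [k0 neCS]]] : exists k (sigma : 'S_k), (0 < k)%N /\
    CS mu sigma != CS mu0 sigma.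
  apply: contrapT => H; move/negP: ne; apply; apply/eqP.
  apply: patterns_determine_copula => // k sigma k0; apply/eqP/negPn/negP => neCS.
  by apply: H; exists k, sigma.
rewrite (_ : (fun n => _) = (fun n => (ks_prob mu0 mu n
  (fun x => qalpha mu0 alpha n <= x))%:E)); last first.
  by apply/funext => n; rewrite sampleP_KS_event.
apply: cvg_EFin; first by near=> n.
apply/cvgrPdist_le => eps eps0; near=> n.
have n0 : (0 < n)%N by near: n; exact: nbhs_infty_gt.
have qle := qalpha_le cop0 alpha_itv n0.
(* The quantile depends on n; it is replaced by its uniform bound, to which the divergence at a
   fixed level applies. *)
have h1 : 1 - eps <= ks_prob mu0 mu n (fun x => Num.sqrt (gamma_w R / alpha) <= x).
  by near: n; exact: (ks_stat_diverges _ k0 cop neCS eps0).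
have h2 : ks_prob mu0 mu n (fun x => Num.sqrt (gamma_w R / alpha) <= x) <=
    ks_prob mu0 mu n (fun x => qalpha mu0 alpha n <= x).
  by apply: le_ks_prob => s _ _; exact: le_trans.
have h3 : ks_prob mu0 mu n (fun x => qalpha mu0 alpha n <= x) <= 1.
  rewrite -(Ex_noties n cop); apply: le_Ex.
  - exact: nice_ks_event.
  - exact: nice_noties.
  - by move=> w; rewrite ler_nat; case: noties => //=; exact: leq_b1.
by rewrite /= ger0_norm ?subr_ge0//; lra.
Unshelve. all: by end_near. Qed.
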